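(* Let $M=\mathrm{diag}(m_1,\dots,m_d)$, $m_i\in\mathbb{Z}$, be a diagonal dilation matrix, $m=|\det M|$. Let $2\le p\le\infty$, $1/p+1/q=1$, and $N\ge0$. Suppose that $\{\widetilde\varphi_j\}_j\in\mathcal{S}'_{N,p}$, $\{\varphi_j\}_j\in\mathcal{B}$ with respect to the parameter $\delta\in(0,1/2)$, and $\{\varphi_j\}_j$ and $\{\widetilde\varphi_j\}_j$ are weakly compatible of order $s>0$. Then, for any $f\in\mathbb{B}_{p,1}^{d/p+N}(M)$ and $j\in\mathbb{N}$, we have $$\|f-Q_j(f,\varphi_j,\widetilde\varphi_j)\|_p\le C\Big(\|M^{-j}\|^s\,\|f\|^{In}_{A_q^s,j}+K_{\varphi_j,q}\,m^{-j(\frac1p+\frac Nd)}\sum_{\nu=j}^\infty m^{(\frac1p+\frac Nd)\nu}E_{\delta M^\nu}(f)_p\Big).$$ If, additionally, $\{\widetilde\varphi_j\}_j\in\mathcal{L}_q$, then for any $f\in L_p$ and $j\in\mathbb N$ we have $$\|f-Q_j(f,\varphi_j,\widetilde\varphi_j)\|_p\le C\Big(\|M^{-j}\|^s\,\|f\|^{In}_{A_q^s,j}+K_{\varphi_j,q}\,\|\widetilde\varphi_j\|_{\mathcal{L}_{q,j}}\,E_{\delta M^j}(f)_p\Big).$$ Here the constant $C$ does not depend on $f$ and $j$.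
   Context: Notation. $\mathbb{T}^d=\mathbb{R}^d/\mathbb{Z}^d$, $L_p=L_p(\mathbb{T}^d)$ with norm $\|\cdot\|_p$, $|\cdot|$ Euclidean norm, $\|\cdot\|$ for matrices is the operator norm, $\widehat f(k)$ Fourier coefficients with respect to $e^{2\pi i(k,x)}$. A dilation matrix is an integer matrix all of whose eigenvalues have absolute value $>1$. $M^*$ is the adjoint of $M$ (here $M^*=M$), $M^{*j}=(M^* )^j$, $M^{*-j}=(M^* )^{-j}$. $D(A):=A[-1/2,1/2)^d\cap\mathbb{Z}^d$. $B_r(a)$ is the ball of radius $r$ centered at $a$. $\operatorname{spec}T=\{k\in\mathbb{Z}^d:\widehat T(k)\ne0\}$. Periodic distributions are continuous linear functionals on $C^\infty(\mathbb{T}^d)$, with Fourier coefficients of at most polynomial growth; $T*\widetilde\varphi$ has Fourier coefficients $\widehat T(k)\widehat{\widetilde\varphi}(k)$. Sequences are indexed by $j\in\mathbb{N}$. $\|f\|^{In}_{A_q^s,j}=\Big(\sum_{k\in D(M^{*j})}|\widehat f(k)|^q(1+|k|^2)^{sq/2}\Big)^{1/q}$ (here $1\le q\le2$). Class $\mathcal{B}=\mathcal{B}_{\delta,R}$: sequences of trigonometric polynomials $\varphi_j$ such that, for some constants $R,\delta,C'_\varphi>0$ independent of $j$, $\operatorname{spec}\varphi_j\subset M^{*j}\big(B_R(\mathbf 0)\setminus\bigcup_{n\in\mathbb{Z}^d\setminus\{\mathbf 0\}}B_\delta(n)\big)$ and $|\widehat{\varphi_j}(l)|\le C'_\varphi$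 for all $j\in\mathbb{N}$, $l\in\mathbb{Z}^d$; ''with respect to the parameter $\delta$'' refers to this $\delta$. Weak compatibility of order $s$: there is a constant $b_0$ with $|1-\widehat{\varphi_j}(r)\overline{\widehat{\widetilde\varphi_j}(r)}|\le b_0|M^{*-j}r|^s$ for all $r\in D(M^{*j})$ and all $j\in\mathbb{N}$. Class $\mathcal{S}'_{N,p}$: sequences of periodic distributions $\{\widetilde\varphi_j\}_j$ such that (with constants independent of $j$) $|\widehat{\widetilde\varphi_j}(k)|\le C_{\widetilde\varphi}|M^{*-j}k|^N$ for $k\in\mathbb{Z}^d\setminus D(M^{*j})$, $|\widehat{\widetilde\varphi_j}(k)|\le C_{\widetilde\varphi}$ for $k\in D(M^{*j})$, and for every trigonometric polynomial $T_n$ with $\operatorname{spec}T_n\subset\{k\in\mathbb{Z}^d:|M^{-n}k|\le1\}$ one has $\|T_n*\widetilde\varphi_j\|_p\le C_{\widetilde\varphi,p}\,m^{\frac Nd(n-j)}\|T_n\|_p$ for all $n\ge j$, $n,j\in\mathbb{N}$. Class $\mathcal{L}_q$: sequences of periodic functions $\{\widetilde\varphi_j\}_j$ such that for all $j\in\mathbb{N}$ the quantity $\|\widetilde\varphi_j\|_{\mathcal{L}_{q,j}}=\Big(m^j\int_{M^{-j}\mathbb{T}^d}\Big(\frac1{m^j}\sum_{k\in D(M^j)}|\widetilde\varphi_j(x-M^{-j}k)|\Big)^qdx\Big)^{1/q}$ is finite (integration over $M^{-j}[-1/2,1/2)^d$; here $q<\infty$). Best approximation: $E_A(f)_p=\inf\{\|f-T\|_p: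 T \text{ trigonometric polynomial},\ \operatorname{spec}T\subset\{k\in\mathbb{Z}^d:|A^{-1}k|<1\}\}$. Besov space: $f\in\mathbb{B}^s_{p,1}(M)$ iff $f\in L_p$ and $\|f\|_p+\sum_{\nu=1}^\infty m^{\frac sd\nu}E_{M^\nu}(f)_p<\infty$ (the same formula is used when the smoothness $d/p+N$ equals $0$). Multiplier norm: $K_{\varphi_j,q}=\sup_{\|g\|_q\le1}\Big\|\sum_{k\in\mathbb{Z}^d}\widehat{\varphi_j}(k)\widehat g(k)e^{2\pi i(k,\cdot)}\Big\|_q$. Operators: $Q_j(f,\varphi_j,\widetilde\varphi_j)=\frac1{m^j}\sum_{k\in D(M^j)}\langle f,\widetilde\varphi_j(\cdot-M^{-j}k)\rangle\varphi_j(\cdot-M^{-j}k)$. For a trigonometric polynomial $T$, $\langle T,\widetilde\varphi_j(\cdot-M^{-j}k)\rangle=\sum_{l}\widehat T(l)\overline{\widehat{\widetilde\varphi_j}(l)}e^{2\pi i(k,M^{*-j}l)}$. For $\{\widetilde\varphi_j\}_j\in\mathcal{S}'_{N,p}$ and $f\in\mathbb{B}_{p,1}^{d/p+N}(M)$, $\langle f,\widetilde\varphi_j(\cdot-M^{-j}k)\rangle:=\lim_{\mu\to\infty}\langle T_\mu,\widetilde\varphi_j(\cdot-M^{-j}k)\rangle$, where $T_\mu$, $\mu\in\mathbb{Z}_+$, are any trigonometric polynomials with $\operatorname{spec}T_\mu\subset D(M^\mu)$ and $\|f-T_\mu\|_p\le\sigma E_{\delta M^\mu}(f)_p$, $\sigma$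 being independent of $f$ and $\mu$ (the limit exists and does not depend on the choice of $T_\mu$). If $\{\widetilde\varphi_j\}_j\in\mathcal{L}_q$ and $f\in L_p$, then $\langle f,\widetilde\varphi_j(\cdot-M^{-j}k)\rangle=\int_{\mathbb{T}^d}f(t)\overline{\widetilde\varphi_j(t-M^{-j}k)}\,dt$. *)

(* Defs.v *)
From HB Require Import structures.
From mathcomp Require Import all_boot all_order all_algebra.
From mathcomp Require Import all_classical all_reals all_analysis.
From mathcomp Require Import complex.

Set Implicit Arguments.
Unset Strict Implicit.
Unset Printing Implicit Defensive.
Import Order.TTheory GRing.Theory Num.Theory.
Import numFieldNormedType.Exports.
Import ComplexField.Normc.

Local Open Scope classical_set_scope.
Local Open Scope ring_scope.
Local Open Scope complex_scope.

(* Column vectors carry the product sigma-algebra, i.e. the one generated by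
   the coordinate maps (the Borel sets when the entries are real). *)
Section measurable_cV.
Context {disp} {T : sigmaRingType disp} (n : nat).

Definition cV_coord : 'I_n -> 'cV[T]_n -> T := fun i x => x i ord0.

Let cV_set0 : g_sigma_preimage cV_coord set0.
Proof. exact: sigma_algebra0. Qed.

Let cV_setC A : g_sigma_preimage cV_coord A -> g_sigma_preimage cV_coord (~` A).
Proof. exact: sigma_algebraC. Qed.

Let cV_bigcup (F : _^nat) : (forall i, g_sigma_preimage cV_coord (F i)) ->
  g_sigma_preimage cV_coord (\bigcup_i (F i)).
Proof. exact: sigma_algebra_bigcup. Qed.

HB.instance Definition _ := @isMeasurable.Build (measure_tuple_display disp)
  'cV[T]_n (g_sigma_preimage cV_coord) cV_set0 cV_setC cV_bigcup.

End measurable_cV.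

Section torus_measure.
Context {R : realType}.

Definition cV_cons (n : nat) (x : measurableTypeR R * 'cV[R]_n) : 'cV[R]_n.+1 :=
  col_mx ((x.1 : R)%:M : 'cV_1) x.2.

Lemma measurable_coord n (i : 'I_n) :
  measurable_fun [set: 'cV[R]_n] (fun x : 'cV[R]_n => x i ord0).
Proof.
move=> _ Y mY; rewrite setTI; apply: sub_sigma_algebra => /=.
rewrite -bigcup_seq/=; exists i => /=; first by rewrite mem_index_enum.
by exists Y => //; rewrite setTI.
Qed.

Lemma measurable_to_cV disp (T : measurableType disp) n (f : T -> 'cV[R]_n) :
  (forall i, measurable_fun [set: T] (fun x => f x i ord0)) ->
  measurable_fun [set: T] f.
Proof.
move=> mf.
suff H : g_sigma_preimage (fun i => @cV_coord _ R n i \o f) `<=` measurable.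
  move=> _ A mA; apply: H.
  have := g_sigma_preimage_comp (@cV_coord _ R n) f.
  by move=> ->; exists A.
apply: smallest_sub; first exact: sigma_algebra_measurable.
case: n => [|n] in f mf *; first by rewrite big_ord0.
rewrite -bigcup_mkord_ord; apply: bigcup_sub => i Ii.
by move=> A [B mB <-]; exact: mf.
Qed.

Lemma measurable_cV_cons n : measurable_fun [set: measurableTypeR R * 'cV[R]_n] (@cV_cons n).
Proof.
apply: measurable_to_cV; rewrite /cV_cons => i.
have [j ->|j ->] := @split_ordP 1 n i.
  rewrite (_ : (fun x => _) = fst); first exact: measurable_fst.
  by apply/funext => x; rewrite (@col_mxEu _ 1 n 1) mxE ord1 eqxx mulr1n.
rewrite (_ : (fun x => _) = (fun y : 'cV[R]_n => y j ord0) \o snd).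
  by apply: measurableT_comp; [exact: measurable_coord|exact: measurable_snd].
by apply/funext => x; rewrite (@col_mxEd _ 1 n 1).
Qed.

HB.instance Definition _ n :=
  isMeasurableFun.Build _ _ _ _ (@cV_cons n) (@measurable_cV_cons n).

Lemma lt_Nhalf_half : - 2^-1 < 2^-1 :> R.
Proof. by rewrite gtrN. Qed.

(* Lebesgue measure on the fundamental cube [-1/2,1/2]^n, as a probability on
   R^n, obtained by iterating the product with uniform measure on
   [-1/2,1/2]; integrating a Z^n-periodic function against it is integrating
   over T^n. *)
Fixpoint torus_prob (n : nat) : probability 'cV[R]_n R :=
  match n with
  | 0%N => dirac (0 : 'cV[R]_0)
  | n'.+1 =>
      distribution (uniform_prob lt_Nhalf_half \x torus_prob n')%E (@cV_cons n')
  end.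

End torus_measure.

Section periodic_approximation.
Context {R : realType} {d : nat}.
Implicit Types (f g h T phi : 'cV[R]_d -> R[i]) (k l : 'cV[int]_d) (x y : 'cV[R]_d).
Implicit Types (u : ('cV[R]_d -> R[i]) -> R[i]) (A : 'M[R]_d) (M : 'M[int]_d).
Implicit Types (p : \bar R).

Definition toR k : 'cV[R]_d := map_mx intr k.
Definition dotp x y : R := \sum_i x i ord0 * y i ord0.
Definition enorm x : R := Num.sqrt (\sum_i x i ord0 ^+ 2).
Definition opnorm A : R := sup [set enorm (A *m x) | x in [set x | enorm x <= 1]].
Definition eball x (r : R) : set 'cV[R]_d := [set y | enorm (y - x) < r].

Definition cexpi (t : R) : R[i] := cos (2 * pi * t) +i* sin (2 * pi * t).
Definition character k x : R[i] := cexpi (dotp (toR k) x).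

Definition cmeasurable f : Prop :=
  measurable_fun [set: 'cV[R]_d] (fun x => complex.Re (f x)) /\
  measurable_fun [set: 'cV[R]_d] (fun x => complex.Im (f x)).
Definition Zperiodic f : Prop := forall x k, f (x + toR k) = f x.
Definition ccontinuous f : Prop :=
  continuous (fun x => complex.Re (f x)) /\ continuous (fun x => complex.Im (f x)).
Definition ccvg (a : nat -> R[i]) (z : R[i]) : Prop :=
  normc (a n - z) @[n --> \oo] --> (0 : R).

Definition cint f : R[i] :=
  (\int[torus_prob d]_x complex.Re (f x)) +i* (\int[torus_prob d]_x complex.Im (f x)).

(* Elements of L_p(T^d) are represented by Z^d-periodic functions on R^d. *)
Definition Lpnorm p f : \bar R :=
  Lnorm (torus_prob d) p (fun x => (normc (f x))%:E).
Definition inLp p f : Prop :=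
  [/\ cmeasurable f, Zperiodic f & (Lpnorm p f < +oo)%E].

Definition fourier f k : R[i] := cint (fun x => f x * character (- k) x).
Definition spec f : set 'cV[int]_d := [set k | fourier f k != 0].
Definition trigpoly f : Prop :=
  exists (s : seq 'cV[int]_d) (c : 'cV[int]_d -> R[i]),
    f = fun x => \sum_(k <- s) c k * character k x.

(* C^oo(T^d) and its topology of uniform convergence of all derivatives; a
   word s over 'I_d encodes the corresponding iterated partial derivative. *)
Definition partial (i : 'I_d) f : 'cV[R]_d -> R[i] := fun x =>
  ('D_(delta_mx i ord0) (fun y => complex.Re (f y)) x) +i*
  ('D_(delta_mx i ord0) (fun y => complex.Im (f y)) x).
Definition partials (s : seq 'I_d) f := foldr partial f s.
Definition testfun f : Prop :=
  Zperiodic f /\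
  forall s : seq 'I_d, ccontinuous (partials s f) /\
    forall i x,
      derivable (fun y => complex.Re (partials s f y)) x (delta_mx i ord0) /\
      derivable (fun y => complex.Im (partials s f y)) x (delta_mx i ord0).
Definition testfun_cvg (F : nat -> 'cV[R]_d -> R[i]) f : Prop :=
  forall (s : seq 'I_d) (e : R), 0 < e ->
    \forall n \near \oo, forall x,
      normc (partials s (F n) x - partials s f x) < e.

(* C^oo(T^d) is metrizable, so continuity is sequential continuity.  Values
   of u outside C^oo(T^d) are irrelevant. *)
Definition distribution u : Prop :=
  (forall (a : R[i]) f g, testfun f -> testfun g ->
     u (fun x => a * f x + g x) = a * u f + u g) /\
  (forall (F : nat -> 'cV[R]_d -> R[i]) f, (forall n : nat, testfun (F n)) -> testfun f -> testfun_cvg F f ->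
     ccvg (fun n => u (F n)) (u f)).
Definition dfourier u k : R[i] := u (character (- k)).
Definition induced_by f u : Prop :=
  forall h, testfun h -> u h = cint (fun x => f x * h x).

(* T * u, the trigonometric polynomial with coefficients T^(k) u^(k). *)
Definition conv T u : 'cV[R]_d -> R[i] := fun x =>
  \sum_(k \in [set: 'cV[int]_d]) fourier T k * dfourier u k * character k x.

Definition cube : set 'cV[R]_d :=
  [set x | forall i, - 2^-1 <= x i ord0 < 2^-1].
Definition D A : set 'cV[int]_d := [set k | (mulmx A @` cube) (toR k)].

(* M^j, M^-j, M^*j, M^*-j as real matrices, and m = |det M|. *)
Definition Mpow M (j : nat) : 'M[R]_d := map_mx intr M ^+ j.
Definition MpowN M j : 'M[R]_d := invmx (Mpow M j).
Definition Mspow M (j : nat) : 'M[R]_d := (map_mx intr M)^T ^+ j.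
Definition MspowN M j : 'M[R]_d := invmx (Mspow M j).
Definition absdet M : R := `|\det M|%:~R.
Definition dilation M : Prop :=
  forall z : R[i], eigenvalue (map_mx intr M : 'M[R[i]]_d) z -> 1 < normc z.

Definition bestapprox A p f : \bar R :=
  ereal_inf [set Lpnorm p (fun x => f x - T x) | T in
    [set T | trigpoly T /\
             spec T `<=` [set k | enorm (invmx A *m toR k) < 1]]].

Definition besov M p (s : R) f : Prop :=
  inLp p f /\
  (Lpnorm p f +
    \sum_(1 <= nu <oo)
      (absdet M `^ (s / d%:R * nu%:R))%:E * bestapprox (Mpow M nu) p f < +oo)%E.

Definition Innorm M (q s : R) (j : nat) f : R :=
  (\sum_(k \in D (Mspow M j))
     normc (fourier f k) `^ q * (1 + enorm (toR k) ^+ 2) `^ (s * q / 2)) `^ q^-1.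

Definition multnorm (q : R) phi : \bar R :=
  ereal_sup [set Lpnorm q%:E (fun x =>
      \sum_(k \in [set: 'cV[int]_d])
         fourier phi k * fourier g k * character k x) |
    g in [set g | inLp q%:E g /\ (Lpnorm q%:E g <= 1)%E]].

(* Sequences are indexed by the positive integers: here and below the term of
   index 0 is unconstrained. *)
Definition classB M (delta : R) (phi : nat -> 'cV[R]_d -> R[i]) : Prop :=
  (forall j, (0 < j)%N -> trigpoly (phi j)) /\
  exists r C : R, [/\ 0 < r, 0 < C & forall j, (0 < j)%N ->
    spec (phi j) `<=` [set l | (mulmx (Mspow M j) @`
       (eball 0 r `\` \bigcup_(n in [set n : 'cV[int]_d | n != 0]) eball (toR n) delta))
         (toR l)] /\
    forall l, normc (fourier (phi j) l) <= C].

Definition weakly_compatible M (s : R) (phi : nat -> 'cV[R]_d -> R[i])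
    (phit : nat -> ('cV[R]_d -> R[i]) -> R[i]) : Prop :=
  exists b0 : R, forall j r, (0 < j)%N -> D (Mspow M j) r ->
    normc (1 - fourier (phi j) r * (dfourier (phit j) r)^*)
      <= b0 * enorm (MspowN M j *m toR r) `^ s.

Definition classS M (N : R) p
    (phit : nat -> ('cV[R]_d -> R[i]) -> R[i]) : Prop :=
  [/\ forall j, (0 < j)%N -> distribution (phit j),
      exists C : R, forall j k, (0 < j)%N ->
        (~ D (Mspow M j) k ->
           normc (dfourier (phit j) k) <= C * enorm (MspowN M j *m toR k) `^ N) /\
        (D (Mspow M j) k -> normc (dfourier (phit j) k) <= C)
    & exists C : R, forall (j n : nat) T, (0 < j)%N -> (j <= n)%N ->
        trigpoly T -> spec T `<=` [set k | enorm (MpowN M n *m toR k) <= 1] ->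
        (Lpnorm p (conv T (phit j))
          <= (C * absdet M `^ (N / d%:R * (n%:R - j%:R)))%:E * Lpnorm p T)%E].

(* For a dilation M that is diagonal, M^-j [-1/2,1/2)^d lies in the cube carrying
   torus_prob, so this is an integral against Lebesgue measure. *)
Definition Lqjnorm M (q : R) (j : nat) g : \bar R :=
  (((absdet M ^+ j)%:E *
    \int[torus_prob d]_(x in mulmx (MpowN M j) @` cube)
      (((absdet M ^+ j)^-1 *
        \sum_(k \in D (Mpow M j)) normc (g (x - MpowN M j *m toR k))) `^ q)%:E)
   `^ q^-1)%E.
Definition classL M (q : R) (g : nat -> 'cV[R]_d -> R[i]) : Prop :=
  forall j, (0 < j)%N ->
    [/\ cmeasurable (g j), Zperiodic (g j) & (Lqjnorm M q j (g j) < +oo)%E].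

(* < T, u(. - M^-j k) > for a trigonometric polynomial T. *)
Definition trigpair M (j : nat) T u k : R[i] :=
  \sum_(l \in [set: 'cV[int]_d])
    fourier T l * (dfourier u l)^* * cexpi (dotp (toR k) (MspowN M j *m toR l)).

Definition near_best M (delta sigma : R) p f
    (T : nat -> 'cV[R]_d -> R[i]) : Prop :=
  forall mu : nat,
    [/\ trigpoly (T mu), spec (T mu) `<=` D (Mpow M mu) &
        (Lpnorm p (fun x => f x - T mu x)%R
          <= sigma%:E * bestapprox (delta *: Mpow M mu) p f)%E].

(* < f, u(. - M^-j k) > for a distribution u: the common limit along all
   near-best sequences (0 if there is none). *)
Definition distpair M (delta : R) p (j : nat) f u k : R[i] :=
  xget 0 [set z | forall (sigma : R) (T : nat -> 'cV[R]_d -> R[i]),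
                    near_best M delta sigma p f T ->
                    ccvg (fun mu => trigpair M j (T mu) u k) z].

Definition funpair M (j : nat) f g k : R[i] :=
  cint (fun t => f t * (g (t - MpowN M j *m toR k))^* ).

Definition Qop M (j : nat) (c : 'cV[int]_d -> R[i]) phi : 'cV[R]_d -> R[i] :=
  fun x => ((absdet M ^+ j)^-1)%:C *
    \sum_(k \in D (Mpow M j)) c k * phi (x - MpowN M j *m toR k).

End periodic_approximation.

(* Main.v *)
(* All L_p norms are estimated by duality: a bound |<F, g>| <= C ||g||_q for
   bounded periodic g gives ||F||_p <= C.  Moving phi_j to the test function
   turns <Q_j T, g> into a mean over the grid M^-j D(M^j) of the samples of
   T * conj(phit_j) against those of H = conj(phi_j) * g.  Both are controlled
   by Marcinkiewicz-Zygmund inequalities, obtained from kernels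
   D_I conj(D_J) / |J| that are dominated by Fejer kernels; the same kernels
   provide the near-best approximants V_nu f.  On polynomials with spectrum in
   |M^-j k| < delta the operator Q_j is a Fourier multiplier, and the error
   caused by the multiplier 1 - phi_j^ conj(phit_j^) is bounded by weak
   compatibility and the Hausdorff-Young inequality.  The remaining error
   Q_j f - Q_j V_j f is telescoped along the V_nu f in the Besov case, and for
   phit_j in L_q it is bounded by the Hoelder and Jensen inequalities and the
   invariance of the grid sums of |phit_j| under grid translations.  At
   frequency 0 weak compatibility reads phi_j^ conj(phit_j^) = 1, which bounds
   K_{phi_j, q} below and absorbs the terms without this factor. *)
Require Import Defs.
From mathcomp Require Import all_boot all_order all_algebra.
From mathcomp Require Import all_classical all_reals all_analysis.
From mathcomp Require Import measurable_realfun ess_sup_inf complex.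
From mathcomp Require Import zify ring lra.
Set Implicit Arguments.
Unset Strict Implicit.
Unset Printing Implicit Defensive.
Import Order.TTheory GRing.Theory Num.Theory.
Import numFieldNormedType.Exports.
Import ComplexField.Normc.
Local Open Scope classical_set_scope.
Local Open Scope complex_scope.
Local Open Scope ring_scope.

(** Duality is what makes p = oo tractable: the kernel and sampling estimates are proved in L_q with
    q finite, against bounded periodic test functions, and 1/p is written 1 - 1/q throughout. The
    growth exponent 1/p + N/d has two sources. Sampling frequencies of level nu on the coarser grid
    of level j costs the oversampling factor m^(nu-j) to the power 1 - 1/q; the class S' costs
    m^((nu-j)N/d). The condition delta < 1/2 leaves room for the kernels: they must be 1 on the
    frequencies below delta and vanish outside D(M^nu), so the transition has relative width 1/2 -
    delta. For boxes the mass of a kernel depends only on ratios of side lengths, hence is bounded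
    in nu. Diagonality of M lets grids, cells and spectra be treated coordinate by coordinate. No
    minimiser of the best approximation is chosen. Every error is bounded by a + b ||f - T|| for an
    arbitrary admissible T, and the infimum over T is taken last. The compatibility error is
    evaluated on the kernel sum of f instead of T, so that the Fourier coefficients on the right are
    those of f. *)

Section complex_norm.
Variable R : realType.
Implicit Types z w : R[i].

Lemma normc_ge0 z : 0 <= normc z.
Proof. by case: z => a b; rewrite sqrtr_ge0. Qed.

Lemma conjCM z w : (z * w)^* = z^* * w^*.
Proof. exact: (rmorphM (@Num.conj R[i])). Qed.

Lemma conjC_sum I (r : seq I) (F : I -> R[i]) :
  (\sum_(i <- r) F i)^* = \sum_(i <- r) (F i)^*.
Proof. exact: (rmorph_sum (@Num.conj R[i])). Qed.

Lemma normc_conj z : normc z^* = normc z.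
Proof. by case: z => a b; rewrite /= sqrrN. Qed.

Lemma mul_conjc z : z * z^* = (normc z ^+ 2)%:C.
Proof.
case: z => a b; rewrite /= sqr_sqrtr ?addr_ge0 ?sqr_ge0//.
by apply/eqP; rewrite eq_complex/=; apply/andP; split; apply/eqP; ring.
Qed.

Lemma normc_realC (a : R) : normc a%:C = `|a|.
Proof. by rewrite /= expr0n addr0 sqrtr_sqr. Qed.

Lemma ReC_le z : `|complex.Re z| <= normc z.
Proof.
by case: z => a b /=; rewrite -sqrtr_sqr ler_wsqrtr// lerDl sqr_ge0.
Qed.

Lemma ImC_le z : `|complex.Im z| <= normc z.
Proof.
by case: z => a b /=; rewrite -sqrtr_sqr ler_wsqrtr// lerDr sqr_ge0.
Qed.

Lemma normc_le_ReIm z : normc z <= `|complex.Re z| + `|complex.Im z|.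
Proof.
case: z => a b /=.
rewrite -[leRHS]ger0_norm ?addr_ge0// -sqrtr_sqr ler_wsqrtr// sqrrD !real_normK ?num_real//.
by rewrite -addrA lerD2l lerDr mulrn_wge0// mulr_ge0.
Qed.

Lemma normcN z : normc (- z) = normc z.
Proof. by case: z => a b /=; rewrite !sqrrN. Qed.

Lemma normc_sum I (r : seq I) (Q : pred I) (F : I -> R[i]) :
  normc (\sum_(i <- r | Q i) F i) <= \sum_(i <- r | Q i) normc (F i).
Proof.
elim/big_ind2 : _ => //; first by rewrite normc0.
move=> x1 x2 y1 y2 h1 h2; apply: le_trans (le_normcD _ _) _; exact: lerD.
Qed.

Lemma ReM z w : complex.Re (z * w) =
  complex.Re z * complex.Re w - complex.Im z * complex.Im w.
Proof. by case: z; case: w. Qed.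
Lemma ImM z w : complex.Im (z * w) =
  complex.Re z * complex.Im w + complex.Im z * complex.Re w.
Proof. by case: z; case: w. Qed.
Lemma ReD z w : complex.Re (z + w) = complex.Re z + complex.Re w.
Proof. by case: z; case: w. Qed.
Lemma ImD z w : complex.Im (z + w) = complex.Im z + complex.Im w.
Proof. by case: z; case: w. Qed.
Lemma Re_conj z : complex.Re z^* = complex.Re z.
Proof. by case: z. Qed.
Lemma Im_conj z : complex.Im z^* = - complex.Im z.
Proof. by case: z. Qed.

(** Rotating a complex integral onto the nonnegative real axis reduces its triangle inequality to
    real integrands. *)
Lemma unimodular_normc z : exists2 w, normc w = 1 & w * z = (normc z)%:C.
Proof.
have [->|z0] := eqVneq z 0; first by exists 1; rewrite ?normc1// mulr0 normc0.
have n0 : normc z != 0 by apply: contra z0 => /eqP/eq0_normc ->.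
exists (z^* * (normc z)^-1%:C).
  rewrite normcM normc_conj normc_realC ger0_norm ?invr_ge0 ?normc_ge0//.
  by rewrite mulfV.
rewrite mulrAC [_ * z]mulrC mul_conjc -rmorphM /=; congr (_ %:C).
by rewrite expr2 -mulrA mulfV ?mulr1.
Qed.

End complex_norm.

(** * Complex integration over the torus *)

Section complex_integral.
Variables (R : realType) (d : nat).
Local Notation P := (@torus_prob R d).
Implicit Types f g h : 'cV[R]_d -> R[i].

Definition cintegrable f := cmeasurable f /\
  (\int[P]_x (normc (f x))%:E < +oo)%E.

Lemma measurable_normc f : cmeasurable f ->
  measurable_fun [set: 'cV[R]_d] (fun x => normc (f x)).
Proof.
move=> [mr mi].
rewrite (_ : (fun x => _) = fun x =>
   Num.sqrt (complex.Re (f x) ^+ 2 + complex.Im (f x) ^+ 2)); last first.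
  by apply/funext => x; case: (f x).
apply: (@measurableT_comp _ _ _ _ _ _ (@Num.sqrt R)).
  exact: continuous_measurable_fun (@sqrt_continuous R).
by apply: measurable_funD; exact: measurable_funX.
Qed.

Lemma measurable_normcE f : cmeasurable f ->
  measurable_fun [set: 'cV[R]_d] (fun x => (normc (f x))%:E).
Proof. by move=> mf; apply/measurable_EFinP; exact: measurable_normc. Qed.

Lemma cintegrableP f : cintegrable f <->
  P.-integrable [set: 'cV[R]_d] (EFin \o (fun x => complex.Re (f x))) /\
  P.-integrable [set: 'cV[R]_d] (EFin \o (fun x => complex.Im (f x))).
Proof.
split=> [[[mr mi] fi]|[/integrableP[mr ir] /integrableP[mi ii]]].
  split; apply/integrableP; split; try exact/measurable_EFinP.
    apply: le_lt_trans fi; apply: ge0_le_integral => //=.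
    - by apply/measurable_EFinP/measurableT_comp.
    - exact: measurable_normcE.
    - by move=> x _; rewrite lee_fin ReC_le.
  apply: le_lt_trans fi; apply: ge0_le_integral => //=.
  - by apply/measurable_EFinP/measurableT_comp.
  - exact: measurable_normcE.
  - by move=> x _; rewrite lee_fin ImC_le.
have cm : cmeasurable f by split; exact/measurable_EFinP.
split=> //.
apply: (@le_lt_trans _ _ (\int[P]_x ((`|complex.Re (f x)|)%:E + (`|complex.Im (f x)|)%:E))%E).
  apply: ge0_le_integral => //=.
  - by move=> x _; rewrite lee_fin normc_ge0.
  - exact: measurable_normcE.
  - by apply: emeasurable_funD; apply/measurable_EFinP/measurableT_comp => //; exact/measurable_EFinP.
  - by move=> x _; rewrite -EFinD lee_fin normc_le_ReIm.
rewrite ge0_integralD//=.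
- exact: lte_add_pinfty.
- by apply/measurable_EFinP/measurableT_comp => //; exact/measurable_EFinP.
- by apply/measurable_EFinP/measurableT_comp => //; exact/measurable_EFinP.
Qed.

Lemma cmeasurableD f g : cmeasurable f -> cmeasurable g ->
  cmeasurable (fun x => f x + g x).
Proof.
move=> [mr mi] [mr' mi']; split.
  by under eq_fun do rewrite ReD; exact: measurable_funD.
by under eq_fun do rewrite ImD; exact: measurable_funD.
Qed.

Lemma cmeasurableM f g : cmeasurable f -> cmeasurable g ->
  cmeasurable (fun x => f x * g x).
Proof.
move=> [mr mi] [mr' mi']; split.
  under eq_fun do rewrite ReM.
  by apply: measurable_funB; exact: measurable_funM.
under eq_fun do rewrite ImM.
by apply: measurable_funD; exact: measurable_funM.
Qed.

Lemma cmeasurable_cst (z : R[i]) : cmeasurable (fun _ : 'cV[R]_d => z).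
Proof. by split; exact: measurable_cst. Qed.

Lemma cmeasurable_conj f : cmeasurable f -> cmeasurable (fun x => (f x)^*).
Proof.
move=> [mr mi]; split.
  by under eq_fun do rewrite Re_conj.
under eq_fun do rewrite Im_conj.
exact: measurableT_comp.
Qed.

Lemma cmeasurable_real (a : 'cV[R]_d -> R) : measurable_fun [set: 'cV[R]_d] a ->
  cmeasurable (fun x => (a x)%:C).
Proof. by move=> ma; split => //=; exact: measurable_cst. Qed.

Lemma cmeasurable_sum I (r : seq I) (F : I -> 'cV[R]_d -> R[i]) :
  (forall i, cmeasurable (F i)) -> cmeasurable (fun x => \sum_(i <- r) F i x).
Proof.
move=> mF; elim: r => [|i r IH].
  by under eq_fun do rewrite big_nil; exact: cmeasurable_cst.
by under eq_fun do rewrite big_cons; exact: cmeasurableD.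
Qed.

Lemma le_cintegrable f (G : 'cV[R]_d -> R) : cmeasurable f ->
  measurable_fun [set: 'cV[R]_d] G ->
  (forall x, normc (f x) <= G x) ->
  (\int[P]_x (G x)%:E < +oo)%E -> cintegrable f.
Proof.
move=> mf mG fG Gi; split=> //; apply: le_lt_trans Gi.
apply: ge0_le_integral => //=.
- by move=> x _; rewrite lee_fin normc_ge0.
- exact: measurable_normcE.
- exact/measurable_EFinP.
- by move=> x _; rewrite lee_fin.
Qed.

Lemma cintegrableD f g : cintegrable f -> cintegrable g ->
  cintegrable (fun x => f x + g x).
Proof.
move=> [mf fi] [mg gi].
apply: (@le_cintegrable _ (fun x => normc (f x) + normc (g x))).
- exact: cmeasurableD.
- by apply: measurable_funD; exact: measurable_normc.
- by move=> x; exact: le_normcD.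
- under eq_integral do rewrite EFinD.
  rewrite ge0_integralD//=; first exact: lte_add_pinfty.
  + by move=> x _; rewrite lee_fin normc_ge0.
  + exact: measurable_normcE.
  + by move=> x _; rewrite lee_fin normc_ge0.
  + exact: measurable_normcE.
Qed.

Definition cbounded f := exists B : R, forall x, normc (f x) <= B.

Lemma cintegrableM f g : cintegrable f -> cmeasurable g -> cbounded g ->
  cintegrable (fun x => f x * g x).
Proof.
move=> [mf fi] mg [B gB].
have B0 : 0 <= B := le_trans (normc_ge0 _) (gB 0).
apply: (@le_cintegrable _ (fun x => B * normc (f x))).
- exact: cmeasurableM.
- by apply: measurable_funM => //; exact: measurable_normc.
- by move=> x; rewrite normcM mulrC ler_wpM2r// normc_ge0.
- under eq_integral do rewrite EFinM.
  rewrite ge0_integralZl_EFin//=.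
  + exact: lte_mul_pinfty.
  + by move=> x _; rewrite lee_fin normc_ge0.
  + exact: measurable_normcE.
Qed.

Lemma cbounded_cst (z : R[i]) : cbounded (fun _ : 'cV[R]_d => z).
Proof. by exists (normc z). Qed.

Lemma cintegrable_cst (z : R[i]) : cintegrable (fun _ : 'cV[R]_d => z).
Proof.
split; first exact: cmeasurable_cst.
by rewrite integral_cst//= probability_setT mule1 ltry.
Qed.

Lemma bounded_cintegrable f : cmeasurable f -> cbounded f -> cintegrable f.
Proof.
move=> mf bf; have := cintegrableM (cintegrable_cst 1) mf bf.
by under eq_fun do rewrite mul1r.
Qed.

Lemma cintegrable_conj f : cintegrable f -> cintegrable (fun x => (f x)^*).
Proof.
move=> [mf fi]; split; first exact: cmeasurable_conj.
by under eq_integral do rewrite normc_conj.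
Qed.

Lemma cintD f g : cintegrable f -> cintegrable g ->
  cint (fun x => f x + g x) = cint f + cint g.
Proof.
move=> /cintegrableP[fr fi] /cintegrableP[gr gi].
rewrite /cint.
under eq_Rintegral do rewrite ReD.
under [in X in _ +i* X]eq_Rintegral do rewrite ImD.
by rewrite !RintegralD.
Qed.

Lemma cintZ z f : cintegrable f -> cint (fun x => z * f x) = z * cint f.
Proof.
move=> /cintegrableP[fr fi].
rewrite /cint.
under eq_Rintegral do rewrite ReM.
under [in X in _ +i* X]eq_Rintegral do rewrite ImM.
rewrite RintegralB//; last 2 first.
- by have := integrableZl measurableT (complex.Re z) fr; apply: eq_integrable.
- by have := integrableZl measurableT (complex.Im z) fi; apply: eq_integrable.
rewrite RintegralD//; last 2 first.
- by have := integrableZl measurableT (complex.Re z) fi; apply: eq_integrable.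
- by have := integrableZl measurableT (complex.Im z) fr; apply: eq_integrable.
by rewrite !RintegralZl//; case: z.
Qed.

Lemma cint_conj f : cintegrable f -> cint (fun x => (f x)^*) = (cint f)^*.
Proof.
move=> /cintegrableP[fr fi].
rewrite /cint.
under eq_Rintegral do rewrite Re_conj.
under [in X in _ +i* X]eq_Rintegral do rewrite Im_conj.
congr (_ +i* _).
rewrite -mulN1r -(RintegralZl _ measurableT)//.
by apply: eq_Rintegral => x _; rewrite mulN1r.
Qed.

Lemma cint_cst z : cint (fun _ : 'cV[R]_d => z) = z.
Proof.
rewrite /cint /Rintegral !integral_cst//= !probability_setT !mule1/=.
by case: z.
Qed.

Lemma cintegrable_sum I (r : seq I) (F : I -> 'cV[R]_d -> R[i]) :
  (forall i, cintegrable (F i)) -> cintegrable (fun x => \sum_(i <- r) F i x).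
Proof.
move=> mF; elim: r => [|i r IH].
  by under eq_fun do rewrite big_nil; exact: cintegrable_cst.
by under eq_fun do rewrite big_cons; exact: cintegrableD.
Qed.

Lemma cint_sum I (r : seq I) (F : I -> 'cV[R]_d -> R[i]) :
  (forall i, cintegrable (F i)) ->
  cint (fun x => \sum_(i <- r) F i x) = \sum_(i <- r) cint (F i).
Proof.
move=> mF; elim: r => [|i r IH].
  by under eq_fun do rewrite big_nil; rewrite cint_cst big_nil.
under eq_fun do rewrite big_cons.
by rewrite cintD// ?IH ?big_cons//; exact: cintegrable_sum.
Qed.

Lemma normc_cint f : cintegrable f ->
  ((normc (cint f))%:E <= \int[P]_x (normc (f x))%:E)%E.
Proof.
move=> fi; have [w w1 wE] := unimodular_normc (cint f).
have wfi : cintegrable (fun x => w * f x).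
  under eq_fun do rewrite mulrC.
  exact: cintegrableM fi (cmeasurable_cst _) (cbounded_cst _).
have -> : normc (cint f) = complex.Re (cint (fun x => w * f x)).
  by rewrite cintZ// wE.
have [wr _] := (cintegrableP _).1 wfi.
rewrite /cint /= /Rintegral fineK ?integrable_fin_num//.
apply: le_integral => //.
  apply/integrableP; split; first by apply: measurable_normcE; case: fi.
  under eq_integral do rewrite gee0_abs ?lee_fin ?normc_ge0//.
  by case: fi.
move=> x _; rewrite lee_fin.
by rewrite (le_trans (ler_norm _))// (le_trans (ReC_le _))// normcM w1 mul1r.
Qed.

End complex_integral.

(** * Translation and reflection of integrals over one period *)

Section interval_invariance.
Variable R : realType.
Local Notation mu := (@lebesgue_measure R).
Implicit Types (h : R -> \bar R) (a b t : R).

(** The translated measure agrees with Lebesgue measure on half-open intervals, and these determine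
    it. *)
Lemma ge0_integral_lebesgue_shift t a b h : measurable_fun [set: R] h ->
  (forall x, 0 <= h x)%E ->
  (\int[mu]_(x in `]a, b]) h (x + t)%R = \int[mu]_(x in `](a + t)%R, (b + t)%R]) h x)%E.
Proof.
move=> mh h0.
have mt : measurable_fun [set: measurableTypeR R] (fun x : R => x + t : measurableTypeR R).
  exact: measurable_funD.
transitivity (\int[pushforward mu (fun x : R => (x + t)%R : measurableTypeR R)]_(x in `](a + t)%R, (b + t)%R]) h x)%E.
  rewrite ge0_integral_pushforward//=; last exact: measurable_funTS.
  congr (integral _ _ _); apply/funext => x; apply/propext.
  by rewrite /preimage/= !in_itv/= ltrD2r lerD2r.
apply: eq_measure_integral => A mA _.
apply/esym/lebesgue_measure_unique => // _ [[u v] _ <-].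
rewrite [RHS](_ : _ = mu `]u - t, v - t]%classic); last first.
  by congr (mu _); apply/seteqP; split => x /=; rewrite !in_itv/= ltrBlDr lerBrDr.
rewrite !lebesgue_measure_itv/= !lte_fin ltrD2r; case: ifP => // _.
by rewrite -!EFinB; congr (_%:E); ring.
Qed.

Local Notation half := (2^-1 : R).

Lemma ge0_integral_uniform_shift t h : measurable_fun [set: R] h ->
  (forall x, 0 <= h x)%E -> (forall x (k : int), h (x + k%:~R) = h x) ->
  (\int[mu]_(x in `[(- half)%R, half]) h (x + t)%R = \int[mu]_(x in `[(- half)%R, half]) h x)%E.
Proof.
move=> mh h0 hp.
(* Periodicity allows t to be replaced by its fractional part. *)
wlog t01 : t / 0 <= t < 1.
  move=> W; rewrite -(W (t - (Num.floor t)%:~R)); last first.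
    by have := floor_itv t; rewrite intrD; lra.
  apply: eq_integral => x _; rewrite addrA -[RHS](hp _ (Num.floor t)).
  by rewrite subrK.
have mht : measurable_fun [set: R] (fun x => h (x + t)).
  by apply: (measurableT_comp mh); exact: measurable_funD.
have [t0 t1] := andP t01.
rewrite -!integral_itv_obnd_cbnd; try exact: measurable_funTS.
rewrite ge0_integral_lebesgue_shift//.
(* The shifted and the original period share the interval from -1/2 + t to 1/2. The two remaining
   pieces have length t and differ by the translation 1. *)
rewrite (@itv_bndbnd_setU _ _ (BRight (- half + t)) (BRight half)); last 2 first.
- by rewrite bnd_simp; lra.
- by rewrite bnd_simp; lra.
rewrite (@itv_bndbnd_setU _ _ (BRight (- half)) (BRight (- half + t)) (BRight half)); last 2 first.
- by rewrite bnd_simp; lra.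
- by rewrite bnd_simp; lra.
rewrite !ge0_integral_setU//=; try exact: measurable_funTS; last 2 first.
- by apply/disj_setPS => x /=; rewrite !in_itv/=; lra.
- by apply/disj_setPS => x /=; rewrite !in_itv/=; lra.
rewrite addeC; congr (_ + _)%E.
have -> : (\int[mu]_(x in `](- half)%R, (- half + t)%R]) h x =
   \int[mu]_(x in `](- half)%R, (- half + t)%R]) h (x + 1)%R)%E.
  by apply: eq_integral => x _; rewrite -[RHS](hp _ (-1)); congr h; rewrite mulrN1z; ring.
rewrite ge0_integral_lebesgue_shift//.
have e1 : - half + 1 = half by lra.
have e2 : - half + t + 1 = half + t by lra.
by rewrite e1 e2.
Qed.

Lemma ge0_integral_uniform_opp h : measurable_fun [set: R] h ->
  (forall x, 0 <= h x)%E ->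
  (\int[mu]_(x in `[(- half)%R, half]) h (- x)%R = \int[mu]_(x in `[(- half)%R, half]) h x)%E.
Proof.
move=> mh h0.
have mN : measurable_fun [set: measurableTypeR R] (fun x : R => - x : measurableTypeR R).
  exact: measurable_funN.
transitivity (\int[pushforward mu (fun x : R => (- x)%R : measurableTypeR R)]_(x in `[(- half)%R, half]) h x)%E.
  rewrite ge0_integral_pushforward//=; last exact: measurable_funTS.
  congr (integral _ _ _); apply/funext => x; apply/propext.
  by rewrite /preimage/= !in_itv/=; lra.
by apply: eq_measure_integral => A mA _; exact: lebesgue_measureN.
Qed.

End interval_invariance.

(** * Invariance of the torus measure, by induction on the dimension *)

Section torus_invariance.
Variable R : realType.
Local Notation mu := (@lebesgue_measure R).
Local Notation half := (2^-1 : R).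

(** Tonelli's theorem for the recursive definition of [torus_prob]; the uniform density is 1 because
    the interval has length 1. The inductions on the dimension go through this identity. *)
Lemma torus_probS n (H : 'cV[R]_n.+1 -> \bar R) :
  measurable_fun [set: 'cV[R]_n.+1] H -> (forall x, 0 <= H x)%E ->
  (\int[torus_prob n.+1]_x H x =
   \int[mu]_(a in `[(- half)%R, half]) \int[torus_prob n]_y H (cV_cons (a, y)))%E.
Proof.
move=> mH H0.
have mHc : measurable_fun [set: measurableTypeR R * 'cV[R]_n] (H \o @cV_cons R n).
  by apply: measurableT_comp => //; exact: measurable_cV_cons.
rewrite /= ge0_integral_distribution// fubini_tonelli1//; last by move=> x /=.
rewrite integral_uniform//=.
- rewrite (_ : (half - - half)^-1 = 1) ?mul1e//.
  have -> : half - - half = 1 by lra.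
  by rewrite invr1.
- by apply: measurable_fun_fubini_tonelli_F => // x /=.
- by move=> x; apply: integral_ge0 => y _; exact: H0.
Qed.

Lemma cV_consD n (a b : R) (y z : 'cV[R]_n) :
  cV_cons (a + b, y + z) = cV_cons (a, y) + cV_cons (b, z).
Proof.
rewrite [RHS](@add_col_mx _ 1 n 1) /cV_cons/=.
by rewrite (_ : (a + b)%:M = a%:M + b%:M)//; apply/matrixP => i j; rewrite !mxE mulrnDl.
Qed.

Lemma cV_consN n (a : R) (y : 'cV[R]_n) : cV_cons (- a, - y) = - cV_cons (a, y).
Proof.
rewrite [RHS](@opp_col_mx _ 1 n 1) /cV_cons/=.
by rewrite (_ : (- a)%:M = - a%:M)//; apply/matrixP => i j; rewrite !mxE mulNrn.
Qed.

Lemma cV_consK n (x : 'cV[R]_n.+1) : x = cV_cons (x ord0 ord0, dsubmx (x : 'cV_(1 + n))).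
Proof.
rewrite /cV_cons/= -[LHS](@vsubmxK _ 1 n 1).
rewrite (_ : usubmx _ = (x ord0 ord0)%:M)//.
apply/colP => i; rewrite !ord1 !mxE eqxx mulr1n.
by congr (x _ _); apply: val_inj.
Qed.

Lemma toR_cons n (k : int) (l : 'cV[int]_n) :
  toR (col_mx (k%:M : 'cV_1) l : 'cV[int]_n.+1) = cV_cons (k%:~R, toR l) :> 'cV[R]_n.+1.
Proof. by rewrite /toR /cV_cons (@map_col_mx _ _ _ 1 n 1)/= map_scalar_mx. Qed.

Lemma cV_0 (x y : 'cV[R]_0) : x = y.
Proof. by apply/colP => -[]. Qed.

Lemma measurable_consr n (H : 'cV[R]_n.+1 -> \bar R) a :
  measurable_fun [set: 'cV[R]_n.+1] H ->
  measurable_fun [set: 'cV[R]_n] (fun y => H (cV_cons (a, y))).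
Proof.
move=> mH.
apply: (measurableT_comp (f := H \o @cV_cons R n) (g := fun y => (a, y))).
  by apply: measurableT_comp => //; exact: measurable_cV_cons.
exact: measurable_pair1.
Qed.

Lemma measurable_consl n (H : 'cV[R]_n.+1 -> \bar R) :
  measurable_fun [set: 'cV[R]_n.+1] H -> (forall x, 0 <= H x)%E ->
  measurable_fun [set: R] (fun a => \int[torus_prob n]_y H (cV_cons (a, y)))%E.
Proof.
move=> mH H0.
have mHc : measurable_fun [set: measurableTypeR R * 'cV[R]_n] (H \o @cV_cons R n).
  by apply: measurableT_comp => //; exact: measurable_cV_cons.
exact: (measurable_fun_fubini_tonelli_F (m2 := torus_prob n) _ mHc (fun x => H0 _)).
Qed.

Lemma measurable_cV_shift n (t : 'cV[R]_n) :
  measurable_fun [set: 'cV[R]_n] (fun x => x + t).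
Proof.
apply: measurable_to_cV => i.
under eq_fun do rewrite mxE.
by apply: measurable_funD => //; exact: measurable_coord.
Qed.

Lemma measurable_cV_opp n : measurable_fun [set: 'cV[R]_n] (fun x => - x).
Proof.
apply: measurable_to_cV => i.
under eq_fun do rewrite mxE.
by apply: measurable_funN => //; exact: measurable_coord.
Qed.

(** By induction the inner integral absorbs the shift of the last coordinates. As a function of the
    first coordinate it is 1-periodic, which leaves the one-dimensional case. *)
Lemma torus_integral_shift n (t : 'cV[R]_n) (H : 'cV[R]_n -> \bar R) :
  measurable_fun [set: 'cV[R]_n] H -> (forall x, 0 <= H x)%E ->
  (forall x (k : 'cV[int]_n), H (x + toR k) = H x) ->
  (\int[torus_prob n]_x H (x + t)%R = \int[torus_prob n]_x H x)%E.
Proof.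
elim: n => [|n IH] in t H *.
  by move=> _ _ _; apply: eq_integral => x _; congr H; exact: cV_0.
move=> mH H0 Hp.
have mHt : measurable_fun [set: 'cV[R]_n.+1] (fun x => H (x + t)).
  by apply: measurableT_comp => //; exact: measurable_cV_shift.
rewrite (torus_probS mHt (fun x => H0 _)) (torus_probS mH H0) [t]cV_consK.
set b := t _ _; set s := dsubmx _.
have hp a y (k : int) : H (cV_cons (a + k%:~R, y)) = H (cV_cons (a, y)).
  rewrite -[y in LHS]addr0 cV_consD -[RHS](Hp _ (col_mx (k%:M : 'cV_1) 0 : 'cV[int]_n.+1)).
  by rewrite toR_cons /toR map_mx0.
under eq_integral => a _.
  under eq_integral do rewrite -cV_consD.
  rewrite (IH s (fun y => H (cV_cons (a + b, y)))).
  - over.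
  - exact: measurable_consr.
  - by [].
  - move=> y k; rewrite -[a + b]addr0 cV_consD -[RHS](Hp _ (col_mx (0%:M : 'cV_1) k : 'cV[int]_n.+1)).
    by rewrite toR_cons addr0.
rewrite (ge0_integral_uniform_shift b (h := fun a => \int[torus_prob n]_y H (cV_cons (a, y)))%E)//.
- exact: measurable_consl.
- by move=> a; apply: integral_ge0.
- by move=> a k; apply: eq_integral => y _; exact: hp.
Qed.

Lemma torus_integral_opp n (H : 'cV[R]_n -> \bar R) :
  measurable_fun [set: 'cV[R]_n] H -> (forall x, 0 <= H x)%E ->
  (\int[torus_prob n]_x H (- x)%R = \int[torus_prob n]_x H x)%E.
Proof.
elim: n => [|n IH] in H *.
  by move=> _ _; apply: eq_integral => x _; congr H; exact: cV_0.
move=> mH H0.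
have mHt : measurable_fun [set: 'cV[R]_n.+1] (fun x => H (- x)).
  by apply: measurableT_comp => //; exact: measurable_cV_opp.
rewrite (torus_probS mHt (fun x => H0 _)) (torus_probS mH H0).
under eq_integral => a _.
  under eq_integral do rewrite -cV_consN.
  rewrite (IH (fun y => H (cV_cons (- a, y)))).
  - over.
  - exact: measurable_consr.
  - by [].
rewrite (ge0_integral_uniform_opp (h := fun a => \int[torus_prob n]_y H (cV_cons (a, y)))%E)//.
- exact: measurable_consl.
- by move=> a; apply: integral_ge0.
Qed.

End torus_invariance.

(** * Characters and their orthogonality *)

Section characters.
Variables (R : realType) (d : nat).
Local Notation P := (@torus_prob R d).
Implicit Types f g h : 'cV[R]_d -> R[i].
Implicit Types (k l : 'cV[int]_d) (x y t : 'cV[R]_d).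

Lemma integral_torus_shift t (h : 'cV[R]_d -> R) :
  measurable_fun [set: 'cV[R]_d] h ->
  (forall x k, h (x + toR k) = h x) ->
  \int[P]_x h (x + t) = \int[P]_x h x.
Proof.
move=> mh hp; rewrite /Rintegral; congr fine.
have mE : measurable_fun [set: 'cV[R]_d] (EFin \o h) by exact/measurable_EFinP.
rewrite integralE [RHS]integralE; congr (_ - _)%E.
  rewrite -(torus_integral_shift t (measurable_funepos mE))//; first by apply: eq_integral => x _; rewrite ?funeposE ?funenegE.
  by move=> x k; rewrite !funeposE/= hp.
rewrite -(torus_integral_shift t (measurable_funeneg mE))//; first by apply: eq_integral => x _; rewrite ?funeposE ?funenegE.
by move=> x k; rewrite !funenegE/= hp.
Qed.

Lemma integral_torus_opp (h : 'cV[R]_d -> R) :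
  measurable_fun [set: 'cV[R]_d] h ->
  \int[P]_x h (- x) = \int[P]_x h x.
Proof.
move=> mh; rewrite /Rintegral; congr fine.
have mE : measurable_fun [set: 'cV[R]_d] (EFin \o h) by exact/measurable_EFinP.
rewrite integralE [RHS]integralE; congr (_ - _)%E.
  by rewrite -(torus_integral_opp (measurable_funepos mE))//; by apply: eq_integral => x _; rewrite ?funeposE ?funenegE.
by rewrite -(torus_integral_opp (measurable_funeneg mE))//; by apply: eq_integral => x _; rewrite ?funeposE ?funenegE.
Qed.

Lemma cint_shift t f : cmeasurable f -> Zperiodic f ->
  cint (fun x => f (x + t)) = cint f.
Proof.
move=> [mr mi] fp; congr (_ +i* _).
  by rewrite (integral_torus_shift t mr)// => x k; rewrite fp.
by rewrite (integral_torus_shift t mi)// => x k; rewrite fp.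
Qed.

Lemma cint_opp f : cmeasurable f -> cint (fun x => f (- x)) = cint f.
Proof.
move=> [mr mi]; congr (_ +i* _).
  exact: (integral_torus_opp mr).
exact: (integral_torus_opp mi).
Qed.

Lemma cmeasurable_shift t f : cmeasurable f -> cmeasurable (fun x => f (x + t)).
Proof.
move=> [mr mi]; split.
  exact: (measurableT_comp mr (measurable_cV_shift t)).
exact: (measurableT_comp mi (measurable_cV_shift t)).
Qed.

Lemma cmeasurable_opp f : cmeasurable f -> cmeasurable (fun x => f (- x)).
Proof.
move=> [mr mi]; split.
  exact: (measurableT_comp mr (@measurable_cV_opp _ _)).
exact: (measurableT_comp mi (@measurable_cV_opp _ _)).
Qed.

Lemma cexpiD (a b : R) : cexpi (a + b) = cexpi a * cexpi b.
Proof.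
rewrite /cexpi mulrDr cosD sinD; apply/eqP; rewrite eq_complex/=.
by rewrite eqxx addrC eqxx.
Qed.

Lemma cexpi0 : cexpi 0 = 1 :> R[i].
Proof. by rewrite /cexpi mulr0 cos0 sin0. Qed.

Lemma cexpiN (a : R) : cexpi (- a) = (cexpi a)^*.
Proof. by rewrite /cexpi mulrN cosN sinN. Qed.

Lemma normc_cexpi (a : R) : normc (cexpi a) = 1.
Proof. by rewrite /= cos2Dsin2 sqrtr1. Qed.

Lemma cexpi_nat (n : nat) : cexpi (n%:R : R) = 1.
Proof.
elim: n => [|n IH]; first exact: cexpi0.
rewrite -natr1 cexpiD IH mul1r /cexpi mulr1 mulr_natl cos2pi sin2pi//.
Qed.

Lemma cexpi_int (n : int) : cexpi (n%:~R : R) = 1.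
Proof.
case: n => n; first exact: cexpi_nat.
by rewrite NegzE mulrNz cexpiN cexpi_nat conjC1.
Qed.

Lemma cexpi_half : cexpi (2^-1 : R) = -1.
Proof.
rewrite /cexpi mulrAC divff ?pnatr_eq0// mul1r cospi sinpi.
by apply/eqP; rewrite eq_complex/= oppr0 !eqxx.
Qed.

Lemma dotpDl x y t : dotp (x + y) t = dotp x t + dotp y t.
Proof.
by rewrite /dotp -big_split; apply: eq_bigr => i _; rewrite mxE mulrDl.
Qed.

Lemma dotpC x y : dotp x y = dotp y x.
Proof. by apply: eq_bigr => i _; rewrite mulrC. Qed.

Lemma dotpDr x y t : dotp t (x + y) = dotp t x + dotp t y.
Proof. by rewrite !(dotpC t) dotpDl. Qed.

Lemma dotpNl x y : dotp (- x) y = - dotp x y.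
Proof.
by rewrite /dotp -sumrN; apply: eq_bigr => i _; rewrite mxE mulNr.
Qed.

Lemma dotpNr x y : dotp y (- x) = - dotp y x.
Proof. by rewrite !(dotpC y) dotpNl. Qed.

Lemma toRD k l : toR (k + l) = toR k + toR l :> 'cV[R]_d.
Proof. by rewrite /toR map_mxD. Qed.

Lemma toRN k : toR (- k) = - toR k :> 'cV[R]_d.
Proof. by rewrite /toR map_mxN. Qed.

Lemma toR0 : toR 0 = 0 :> 'cV[R]_d.
Proof. by rewrite /toR map_mx0. Qed.

Lemma dotp_toR k l : exists n : int, dotp (toR k : 'cV[R]_d) (toR l) = n%:~R.
Proof.
exists (\sum_i k i ord0 * l i ord0).
by rewrite rmorph_sum; apply: eq_bigr => i _; rewrite !mxE -intrM.
Qed.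

Lemma characterDr k x y : character k (x + y) = character k x * character k y.
Proof. by rewrite /character dotpDr cexpiD. Qed.

Lemma characterDl k l x : character (k + l) x = character k x * character l x.
Proof. by rewrite /character toRD dotpDl cexpiD. Qed.

Lemma characterNl k x : character (- k) x = (character k x)^*.
Proof. by rewrite /character toRN dotpNl cexpiN. Qed.

Lemma characterNr k x : character k (- x) = (character k x)^*.
Proof. by rewrite /character dotpNr cexpiN. Qed.

Lemma character0 x : character 0 x = 1 :> R[i].
Proof.
by rewrite /character toR0 /dotp big1 ?cexpi0// => i _; rewrite mxE mul0r.
Qed.

Lemma normc_character k x : normc (character k x) = 1.
Proof. exact: normc_cexpi. Qed.

Lemma character_toR k l : character k (toR l : 'cV[R]_d) = 1 :> R[i].
Proof. by rewrite /character; have [n ->] := dotp_toR k l; rewrite cexpi_int. Qed.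

Lemma Zperiodic_character k : Zperiodic (@character R d k).
Proof. by move=> x l; rewrite characterDr character_toR mulr1. Qed.

Lemma measurable_dotp x : measurable_fun [set: 'cV[R]_d] (dotp x).
Proof.
apply: measurable_sum => i; apply: measurable_funM; first exact: measurable_cst.
exact: measurable_coord.
Qed.

Lemma cmeasurable_character k : cmeasurable (@character R d k).
Proof.
have m : measurable_fun [set: 'cV[R]_d] (fun x => 2 * pi * dotp (toR k) x).
  by apply: measurable_funM; [exact: measurable_cst|exact: measurable_dotp].
split => /=.
  exact: (measurableT_comp (continuous_measurable_fun (@continuous_cos R)) m).
exact: (measurableT_comp (continuous_measurable_fun (@continuous_sin R)) m).
Qed.

Lemma cbounded_character k : cbounded (@character R d k).
Proof. by exists 1 => x; rewrite normc_character. Qed.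

Lemma cintegrable_character k : cintegrable (@character R d k).
Proof.
exact: bounded_cintegrable (cmeasurable_character k) (cbounded_character k).
Qed.

Lemma cint_character k : cint (@character R d k) = (k == 0)%:R.
Proof.
have [->|k0] := eqVneq k 0.
  rewrite (_ : character 0 = fun=> 1) ?cint_cst//.
  by apply/funext => x; rewrite character0.
have [i ki] : exists i, k i ord0 != 0.
  apply/existsP; apply: contraNT k0 => /existsPn h.
  by apply/eqP/colP => i; rewrite mxE; apply/eqP; have := h i; rewrite negbK.
(* Half a wavelength in a coordinate where k does not vanish: the shift by t multiplies the
   character by -1 and preserves the integral, which is therefore 0. *)
pose t : 'cV[R]_d := \col_j if j == i then (2 * (k i ord0)%:~R)^-1 else 0.
have ct : character k t = -1 :> R[i].
  rewrite /character /dotp (bigD1 i)//= big1 ?addr0; last first.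
    by move=> j /negbTE ji; rewrite [in X in _ * X]mxE ji mulr0.
  rewrite !mxE eqxx invfM mulrCA mulfV ?mulr1; last by rewrite intr_eq0.
  exact: cexpi_half.
have := cint_shift t (cmeasurable_character k) (@Zperiodic_character k).
under [X in cint X]eq_fun do rewrite characterDr mulrC ct.
rewrite cintZ ?mulN1r; last exact: cintegrable_character.
case: (cint _) => a b [ea eb]; apply/eqP; rewrite eq_complex/=.
by apply/andP; split; apply/eqP; lra.
Qed.

End characters.

(** * Finite trigonometric sums, Fourier coefficients and Parseval's identity *)

Section trigonometric_sums.
Variables (R : realType) (d : nat).
Local Notation P := (@torus_prob R d).
Implicit Types f g h : 'cV[R]_d -> R[i].
Implicit Types (k l : 'cV[int]_d) (x y t : 'cV[R]_d).
Implicit Types (s : seq 'cV[int]_d) (c : 'cV[int]_d -> R[i]).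

(** The list of frequencies is kept explicit and may exceed the spectrum, so that several
    polynomials can share one list. *)
Definition trigsum s c : 'cV[R]_d -> R[i] :=
  fun x => \sum_(k <- s) c k * character k x.

Lemma cmeasurable_trigsum s c : cmeasurable (trigsum s c).
Proof.
apply: cmeasurable_sum => k; apply: cmeasurableM; first exact: cmeasurable_cst.
exact: cmeasurable_character.
Qed.

Lemma normc_trigsum s c x : normc (trigsum s c x) <= \sum_(k <- s) normc (c k).
Proof.
apply: le_trans (normc_sum _ _ _) _; apply: ler_sum => k _.
by rewrite normcM normc_character mulr1.
Qed.

Lemma cbounded_trigsum s c : cbounded (trigsum s c).
Proof. by exists (\sum_(k <- s) normc (c k)) => x; exact: normc_trigsum. Qed.

Lemma cintegrable_trigsum s c : cintegrable (trigsum s c).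
Proof.
exact: bounded_cintegrable (cmeasurable_trigsum s c) (cbounded_trigsum s c).
Qed.

Lemma Zperiodic_trigsum s c : Zperiodic (trigsum s c).
Proof. by move=> x l; apply: eq_bigr => k _; rewrite Zperiodic_character. Qed.

Lemma cintegrableZ (z : R[i]) f : cintegrable f -> cintegrable (fun x => z * f x).
Proof.
move=> fi; under eq_fun do rewrite mulrC.
exact: cintegrableM fi (cmeasurable_cst _ _) (cbounded_cst _ _).
Qed.

Lemma cintegrableM_character k f : cintegrable f ->
  cintegrable (fun x => f x * character k x).
Proof.
by move=> fi; exact: cintegrableM fi (cmeasurable_character _ k) (cbounded_character _ k).
Qed.

Lemma fourierD f g k : cintegrable f -> cintegrable g ->
  fourier (fun x => f x + g x) k = fourier f k + fourier g k.
Proof.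
move=> fi gi; rewrite /fourier -cintD; try exact: cintegrableM_character.
by congr cint; apply/funext => x; rewrite mulrDl.
Qed.

Lemma fourierZ z f k : cintegrable f ->
  fourier (fun x => z * f x) k = z * fourier f k.
Proof.
move=> fi; rewrite /fourier -cintZ; last exact: cintegrableM_character.
by congr cint; apply/funext => x; rewrite mulrA.
Qed.

Lemma fourierB f g k : cintegrable f -> cintegrable g ->
  fourier (fun x => f x - g x) k = fourier f k - fourier g k.
Proof.
move=> fi gi; under [X in fourier X]eq_fun do rewrite -mulN1r.
by rewrite fourierD ?fourierZ ?mulN1r//; exact: cintegrableZ.
Qed.

Lemma fourier_character k l : fourier (@character R d l) k = (l == k)%:R.
Proof.
rewrite /fourier; under [X in cint X]eq_fun do rewrite -characterDl.
by rewrite cint_character subr_eq0.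
Qed.

Lemma sum_uniq_eq (V : nmodType) (I : eqType) (r : seq I) (F : I -> V) (k : I) :
  uniq r -> \sum_(i <- r) (if i == k then F i else 0) = if k \in r then F k else 0.
Proof.
move=> ur; rewrite -big_mkcond; case: ifPn => kr.
  by rewrite (big_rem k)//= eqxx big_seq_cond big1 ?addr0// => i /andP[];
     rewrite mem_rem_uniq// !inE => /andP[/negbTE ->].
by rewrite big_seq_cond big1// => i /andP[ir /eqP ik]; rewrite -ik ir in kr.
Qed.

Lemma fourier_trigsum s c k : uniq s ->
  fourier (trigsum s c) k = if k \in s then c k else 0.
Proof.
move=> us; rewrite -(sum_uniq_eq _ _ us) /fourier /trigsum.
under [X in cint X]eq_fun do rewrite mulr_suml.
rewrite cint_sum => [|l]; last first.
  by apply: cintegrableM_character; apply: cintegrableZ; exact: cintegrable_character.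
apply: eq_bigr => l _; rewrite -/(fourier _ _) fourierZ; last exact: cintegrable_character.
by rewrite fourier_character; case: eqP; rewrite ?mulr1 ?mulr0.
Qed.

Lemma eq_trigsum s c c' : {in s, c =1 c'} -> trigsum s c = trigsum s c'.
Proof.
by move=> cc; apply/funext => x; apply: eq_big_seq => k ks; rewrite cc.
Qed.

Lemma trigpolyP f : trigpoly f -> exists s,
  [/\ uniq s, f = trigsum s (fourier f) & forall k, k \notin s -> fourier f k = 0].
Proof.
move=> [s [c fE]].
(* A frequency repeated in the list contributes once for each occurrence. *)
pose c' k := c k *+ count_mem k s.
have E : f = trigsum (undup s) c'.
  apply/funext => x; rewrite fE /trigsum -big_undup_iterop_count/=.
  by apply: eq_bigr => k _; rewrite /c' mulrnAl Monoid.iteropE -iter_addr_0.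
have us := undup_uniq s.
exists (undup s); split => //.
  by rewrite [LHS]E; apply: eq_trigsum => k ks; rewrite E fourier_trigsum// ks.
by move=> k /negbTE ks; rewrite E fourier_trigsum// ks.
Qed.

Lemma trigpoly_trigsum s c : trigpoly (trigsum s c).
Proof. by exists s, c. Qed.

Lemma fsum_seq (V : nmodType) (s : seq 'cV[int]_d) (F : 'cV[int]_d -> V) : uniq s ->
  (forall k, k \notin s -> F k = 0) ->
  \sum_(k \in [set: 'cV[int]_d]) F k = \sum_(k <- s) F k.
Proof.
move=> us F0; rewrite [RHS]fsbig_seq//; symmetry; apply: fsbig_widen => // k [_ /= ks].
by apply: F0; apply/negP.
Qed.

Lemma normc_fourier f k : cintegrable f ->
  ((normc (fourier f k))%:E <= \int[P]_x (normc (f x))%:E)%E.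
Proof.
move=> fi; apply: le_trans (normc_cint (cintegrableM_character _ fi)) _.
by under eq_integral do rewrite normcM normc_character mulr1.
Qed.

Definition pairing f g : R[i] := cint (fun x => f x * (g x)^*).

Lemma fourier_conj g k : cintegrable g ->
  cint (fun x => character k x * (g x)^*) = (fourier g k)^*.
Proof.
move=> gi; rewrite /fourier -cint_conj; last exact: cintegrableM_character.
congr cint; apply/funext => x.
by rewrite conjCM characterNl conjCK mulrC.
Qed.

Lemma pairing_trigsum s c g : cintegrable g ->
  pairing (trigsum s c) g = \sum_(k <- s) c k * (fourier g k)^*.
Proof.
move=> gi; rewrite /pairing /trigsum.
have ci k : cintegrable (fun x => character k x * (g x)^*).
  under eq_fun do rewrite mulrC; apply: cintegrableM_character.
  exact: cintegrable_conj.
rewrite (_ : (fun x => _) =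
    fun x => \sum_(k <- s) c k * (character k x * (g x)^*)); last first.
  by apply/funext => x; rewrite mulr_suml; apply: eq_bigr => k _; rewrite mulrA.
rewrite cint_sum => [|k]; last exact: cintegrableZ.
by apply: eq_bigr => k _; rewrite cintZ// fourier_conj.
Qed.

(** A multiplier is a convolution with its kernel; this is how pointwise majorants of kernels become
    norm inequalities. *)
Lemma trigsum_convolution s c f x : cintegrable f ->
  trigsum s (fun k => c k * fourier f k) x = cint (fun t => f t * trigsum s c (x - t)).
Proof.
move=> fi; rewrite /trigsum.
under [X in cint X]eq_fun do rewrite mulr_sumr.
have E k t : f t * (c k * character k (x - t)) =
    c k * character k x * (f t * character (- k) t).
  by rewrite characterDr characterNr characterNl; ring.
under [X in cint X]eq_fun do under eq_bigr do rewrite E.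
rewrite cint_sum => [|k]; last by apply: cintegrableZ; exact: cintegrableM_character.
apply: eq_bigr => k _; rewrite cintZ; last exact: cintegrableM_character.
by rewrite -/(fourier _ _); ring.
Qed.

(** Obtained by pairing the sum with itself. *)
Lemma parseval s c : uniq s ->
  (\int[P]_x (normc (trigsum s c x) ^+ 2)%:E = (\sum_(k <- s) normc (c k) ^+ 2)%:E)%E.
Proof.
move=> us.
have := pairing_trigsum s c (cintegrable_trigsum s c).
rewrite [in RHS](_ : \sum_(k <- s) _ = (\sum_(k <- s) normc (c k) ^+ 2)%:C); last first.
  rewrite rmorph_sum; apply: eq_big_seq => k ks.
  by rewrite fourier_trigsum// ks mul_conjc.
rewrite /pairing; under [X in cint X]eq_fun do rewrite mul_conjc.
move=> [h _]; rewrite -h /Rintegral fineK//.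
apply: integrable_fin_num => //.
have := cintegrableM (cintegrable_trigsum s c) (cmeasurable_conj (cmeasurable_trigsum s c)).
have b : cbounded (fun x => (trigsum s c x)^*).
  by have [B hB] := cbounded_trigsum s c; exists B => x; rewrite normc_conj.
move=> /(_ b) /cintegrableP[+ _].
by under [X in _.-integrable _ (EFin \o X)]eq_fun do rewrite mul_conjc.
Qed.

End trigonometric_sums.

(** * L_p norms and Hoelder's inequality *)

Section Lp_norms.
Variables (R : realType) (d : nat).
Local Notation P := (@torus_prob R d).
Implicit Types f g h F : 'cV[R]_d -> R[i].
Implicit Types (p : \bar R) (q r : R).

Definition Lqint q f : \bar R := (\int[P]_x ((normc (f x)) `^ q)%:E)%E.

Lemma Lqint_ge0 q f : (0 <= Lqint q f)%E.
Proof. by apply: integral_ge0 => x _; rewrite lee_fin powR_ge0. Qed.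

Lemma Lpnorm_fin q f : Lpnorm q%:E f = (Lqint q f `^ q^-1)%E.
Proof.
rewrite /Lpnorm unlock; apply: (f_equal (fun z => z `^ q^-1)%E).
by apply: eq_integral => x _; rewrite abse_EFin ger0_norm ?normc_ge0// poweR_EFin.
Qed.

Lemma Lpnorm_ge0 p f : (0 <= Lpnorm p f)%E.
Proof. exact: Lnorm_ge0. Qed.

Lemma Lpnorm_infE f :
  Lpnorm +oo%E f = ess_sup P (fun x => (normc (f x))%:E).
Proof.
rewrite /Lpnorm unlock /= probability_setT lte01; congr ess_sup.
by apply/funext => x /=; rewrite ger0_norm ?normc_ge0.
Qed.

Lemma Lqint_fin_num q f : 0 < q -> (Lpnorm q%:E f < +oo)%E ->
  Lqint q f \is a fin_num.
Proof.
move=> q0; rewrite Lpnorm_fin ge0_fin_numE ?Lqint_ge0//.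
by apply: lty_poweRy; rewrite invr_neq0// gt_eqF.
Qed.

Lemma LpnormN p f : Lpnorm p (fun x => - f x) = Lpnorm p f.
Proof. by rewrite /Lpnorm; congr Lnorm; apply/funext => x; rewrite normcN. Qed.

Lemma measurable_powR_normc q f : cmeasurable f ->
  measurable_fun [set: 'cV[R]_d] (fun x => normc (f x) `^ q).
Proof.
move=> mf; apply: (measurableT_comp (measurable_powR q)).
exact: measurable_normc.
Qed.

Lemma measurable_powR_normcE q f : cmeasurable f ->
  measurable_fun [set: 'cV[R]_d] (fun x => (normc (f x) `^ q)%:E).
Proof. by move=> mf; apply/measurable_EFinP; exact: measurable_powR_normc. Qed.

Lemma le_Lpnorm p f g : (0 < p)%E -> cmeasurable f -> cmeasurable g ->
  (forall x, normc (f x) <= normc (g x)) -> (Lpnorm p f <= Lpnorm p g)%E.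
Proof.
case: p => [r||//]; rewrite ?lte_fin => p0 mf mg fg.
  rewrite !Lpnorm_fin; apply: gt0_ler_poweR.
  - by rewrite invr_ge0 ltW.
  - by rewrite in_itv/= Lqint_ge0 leey.
  - by rewrite in_itv/= Lqint_ge0 leey.
  apply: ge0_le_integral => //=.
  - by move=> x _; rewrite lee_fin powR_ge0.
  - exact: measurable_powR_normcE.
  - exact: measurable_powR_normcE.
  - move=> x _; rewrite lee_fin ge0_ler_powR ?nnegrE ?normc_ge0//; exact: ltW.
rewrite !Lpnorm_infE; apply: le_ess_sup; apply: aeW => x; rewrite lee_fin//.
Qed.

Lemma Lpnorm_cst1 p : (0 < p)%E -> Lpnorm p (fun _ : 'cV[R]_d => (1 : R[i])) = 1%E.
Proof.
case: p => [r||//]; rewrite ?lte_fin => p0.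
  rewrite Lpnorm_fin /Lqint normc1 powR1 integral_cst//= probability_setT mule1.
  by rewrite poweR_EFin powR1.
rewrite Lpnorm_infE normc1 ess_sup_cst//=.
by rewrite probability_setT lte01.
Qed.

Lemma Lpnorm_triangle p f g : (1 <= p)%E -> cmeasurable f -> cmeasurable g ->
  (Lpnorm p (fun x => f x + g x)%R <= Lpnorm p f + Lpnorm p g)%E.
Proof.
move=> p1 mf mg.
apply: le_trans (eminkowski P (measurable_normc mf) (measurable_normc mg) p1).
rewrite /Lpnorm -[leRHS]Lnorm_abse.
have E : abse \o (EFin \o ((fun x => normc (f x)) \+ (fun x => normc (g x)))) =
   fun x => (normc ((normc (f x) + normc (g x))%:C))%:E.
  by apply/funext => x /=; rewrite expr0n addr0 sqrtr_sqr.
rewrite E; apply: (@le_Lpnorm p _ (fun x => (normc (f x) + normc (g x))%:C)).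
- by apply: lt_le_trans p1.
- exact: cmeasurableD.
- by apply: cmeasurable_real; apply: measurable_funD; exact: measurable_normc.
- move=> x; rewrite normc_realC ger0_norm ?addr_ge0 ?normc_ge0//.
  exact: le_normcD.
Qed.

(** The exponent q remains a real number in both cases, so that q-th powers can be integrated. The
    endpoint p = oo is kept as a separate alternative. *)
Definition conjugate_exponents p q :=
  p = +oo%E /\ q = 1 \/ exists r, [/\ p = r%:E, 1 < r, 1 < q & r^-1 + q^-1 = 1].

Lemma hoelder_pairing p q f g : conjugate_exponents p q ->
  cmeasurable f -> cmeasurable g -> (Lpnorm p f < +oo)%E ->
  (\int[P]_x (normc (f x) * normc (g x))%:E <= Lpnorm p f * Lpnorm q%:E g)%E.
Proof.
move=> [[-> ->]|[r [-> r1 q1 rq]]] mf mg fp.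
  have f0 := Lpnorm_ge0 +oo f.
  rewrite Lpnorm_fin invr1 poweRe1; last exact: Lqint_ge0.
  rewrite /Lqint -ge0_integralZl//; last 2 first.
  - exact: measurable_powR_normcE.
  - by move=> x _; rewrite lee_fin powR_ge0.
  apply: ae_ge0_le_integral => //.
  - by move=> x _; rewrite lee_fin mulr_ge0 ?normc_ge0.
  - by apply/measurable_EFinP/measurable_funM; exact: measurable_normc.
  - by move=> x _; rewrite mule_ge0// lee_fin powR_ge0.
  - by apply: measurable_funeM; exact: measurable_powR_normcE.
  - rewrite Lpnorm_infE; have := ess_sup_ge P (fun x => (normc (f x))%:E).
    apply: filterS => x fx _.
    by rewrite powRr1 ?normc_ge0// EFinM lee_wpmul2r// lee_fin normc_ge0.
have r0 : 0 < r by lra.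
have q0 : 0 < q by lra.
have := hoelder P (measurable_normc mf) (measurable_normc mg) r0 q0 rq.
apply: le_trans; rewrite Lnorm1 le_eqVlt; apply/orP; left; apply/eqP.
by apply: eq_integral => x _; rewrite /= ger0_norm// mulr_ge0 ?normc_ge0.
Qed.

Lemma conj_p_ge1 p q : conjugate_exponents p q -> (1 <= p)%E.
Proof.
by move=> [[-> _]|[r [-> r1 _ _]]]; rewrite ?leey// lee_fin ltW.
Qed.

Lemma conj_q_ge1 p q : conjugate_exponents p q -> 1 <= q.
Proof. by move=> [[_ ->]|[r [_ _ /ltW]]]. Qed.

Lemma integral_le_Lpnorm p q f : conjugate_exponents p q -> cmeasurable f ->
  (\int[P]_x (normc (f x))%:E <= Lpnorm p f)%E.
Proof.
move=> pq mf; have [->|fy] := eqVneq (Lpnorm p f) +oo%E; first by rewrite leey.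
have q0 : (0 < q%:E)%E by rewrite lte_fin (lt_le_trans ltr01 (conj_q_ge1 pq)).
have fy' : (Lpnorm p f < +oo)%E by rewrite ltey.
have := hoelder_pairing pq mf (cmeasurable_cst _ 1) fy'.
rewrite Lpnorm_cst1// mule1; apply: le_trans.
by under [leRHS]eq_integral do rewrite normc1 mulr1.
Qed.

Lemma integral_le_Lqnorm p q f : conjugate_exponents p q -> cmeasurable f ->
  (\int[P]_x (normc (f x))%:E <= Lpnorm q%:E f)%E.
Proof.
move=> pq mf.
have p0 : (0 < p)%E by rewrite (lt_le_trans lte01 (conj_p_ge1 pq)).
have := hoelder_pairing pq (cmeasurable_cst _ 1) mf.
rewrite Lpnorm_cst1// mul1e => /(_ (ltry _)); apply: le_trans.
by under [leRHS]eq_integral do rewrite normc1 mul1r.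
Qed.

Lemma Lp_cintegrable p q f : conjugate_exponents p q -> cmeasurable f ->
  (Lpnorm p f < +oo)%E -> cintegrable f.
Proof. by move=> pq mf; split=> //; apply: le_lt_trans (integral_le_Lpnorm pq mf) _. Qed.

Lemma Lq_cintegrable p q f : conjugate_exponents p q -> cmeasurable f ->
  (Lpnorm q%:E f < +oo)%E -> cintegrable f.
Proof. by move=> pq mf; split=> //; apply: le_lt_trans (integral_le_Lqnorm pq mf) _. Qed.

Lemma cintegrable_pairing p q f g : conjugate_exponents p q ->
  cmeasurable f -> cmeasurable g -> (Lpnorm p f < +oo)%E -> (Lpnorm q%:E g < +oo)%E ->
  cintegrable (fun x => f x * (g x)^*).
Proof.
move=> pq mf mg fp gq; split; first by apply: cmeasurableM => //; exact: cmeasurable_conj.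
apply: (@le_lt_trans _ _ (Lpnorm p f * Lpnorm q%:E g)%E).
  under eq_integral do rewrite normcM normc_conj.
  exact: hoelder_pairing.
by rewrite lte_mul_pinfty ?Lpnorm_ge0// ge0_fin_numE ?Lpnorm_ge0.
Qed.

Lemma normc_pairing p q f g : conjugate_exponents p q ->
  cmeasurable f -> cmeasurable g -> (Lpnorm p f < +oo)%E -> (Lpnorm q%:E g < +oo)%E ->
  ((normc (pairing f g))%:E <= Lpnorm p f * Lpnorm q%:E g)%E.
Proof.
move=> pq mf mg fp gq; apply: le_trans (normc_cint _) _.
  exact: (cintegrable_pairing pq).
under eq_integral do rewrite normcM normc_conj.
exact: hoelder_pairing.
Qed.

Lemma Lpnorm_bounded p f (B : R) : (0 < p)%E -> cmeasurable f ->
  (forall x, normc (f x) <= B) -> (Lpnorm p f <= B%:E)%E.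
Proof.
move=> p0 mf fB.
have B0 : 0 <= B := le_trans (normc_ge0 _) (fB 0).
apply: (@le_trans _ _ (Lpnorm p (fun _ : 'cV[R]_d => (B%:C : R[i])))).
  apply: (le_Lpnorm p0 mf (cmeasurable_cst _ _)) => x.
  by rewrite normc_realC ger0_norm.
case: p p0 => [r||//]; rewrite ?lte_fin => p0.
  rewrite Lpnorm_fin /Lqint normc_realC ger0_norm// integral_cst//= probability_setT mule1.
  by rewrite poweR_EFin -powRrM mulfV ?gt_eqF// powRr1.
rewrite Lpnorm_infE normc_realC ger0_norm// ess_sup_cst//=.
by rewrite probability_setT lte01.
Qed.

End Lp_norms.

(** * The L_p norm by duality *)

Section duality.
Variables (R : realType) (d : nat).
Local Notation P := (@torus_prob R d).
Implicit Types f g h F : 'cV[R]_d -> R[i].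

(** The class of test functions. Boundedness makes all the integrals finite, and the extremal
    functions of the duality arguments stay in the class. *)
Definition bperiodic g := [/\ cmeasurable g, Zperiodic g & cbounded g].

Lemma bperiodic_cintegrable g : bperiodic g -> cintegrable g.
Proof. by move=> [mg _ bg]; exact: bounded_cintegrable. Qed.

Lemma bperiodic_Lpnorm p g : (0 < p)%E -> bperiodic g -> (Lpnorm p g < +oo)%E.
Proof.
by move=> p0 [mg _ [B gB]]; apply: le_lt_trans (Lpnorm_bounded p0 mg gB) (ltry _).
Qed.

Lemma bperiodic_trigsum s c : bperiodic (@trigsum R d s c).
Proof.
by split; [exact: cmeasurable_trigsum|exact: Zperiodic_trigsum|exact: cbounded_trigsum].
Qed.

Lemma cint_real (a : 'cV[R]_d -> R) :
  cint (fun x => (a x)%:C) = (\int[P]_x a x)%:C.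
Proof. by rewrite /cint /= Rintegral_cst// mul0r. Qed.

Lemma duality_finite (r q C : R) F : 1 < r -> 1 < q -> r^-1 + q^-1 = 1 ->
  bperiodic F -> 0 <= C ->
  (forall g, bperiodic g ->
     ((normc (pairing F g))%:E <= C%:E * Lpnorm q%:E g)%E) ->
  (Lpnorm r%:E F <= C%:E)%E.
Proof.
move=> r1 q1 rq [mF pF [B FB]] C0 H.
have B0 : 0 <= B := le_trans (normc_ge0 _) (FB 0).
have r0 : 0 < r by lra.
have q0 : 0 < q by lra.
have rqr : (r - 1) * q = r.
  have : r * q * (r^-1 + q^-1) = r * q by rewrite rq mulr1.
  rewrite mulrDr mulrAC mulfV ?gt_eqF// mul1r -mulrA mulfV ?gt_eqF// mulr1.
  by move=> e; rewrite mulrBl mul1r -e; ring.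
(* The extremal function [F * |F| ^ (r - 2)]. It satisfies [|g| ^ q = |F| ^ r] because
   [(r - 1) * q = r]. The zeros of F are treated apart, since r - 2 may be negative or 0. *)
pose w x := normc (F x) `^ (r - 2).
pose g x := F x * (w x)%:C.
have ng x : normc (g x) = normc (F x) `^ (r - 1).
  rewrite /g normcM normc_realC ger0_norm ?powR_ge0// /w.
  have [->|n0] := eqVneq (normc (F x)) 0.
    by rewrite mul0r powR0//; lra.
  rewrite -[X in X * _]powRr1 ?normc_ge0// -powRD ?n0 ?implybT//.
  by congr (_ `^ _); ring.
have Fg x : F x * (g x)^* = (normc (F x) `^ r)%:C.
  rewrite /g conjCM [((w x)%:C)^*]conjc_real mulrA mul_conjc -rmorphM /=; congr (_%:C).
  rewrite /w; have [->|n0] := eqVneq (normc (F x)) 0.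
    by rewrite expr0n/= mul0r powR0//; lra.
  rewrite -powR_mulrn ?normc_ge0// -powRD ?n0 ?implybT//.
  by congr (_ `^ _); ring.
have bg : bperiodic g.
  split.
  - apply: cmeasurableM => //; apply: cmeasurable_real.
    exact: measurable_powR_normc.
  - by move=> x k; rewrite /g /w pF.
  - exists (B `^ (r - 1)) => x; rewrite ng ge0_ler_powR ?nnegrE ?normc_ge0//; lra.
have Ifin : Lqint r F \is a fin_num.
  apply: Lqint_fin_num => //; apply: (@bperiodic_Lpnorm r%:E) => //.
    by split => //; exists B.
pose I := fine (Lqint r F).
have I0 : 0 <= I by rewrite fine_ge0// Lqint_ge0.
have := H g bg.
rewrite /pairing; under [X in cint X]eq_fun do rewrite Fg.
rewrite cint_real normc_realC ger0_norm; last first.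
  by apply: Rintegral_ge0 => x _; rewrite powR_ge0.
rewrite /Rintegral -/(Lqint r F) -/I !Lpnorm_fin.
have -> : Lqint q g = Lqint r F.
  by apply: eq_integral => x _; rewrite ng -powRrM rqr.
rewrite -(fineK Ifin) -/I !poweR_EFin -EFinM !lee_fin => h.
(* The inequality reads [I <= C * I ^ (1/q)]; dividing by the last factor requires I to be
   nonzero. *)
have [I00|In0] := eqVneq I 0; first by rewrite I00 powR0// invr_neq0// gt_eqF.
have Iq : 0 < I `^ q^-1 by rewrite powR_gt0// lt_neqAle eq_sym In0.
rewrite -(ler_pM2r Iq); apply: le_trans h.
by rewrite -powRD ?In0 ?implybT// rq powRr1.
Qed.

Lemma duality_infinite (C : R) F : bperiodic F -> 0 <= C ->
  (forall g, bperiodic g ->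
     ((normc (pairing F g))%:E <= C%:E * Lpnorm 1%:E g)%E) ->
  (Lpnorm +oo%E F <= C%:E)%E.
Proof.
move=> [mF pF [B FB]] C0 H.
(* The test function is the phase of F on the set where [C < |F|], and 0 elsewhere. *)
pose a x : R := if C < normc (F x) then (normc (F x))^-1 else 0.
have mnF := measurable_normc mF.
have ma : measurable_fun [set: 'cV[R]_d] a.
  apply: measurable_fun_ifT => //.
    by apply: measurable_fun_ltr => //; exact: measurable_cst.
  under eq_fun do rewrite -powR_inv1 ?normc_ge0//.
  exact: measurable_powR_normc.
pose g x := F x * (a x)%:C.
pose b x : R := if C < normc (F x) then 1 else 0.
have ng x : normc (g x) = b x.
  rewrite /g /a /b normcM normc_realC; case: ifP => h; last by rewrite normr0 mulr0.
  have n0 : 0 < normc (F x) by apply: le_lt_trans h.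
  by rewrite ger0_norm ?invr_ge0 ?normc_ge0// mulfV ?gt_eqF.
have Fg x : F x * (g x)^* = (normc (F x) * b x)%:C.
  rewrite /g conjCM [((a x)%:C)^*]conjc_real mulrA mul_conjc -rmorphM /=; congr (_%:C).
  rewrite /a /b; case: ifP => h; last by rewrite !mulr0.
  have n0 : 0 < normc (F x) by apply: le_lt_trans h.
  by rewrite mulr1 expr2 -mulrA mulfV ?gt_eqF// mulr1.
have mb : measurable_fun [set: 'cV[R]_d] b.
  apply: measurable_fun_ifT => //.
  by apply: measurable_fun_ltr => //; exact: measurable_cst.
have bg : bperiodic g.
  split.
  - by apply: cmeasurableM => //; exact: cmeasurable_real.
  - by move=> x k; rewrite /g /a pF.
  - by exists 1 => x; rewrite ng /b; case: ifP.
have b0 x : 0 <= b x by rewrite /b; case: ifP.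
have := H g bg.
rewrite /pairing; under [X in cint X]eq_fun do rewrite Fg.
rewrite cint_real normc_realC ger0_norm; last first.
  by apply: Rintegral_ge0 => x _; rewrite mulr_ge0 ?normc_ge0.
rewrite Lpnorm_fin invr1 poweRe1 ?Lqint_ge0// /Lqint.
under eq_integral do rewrite ng powRr1//.
have ib : P.-integrable [set: 'cV[R]_d] (EFin \o b).
  have /cintegrableP[+ _] : cintegrable (fun x => (b x)%:C : R[i]).
    apply: bounded_cintegrable; first exact: cmeasurable_real.
    by exists 1 => x; rewrite normc_realC ger0_norm// /b; case: ifP.
  by [].
have iFb : P.-integrable [set: 'cV[R]_d] (EFin \o (fun x => normc (F x) * b x)).
  have /cintegrableP[+ _] : cintegrable (fun x => (normc (F x) * b x)%:C : R[i]).
    apply: bounded_cintegrable; first by apply: cmeasurable_real; exact: measurable_funM.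
    exists B => x; rewrite normc_realC ger0_norm ?mulr_ge0 ?normc_ge0// /b.
    by case: ifP; rewrite ?mulr1// mulr0 (le_trans _ (FB x))// normc_ge0.
  by [].
rewrite /Rintegral -(fineK (integrable_fin_num measurableT ib)) -EFinM lee_fin.
rewrite -[X in _ <= _ * X]/(\int[P]_x b x) -[X in X <= _]/(\int[P]_x (normc (F x) * b x)).
rewrite -RintegralZl// -subr_le0 -RintegralB//; last first.
  by have := integrableZl measurableT C ib; apply: eq_integrable.
move=> h.
(* The excess of |F| over C is nonnegative with integral at most 0, hence vanishes almost
   everywhere. *)
pose e x := normc (F x) * b x - C * b x.
have e0 x : 0 <= e x.
  rewrite /e /b; case: ifP => h'; last by rewrite !mulr0 subrr.
  by rewrite !mulr1 subr_ge0 ltW.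
have ie : P.-integrable [set: 'cV[R]_d] (EFin \o e).
  have := integrableB measurableT iFb (integrableZl measurableT C ib).
  by apply: eq_integrable.
have int0 : (\int[P]_x `|(EFin \o e) x| = 0)%E.
  under eq_integral do rewrite gee0_abs ?lee_fin//.
  apply/eqP; rewrite eq_le integral_ge0 ?andbT; last by move=> x _; rewrite lee_fin.
  by rewrite -(fineK (integrable_fin_num measurableT ie)) lee_fin.
have me : measurable_fun [set: 'cV[R]_d] (EFin \o e) by case/integrableP: ie.
have := (ae_eq_integral_abs P measurableT me).1 int0.
rewrite Lpnorm_infE => ae; apply/ess_supP.
apply: filterS ae => x /(_ Logic.I) /= [].
rewrite /e /b; case: ifP => [hC|/negbT]; last by rewrite -leNgt lee_fin.
by rewrite !mulr1 => /eqP; rewrite subr_eq0 => /eqP ->.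
Qed.

Lemma Lpnorm_duality p q (C : R) F : conjugate_exponents p q ->
  bperiodic F -> 0 <= C ->
  (forall g, bperiodic g ->
     ((normc (pairing F g))%:E <= C%:E * Lpnorm q%:E g)%E) ->
  (Lpnorm p F <= C%:E)%E.
Proof.
move=> [[-> ->]|[r [-> r1 q1 rq]]]; first exact: duality_infinite.
exact: duality_finite.
Qed.

End duality.

(** * Jensen's inequality for sums and integrals *)

Section jensen.
Variables (R : realType) (d : nat).
Local Notation P := (@torus_prob R d).
Implicit Types (q s W : R).

(** Convexity of [u ^ q] as a tangent line inequality at s, from Young's inequality. In this linear
    form it can be summed or integrated against weights. *)
Lemma powR_tangent q (u s : R) : 1 <= q -> 0 <= u -> 0 <= s ->
  q * s `^ (q - 1) * u - (q - 1) * s `^ q <= u `^ q.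
Proof.
rewrite le_eqVlt => /predU1P[<-|q1] u0 s0.
  by rewrite subrr mul0r subr0 powRr0 !mul1r powRr1.
have q0 : 0 < q by lra.
have r0 : 0 < q / (q - 1) by rewrite divr_gt0//; lra.
have := @conjugate_powR _ (s `^ (q - 1)) u _ _ (powR_ge0 _ _) u0 r0 q0.
rewrite invf_div.
have -> : (q - 1) / q + q^-1 = 1 by field; rewrite gt_eqF.
move=> /(_ erefl); rewrite -powRrM [(q - 1) * _]mulrC divfK; last by rewrite subr_eq0 gt_eqF.
move=> h; have : q * (s `^ (q - 1) * u) <= q * (s `^ q * ((q - 1) / q) + u `^ q / q).
  by rewrite ler_pM2l.
rewrite mulrDr [q * (u `^ q / q)]mulrC divfK ?gt_eqF//.
have -> : q * (s `^ q * ((q - 1) / q)) = (q - 1) * s `^ q.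
  by field; rewrite gt_eqF.
by rewrite mulrA; lra.
Qed.

Lemma powR_jensen_of_tangents q (a W B : R) : 1 <= q -> 0 <= a -> 0 < W ->
  (forall s, 0 <= s -> q * s `^ (q - 1) * a - (q - 1) * s `^ q * W <= B) ->
  a `^ q <= W `^ (q - 1) * B.
Proof.
(* The best tangency point is the weighted mean a / W. *)
move=> q1 a0 W0 /(_ (a / W) (divr_ge0 a0 (ltW W0))).
have q0 : 0 < q by lra.
have E : (a / W) `^ q = a / W * (a / W) `^ (q - 1).
  by rewrite mulr_powRB1 ?divr_ge0// ltW.
have -> : q * (a / W) `^ (q - 1) * a - (q - 1) * (a / W) `^ q * W = a * (a / W) `^ (q - 1).
  by rewrite E; field; rewrite gt_eqF.
have Wq0 : 0 < W `^ (q - 1) by rewrite powR_gt0.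
rewrite -(ler_pM2l Wq0); apply: le_trans.
rewrite mulrCA -powRM ?divr_ge0// ?(ltW W0)// [W * _]mulrC divfK ?gt_eqF//.
by rewrite mulr_powRB1.
Qed.

(** An upper bound W of the total weight suffices, because the constant term of each tangent line is
    nonpositive. *)
Lemma sum_jensen (I : Type) (r : seq I) (w u : I -> R) q W : 1 <= q -> 0 < W ->
  (forall i, 0 <= w i) -> (forall i, 0 <= u i) -> \sum_(i <- r) w i <= W ->
  (\sum_(i <- r) w i * u i) `^ q <= W `^ (q - 1) * \sum_(i <- r) w i * u i `^ q.
Proof.
move=> q1 W0 w0 u0 wW; apply: powR_jensen_of_tangents => //.
  by apply: sumr_ge0 => i _; rewrite mulr_ge0.
move=> s s0; have sq0 := powR_ge0 s q.
apply: (@le_trans _ _ (\sum_(i <- r) w i * (q * s `^ (q - 1) * u i - (q - 1) * s `^ q))).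
  rewrite [leRHS](eq_bigr (fun i => q * s `^ (q - 1) * (w i * u i) - (q - 1) * s `^ q * w i)); last first.
    by move=> i _; ring.
  rewrite sumrB -!mulr_sumr lerD2l lerN2 ler_wpM2l// mulr_ge0//; lra.
apply: ler_sum => i _; rewrite ler_wpM2l//; exact: powR_tangent.
Qed.

Definition bmeasurable (a : 'cV[R]_d -> R) :=
  measurable_fun [set: 'cV[R]_d] a /\ exists B, forall x, `|a x| <= B.

Implicit Types a b w u : 'cV[R]_d -> R.

Lemma bmeasurable_integrable a : bmeasurable a ->
  P.-integrable [set: 'cV[R]_d] (EFin \o a).
Proof.
move=> [ma [B aB]].
have /cintegrableP[+ _] : cintegrable (fun x => (a x)%:C : R[i]).
  apply: bounded_cintegrable; first exact: cmeasurable_real.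
  by exists B => x; rewrite normc_realC.
by [].
Qed.

Lemma bmeasurableM a b : bmeasurable a -> bmeasurable b ->
  bmeasurable (fun x => a x * b x).
Proof.
move=> [ma [B aB]] [mb [B' bB]]; split; first exact: measurable_funM.
by exists (B * B') => x; rewrite normrM ler_pM.
Qed.

Lemma bmeasurableD a b : bmeasurable a -> bmeasurable b ->
  bmeasurable (fun x => a x + b x).
Proof.
move=> [ma [B aB]] [mb [B' bB]]; split; first exact: measurable_funD.
by exists (B + B') => x; apply: le_trans (ler_normD _ _) _; exact: lerD.
Qed.

Lemma bmeasurable_cst (c : R) : bmeasurable (fun _ : 'cV[R]_d => c).
Proof. by split; [exact: measurable_cst|exists `|c|]. Qed.

Lemma bmeasurable_sum (I : Type) (r : seq I) (F : I -> 'cV[R]_d -> R) :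
  (forall i, bmeasurable (F i)) -> bmeasurable (fun x => \sum_(i <- r) F i x).
Proof.
move=> mF; elim: r => [|i r IH].
  by under eq_fun do rewrite big_nil; exact: bmeasurable_cst.
by under eq_fun do rewrite big_cons; exact: bmeasurableD.
Qed.

Lemma bmeasurable_normc f : bperiodic f -> bmeasurable (fun x => normc (f x)).
Proof.
move=> [mf _ [B fB]]; split; first exact: measurable_normc.
by exists B => x; rewrite ger0_norm ?normc_ge0.
Qed.

Lemma bmeasurable_powR a q : 0 <= q -> (forall x, 0 <= a x) -> bmeasurable a ->
  bmeasurable (fun x => a x `^ q).
Proof.
move=> q0 a0 [ma [B aB]]; split; first exact: (measurableT_comp (measurable_powR q)).
exists (B `^ q) => x; rewrite ger0_norm ?powR_ge0// ge0_ler_powR ?nnegrE//.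
  by apply: le_trans (aB 0).
by rewrite -(ger0_norm (a0 x)).
Qed.

Lemma le_mean a b : bmeasurable a -> bmeasurable b ->
  (forall x, a x <= b x) -> \int[P]_x a x <= \int[P]_x b x.
Proof. by move=> ma mb ab; apply: le_Rintegral => //; exact: bmeasurable_integrable. Qed.

Lemma mean_ge0 a : (forall x, 0 <= a x) -> 0 <= \int[P]_x a x.
Proof. by move=> a0; apply: Rintegral_ge0. Qed.

Lemma meanD a b : bmeasurable a -> bmeasurable b ->
  \int[P]_x (a x + b x) = \int[P]_x a x + \int[P]_x b x.
Proof. by move=> ma mb; rewrite RintegralD//; exact: bmeasurable_integrable. Qed.

Lemma meanZ a (c : R) : bmeasurable a ->
  \int[P]_x (c * a x) = c * \int[P]_x a x.
Proof. by move=> ma; rewrite RintegralZl//; exact: bmeasurable_integrable. Qed.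

Lemma mean_sum (I : Type) (r : seq I) (F : I -> 'cV[R]_d -> R) :
  (forall i, bmeasurable (F i)) ->
  \int[P]_x (\sum_(i <- r) F i x) = \sum_(i <- r) \int[P]_x (F i x).
Proof.
move=> mF; elim: r => [|i r IH].
  under eq_Rintegral do rewrite big_nil.
  by rewrite Rintegral_cst// mul0r big_nil.
under eq_Rintegral do rewrite big_cons.
by rewrite meanD// ?IH ?big_cons//; exact: bmeasurable_sum.
Qed.

Lemma mean_cst (c : R) : \int[P]_x c = c.
Proof. by rewrite /Rintegral integral_cst//= probability_setT mule1. Qed.

Lemma mean_jensen w u q W : 1 <= q -> 0 < W ->
  bmeasurable w -> bmeasurable u ->
  (forall x, 0 <= w x) -> (forall x, 0 <= u x) -> \int[P]_x w x <= W ->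
  (\int[P]_x (w x * u x)) `^ q <= W `^ (q - 1) * \int[P]_x (w x * u x `^ q).
Proof.
move=> q1 W0 mw mu w0 u0 wW; apply: powR_jensen_of_tangents => //.
  by apply: mean_ge0 => x; rewrite mulr_ge0.
move=> s s0; have sq0 := powR_ge0 s q.
have q0 : 0 <= q by lra.
have mwu := bmeasurableM mw mu.
apply: (@le_trans _ _ (\int[P]_x (w x * (q * s `^ (q - 1) * u x - (q - 1) * s `^ q)))).
  rewrite [leRHS](@eq_Rintegral _ _ _ _ _
    (fun x => q * s `^ (q - 1) * (w x * u x) + (- ((q - 1) * s `^ q)) * w x)); last first.
    by move=> x _; ring.
  rewrite meanD; try by apply: bmeasurableM => //; exact: bmeasurable_cst.
  rewrite !meanZ// lerD2l mulNr lerN2 ler_wpM2l// mulr_ge0//; lra.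
apply: le_mean.
- apply: bmeasurableM => //; apply: bmeasurableD; last exact: bmeasurable_cst.
  by apply: bmeasurableM => //; exact: bmeasurable_cst.
- by apply: bmeasurableM => //; exact: bmeasurable_powR.
- by move=> x; rewrite ler_wpM2l//; exact: powR_tangent.
Qed.

Lemma LqintE q f : 0 <= q -> bperiodic f ->
  Lqint q f = (\int[P]_x (normc (f x) `^ q))%:E.
Proof.
move=> q0 bf; rewrite /Rintegral fineK//.
apply: integrable_fin_num => //; apply: bmeasurable_integrable.
apply: bmeasurable_powR => //; first by move=> x; exact: normc_ge0.
exact: bmeasurable_normc.
Qed.

End jensen.

(** * Kernels of de la Vallee Poussin type *)

Section de_la_Vallee_Poussin.
Variables (R : realType) (d : nat).
Local Notation P := (@torus_prob R d).
Implicit Types (I J s : seq 'cV[int]_d) (k l y z : 'cV[int]_d) (x t : 'cV[R]_d).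
Implicit Types (f g : 'cV[R]_d -> R[i]) (q : R).

Definition dirichlet I : 'cV[R]_d -> R[i] := trigsum I (fun=> 1).

(** This is |I| times a Fejer kernel; its integral is |I|. *)
Definition sqD I x : R := normc (dirichlet I x) ^+ 2.

(* (1/|J|) D_I conj(D_J): its coefficient at l is 1 when l + J is contained
   in I, and it is dominated by (|D_I|^2 + |D_J|^2)/(2|J|). *)
Definition vpcoef I J l : R :=
  (count (fun y => l + y \in I) J)%:R / (size J)%:R.

Definition vpsupp I J := undup [seq z - y | z <- I, y <- J].

Definition vpkernel I J : 'cV[R]_d -> R[i] :=
  trigsum (vpsupp I J) (fun l => (vpcoef I J l)%:C).

Definition vpsum I J f : 'cV[R]_d -> R[i] :=
  trigsum (vpsupp I J) (fun l => (vpcoef I J l)%:C * fourier f l).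

Definition vpmaj I J x : R := (sqD I x + sqD J x) / (2 * (size J)%:R).

(** The integral of [vpmaj], which bounds the L_1 norm of the kernel. *)
Definition vpmass I J : R := ((size I)%:R + (size J)%:R) / (2 * (size J)%:R).

Lemma vpcoef_ge0 I J l : 0 <= vpcoef I J l.
Proof. by rewrite divr_ge0. Qed.

Lemma vpcoef_le1 I J l : vpcoef I J l <= 1.
Proof.
rewrite /vpcoef; have [->|J0] := eqVneq (size J) 0; first by rewrite invr0 mulr0.
by rewrite ler_pdivrMr ?ltr0n ?lt0n// mul1r ler_nat count_size.
Qed.

Lemma vpsupp_uniq I J : uniq (vpsupp I J).
Proof. exact: undup_uniq. Qed.

Lemma vpcoef_out I J l : l \notin vpsupp I J -> vpcoef I J l = 0.
Proof.
rewrite mem_undup => /allpairsP h.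
rewrite /vpcoef; suff -> : count (fun y => l + y \in I) J = 0%N by rewrite mul0r.
apply/eqP; rewrite -leqn0 leqNgt -has_count; apply/negP => /hasP[y yJ lI].
by apply: h; exists (l + y, y); split => //=; rewrite addrK.
Qed.

Lemma vpcoef_eq1 I J l : (0 < size J)%N ->
  (forall y, y \in J -> l + y \in I) -> vpcoef I J l = 1.
Proof.
move=> J0 h; rewrite /vpcoef (_ : count _ _ = size J).
  by rewrite mulfV// pnatr_eq0 -lt0n.
by apply/eqP; rewrite -all_count; apply/allP.
Qed.

Lemma sum_sub_uniq (V : nmodType) (r s : seq 'cV[int]_d) (F : 'cV[int]_d -> V) :
  uniq r -> uniq s -> {subset r <= s} ->
  \sum_(l <- r) F l = \sum_(l <- s | l \in r) F l.
Proof.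
move=> ur us rs; rewrite -[RHS]big_filter; apply: perm_big; apply: uniq_perm => //.
  exact: filter_uniq.
move=> l; rewrite mem_filter; apply/idP/andP => [lr|[]//].
by split=> //; exact: rs.
Qed.

(** In the product the frequency l arises once for every y in J with l + y in I; this count is the
    numerator of [vpcoef]. *)
Lemma vpkernelE I J x : uniq I ->
  vpkernel I J x = ((size J)%:R^-1)%:C * (dirichlet I x * (dirichlet J x)^*).
Proof.
move=> uI; rewrite /vpkernel /dirichlet /trigsum conjC_sum mulr_sumr.
transitivity (((size J)%:R^-1)%:C * \sum_(y <- J)
  \sum_(l <- vpsupp I J | l + y \in I) character l x); last first.
  congr (_ * _); apply: eq_big_seq => y yJ.
  rewrite conjCM conjC1 mul1r mulr_suml.
  transitivity (\sum_(l <- [seq z - y | z <- I]) character l x : R[i]).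
    rewrite [RHS](sum_sub_uniq _ _ (vpsupp_uniq I J)).
    - apply: eq_bigl => l; apply/idP/mapP => [lI|[z zI ->]]; last by rewrite subrK.
      by exists (l + y) => //; rewrite addrK.
    - by rewrite map_inj_uniq//; exact: addIr.
    - move=> l /mapP[z zI ->]; rewrite mem_undup; apply/allpairsP.
      by exists (z, y).
  rewrite big_map; apply: eq_bigr => z _.
  by rewrite characterDl characterNl mul1r.
rewrite (exchange_big_dep predT)//= mulr_sumr; apply: eq_bigr => l _.
rewrite big_const_seq iter_addr_0 -(mulr_natl (character l x)) mulrA; congr (_ * _).
rewrite /vpcoef mulrC rmorphM/=; congr (_ * _).
by rewrite -(rmorph_nat (real_complex R)).
Qed.

Lemma normc_vpkernel I J x : uniq I -> normc (vpkernel I J x) <= vpmaj I J x.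
Proof.
move=> uI; rewrite vpkernelE// normcM normc_realC ger0_norm ?invr_ge0//.
rewrite normcM normc_conj /vpmaj /sqD.
set a := normc _; set b := normc _.
have [->|J0] := eqVneq (size J) 0%N; first by rewrite !(mulr0, invr0, mul0r).
have -> : (a ^+ 2 + b ^+ 2) / (2 * (size J)%:R) = (size J)%:R^-1 * ((a ^+ 2 + b ^+ 2) / 2).
  by rewrite invfM; ring.
rewrite ler_wpM2l ?invr_ge0//.
by have := sqr_ge0 (a - b); rewrite sqrrB; lra.
Qed.

Lemma sqD_ge0 I x : 0 <= sqD I x.
Proof. exact: sqr_ge0. Qed.

Lemma vpmaj_ge0 I J x : 0 <= vpmaj I J x.
Proof. by rewrite divr_ge0 ?addr_ge0 ?sqD_ge0 ?mulr_ge0. Qed.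

Lemma sqDB I x t : sqD I (x - t) =
  normc (trigsum I (fun z => (character z x)^*) t) ^+ 2.
Proof.
rewrite /sqD -[in LHS]normc_conj /dirichlet /trigsum conjC_sum.
congr (normc _ ^+ 2); apply: eq_bigr => z _.
by rewrite mul1r characterDr characterNr conjCM conjCK.
Qed.

Lemma sqD_opp I x : sqD I (- x) = sqD I x.
Proof.
rewrite /sqD -[in LHS]normc_conj /dirichlet /trigsum conjC_sum.
congr (normc _ ^+ 2); apply: eq_bigr => z _.
by rewrite !mul1r characterNr conjCK.
Qed.

Lemma vpmaj_sym I J x t : vpmaj I J (x - t) = vpmaj I J (t - x).
Proof. by rewrite /vpmaj -!(sqD_opp _ (t - x)) opprB. Qed.

Lemma bmeasurable_sqD I x : bmeasurable (fun t => sqD I (x - t)).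
Proof.
under eq_fun do rewrite sqDB expr2.
by apply: bmeasurableM; apply: bmeasurable_normc; exact: bperiodic_trigsum.
Qed.

Lemma bmeasurable_vpmaj I J x : bmeasurable (fun t => vpmaj I J (x - t)).
Proof.
apply: bmeasurableM; last exact: bmeasurable_cst.
by apply: bmeasurableD; exact: bmeasurable_sqD.
Qed.

Lemma mean_sqD I x : uniq I -> \int[P]_t sqD I (x - t) = (size I)%:R.
Proof.
move=> uI; under eq_Rintegral do rewrite sqDB.
transitivity (\sum_(z <- I) normc ((character z x)^* ) ^+ 2).
  by rewrite /Rintegral parseval.
under eq_bigr do rewrite normc_conj normc_character expr1n.
by rewrite big_const_seq count_predT iter_addr_0.
Qed.

Lemma mean_vpmaj I J x : uniq I -> uniq J ->
  \int[P]_t vpmaj I J (x - t) = vpmass I J.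
Proof.
move=> uI uJ; under eq_Rintegral do rewrite /vpmaj mulrC.
rewrite meanZ; last by apply: bmeasurableD; exact: bmeasurable_sqD.
rewrite meanD; [|exact: bmeasurable_sqD..].
by rewrite (mean_sqD x uI) (mean_sqD x uJ) /vpmass mulrC.
Qed.

Lemma sqD_complex I x : (sqD I x)%:C =
  \sum_(z <- I) \sum_(y <- I) character (z - y) x :> R[i].
Proof.
rewrite /sqD -mul_conjc /dirichlet /trigsum conjC_sum mulr_suml.
apply: eq_bigr => z _; rewrite mulr_sumr; apply: eq_bigr => y _.
by rewrite conjCM conjC1 !mul1r characterDl characterNl.
Qed.

(** The convolution is an explicit trigonometric polynomial in x. Its measurability and its mean
    over x are read off the coefficients, in place of a Fubini argument. *)
Lemma convolution_sqD I (G : 'cV[R]_d -> R) x : bmeasurable G ->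
  (\int[P]_t (sqD I (x - t) * G t))%:C =
  \sum_(z <- I) \sum_(y <- I) fourier (fun t => (G t)%:C) (z - y) * character (z - y) x.
Proof.
move=> bG; have [mG [B GB]] := bG.
have iG : cintegrable (fun t => (G t)%:C : R[i]).
  apply: bounded_cintegrable; first exact: cmeasurable_real.
  by exists B => t; rewrite normc_realC.
rewrite -cint_real.
have E t : (sqD I (x - t) * G t)%:C = \sum_(z <- I) \sum_(y <- I)
    character (z - y) x * ((G t)%:C * character (- (z - y)) t) :> R[i].
  rewrite rmorphM /= sqD_complex mulr_suml; apply: eq_bigr => z _.
  rewrite mulr_suml; apply: eq_bigr => y _.
  by rewrite characterDr characterNr characterNl; ring.
under [X in cint X]eq_fun do rewrite E.
have iGl (l : 'cV[int]_d) := cintegrableM_character l iG.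
rewrite cint_sum => [|z]; last by apply: cintegrable_sum => y; exact: cintegrableZ.
apply: eq_bigr => z _; rewrite cint_sum => [|y]; last exact: cintegrableZ.
by apply: eq_bigr => y _; rewrite cintZ// mulrC.
Qed.

Lemma bmeasurable_convolution_sqD I (G : 'cV[R]_d -> R) : bmeasurable G ->
  bmeasurable (fun x => \int[P]_t (sqD I (x - t) * G t)).
Proof.
move=> bG.
have E x : \int[P]_t (sqD I (x - t) * G t) = complex.Re
  (\sum_(z <- I) \sum_(y <- I) fourier (fun t => (G t)%:C) (z - y) * character (z - y) x).
  by rewrite -convolution_sqD.
under eq_fun do rewrite E.
pose F x := \sum_(z <- I) \sum_(y <- I)
  fourier (fun t => (G t)%:C) (z - y) * character (z - y) x.
have [mF _] : cmeasurable F.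
  apply: cmeasurable_sum => z; apply: cmeasurable_sum => y.
  by apply: cmeasurableM; [exact: cmeasurable_cst|exact: cmeasurable_character].
split => //.
exists (\sum_(z <- I) \sum_(y <- I) normc (fourier (fun t => (G t)%:C) (z - y))) => x.
apply: le_trans (ReC_le _) _; apply: le_trans (normc_sum _ _ _) _.
apply: ler_sum => z _; apply: le_trans (normc_sum _ _ _) _; apply: ler_sum => y _.
by rewrite normcM normc_character mulr1.
Qed.

Lemma mean_convolution_sqD I (G : 'cV[R]_d -> R) : uniq I -> bmeasurable G ->
  \int[P]_x \int[P]_t (sqD I (x - t) * G t) = (size I)%:R * \int[P]_x G x.
Proof.
move=> uI bG; have [mG _] := bG.
suff : (\int[P]_x \int[P]_t (sqD I (x - t) * G t))%:C =
   ((size I)%:R * \int[P]_x G x)%:C :> R[i] by case.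
rewrite -cint_real; under [X in cint X]eq_fun do rewrite convolution_sqD//.
rewrite cint_sum => [|z]; last first.
  by apply: cintegrable_sum => y; apply: cintegrableZ; exact: cintegrable_character.
have -> : ((size I)%:R * \int[P]_x G x)%:C =
    \sum_(z <- I) fourier (fun t => (G t)%:C) 0 :> R[i].
  have -> : fourier (fun t => (G t)%:C) 0 = (\int[P]_x G x)%:C :> R[i].
    rewrite -cint_real /fourier oppr0; congr cint; apply/funext => t.
    by rewrite character0 mulr1.
  by rewrite -rmorph_sum/= big_const_seq count_predT iter_addr_0 mulr_natl.
(* Only the diagonal terms z = y have frequency 0 and survive the integration. *)
apply: eq_big_seq => z zI; rewrite cint_sum => [|y]; last first.
  by apply: cintegrableZ; exact: cintegrable_character.
rewrite (bigD1_seq z)//= subrr cintZ; last exact: cintegrable_character.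
rewrite cint_character eqxx mulr1 big1 ?addr0// => y yz.
rewrite cintZ; last exact: cintegrable_character.
by rewrite cint_character subr_eq0 eq_sym (negbTE yz) mulr0.
Qed.

End de_la_Vallee_Poussin.

(** * Young and Marcinkiewicz-Zygmund inequalities for the kernels *)

Section vp_inequalities.
Variables (R : realType) (d : nat).
Local Notation P := (@torus_prob R d).
Implicit Types (I J : seq 'cV[int]_d) (x t : 'cV[R]_d).
Implicit Types (f g : 'cV[R]_d -> R[i]) (q W : R).

Lemma normc_cint_le f (b : 'cV[R]_d -> R) : cintegrable f -> bmeasurable b ->
  (forall x, normc (f x) <= b x) -> normc (cint f) <= \int[P]_x b x.
Proof.
move=> fi mb fb; rewrite -lee_fin; apply: le_trans (normc_cint fi) _.
rewrite /Rintegral fineK; last by apply: integrable_fin_num => //; exact: bmeasurable_integrable.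
apply: ge0_le_integral => //.
- by move=> x _; rewrite lee_fin normc_ge0.
- by apply: measurable_normcE; case: fi.
- by apply/measurable_EFinP; case: mb.
- by move=> x _; rewrite lee_fin.
Qed.

Lemma bmeasurable_normc_powR f q : 0 <= q -> bperiodic f ->
  bmeasurable (fun x => normc (f x) `^ q).
Proof.
move=> q0 bf; apply: bmeasurable_powR => //; first by move=> x; exact: normc_ge0.
exact: bmeasurable_normc.
Qed.

Lemma cintegrableM_bperiodic f g : bperiodic f -> cmeasurable g -> cbounded g ->
  cintegrable (fun x => f x * g x).
Proof. by move=> /bperiodic_cintegrable; exact: cintegrableM. Qed.

Lemma cmeasurable_reflect x f : cmeasurable f -> cmeasurable (fun t => f (x - t)).
Proof.
move=> mf; have := cmeasurable_opp (cmeasurable_shift x mf).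
by under eq_fun do rewrite addrC.
Qed.

Lemma vpmass_ge0 I J : 0 <= vpmass R I J.
Proof. by rewrite /vpmass divr_ge0 ?addr_ge0 ?mulr_ge0. Qed.

Lemma vpmass_gt0 I J : (0 < size J)%N -> 0 < vpmass R I J.
Proof.
by move=> J0; rewrite /vpmass divr_gt0 ?mulr_gt0 ?ltr0n// ltr_wpDl// ltr0n.
Qed.

(** Jensen's inequality for the convolution, with the majorant of the kernel as weight. *)
Lemma vp_pointwise I J f q x : uniq I -> uniq J -> (0 < size J)%N -> 1 <= q ->
  bperiodic f ->
  normc (vpsum I J f x) `^ q <=
    vpmass R I J `^ (q - 1) * \int[P]_t (vpmaj I J (x - t) * normc (f t) `^ q).
Proof.
move=> uI uJ J0 q1 bf; have [mf _ _] := bf.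
have q0 : 0 <= q by lra.
have bk := bperiodic_trigsum (vpsupp I J) (fun l => (vpcoef R I J l)%:C).
have W0 := vpmass_gt0 I J0.
have bw := bmeasurable_vpmaj I J x.
have w0 t := vpmaj_ge0 I J (x - t).
have wW : \int[P]_t vpmaj I J (x - t) <= vpmass R I J by rewrite mean_vpmaj.
apply: le_trans (mean_jensen q1 W0 bw (bmeasurable_normc bf) w0 (fun t => normc_ge0 _) wW).
rewrite ge0_ler_powR ?nnegrE ?normc_ge0//.
  by apply: mean_ge0 => t; rewrite mulr_ge0 ?normc_ge0.
rewrite /vpsum trigsum_convolution; last exact: bperiodic_cintegrable.
apply: normc_cint_le.
- apply: cintegrableM_bperiodic => //.
    by apply: cmeasurable_reflect; case: bk.
  by case: bk => _ _ [B kB]; exists B => t; exact: kB.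
- by apply: bmeasurableM => //; exact: bmeasurable_normc.
- move=> t; rewrite normcM mulrC ler_wpM2r ?normc_ge0//; exact: normc_vpkernel.
Qed.

Lemma mean_vpmaj_mul I J (G : 'cV[R]_d -> R) x : bmeasurable G ->
  \int[P]_t (vpmaj I J (x - t) * G t) = (2 * (size J)%:R)^-1 *
    (\int[P]_t (sqD I (x - t) * G t) + \int[P]_t (sqD J (x - t) * G t)).
Proof.
move=> bG; rewrite -meanD; try by apply: bmeasurableM => //; exact: bmeasurable_sqD.
rewrite -meanZ; last first.
  by apply: bmeasurableD; apply: bmeasurableM => //; exact: bmeasurable_sqD.
by apply: eq_Rintegral => t _; rewrite /vpmaj; ring.
Qed.

Lemma mean_convolution_vpmaj I J (G : 'cV[R]_d -> R) : uniq I -> uniq J ->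
  bmeasurable G ->
  \int[P]_x \int[P]_t (vpmaj I J (x - t) * G t) = vpmass R I J * \int[P]_x G x.
Proof.
move=> uI uJ bG; under eq_Rintegral do rewrite mean_vpmaj_mul//.
rewrite meanZ; last by apply: bmeasurableD; exact: bmeasurable_convolution_sqD.
rewrite meanD; try exact: bmeasurable_convolution_sqD.
by rewrite (mean_convolution_sqD uI bG) (mean_convolution_sqD uJ bG) /vpmass; ring.
Qed.

Lemma bmeasurable_convolution_vpmaj I J (G : 'cV[R]_d -> R) : bmeasurable G ->
  bmeasurable (fun x => \int[P]_t (vpmaj I J (x - t) * G t)).
Proof.
move=> bG; under eq_fun do rewrite mean_vpmaj_mul//.
apply: bmeasurableM; first exact: bmeasurable_cst.
by apply: bmeasurableD; exact: bmeasurable_convolution_sqD.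
Qed.

Lemma vp_bound I J f q : uniq I -> uniq J -> (0 < size J)%N -> 1 <= q ->
  bperiodic f ->
  \int[P]_x (normc (vpsum I J f x) `^ q) <=
    vpmass R I J `^ q * \int[P]_x (normc (f x) `^ q).
Proof.
move=> uI uJ J0 q1 bf; have q0 : 0 <= q by lra.
have bG := bmeasurable_normc_powR q0 bf.
apply: (@le_trans _ _ (\int[P]_x (vpmass R I J `^ (q - 1) *
    \int[P]_t (vpmaj I J (x - t) * normc (f t) `^ q)))).
  apply: le_mean.
  - by apply: bmeasurable_normc_powR => //; exact: bperiodic_trigsum.
  - apply: bmeasurableM; first exact: bmeasurable_cst.
    exact: bmeasurable_convolution_vpmaj.
  - by move=> x; exact: vp_pointwise.
rewrite meanZ; last exact: bmeasurable_convolution_vpmaj.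
rewrite mean_convolution_vpmaj// mulrA [_ * vpmass R I J]mulrC.
by rewrite mulr_powRB1 ?vpmass_ge0//; lra.
Qed.

Section sampling.
Variables (T : Type) (r : seq T) (u : T -> 'cV[R]_d).
Local Notation E := ((size r)%:R : R).

(** The modulus of the mean of a character over the sample points. On a grid it vanishes unless the
    character is 1 at all grid points. *)
Definition gridchar l : R := normc (\sum_(k <- r) character l (u k)) / E.

Definition gridmass I : R := \sum_(z <- I) \sum_(y <- I) gridchar (z - y).

(** The discrete counterpart of [vpmass]: it bounds, uniformly in t, the mean of the majorant
    centred at t over the sample points. *)
Definition vpgrid I J : R := (gridmass I + gridmass J) / (2 * (size J)%:R).

Lemma sqD_grid I t : E^-1 * \sum_(k <- r) sqD I (u k - t) <= gridmass I.
Proof.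
have s0 : 0 <= E^-1 * \sum_(k <- r) sqD I (u k - t).
  by rewrite mulr_ge0 ?invr_ge0//; apply: sumr_ge0 => k _; exact: sqD_ge0.
rewrite -(ger0_norm s0) -normc_realC rmorphM rmorph_sum /=.
under eq_bigr do rewrite sqD_complex.
rewrite (_ : \sum_(k <- r) _ = \sum_(z <- I) \sum_(y <- I)
    (character (z - y) (- t) * \sum_(k <- r) character (z - y) (u k))); last first.
  rewrite exchange_big/=; apply: eq_bigr => z _.
  rewrite exchange_big/=; apply: eq_bigr => y _.
  by rewrite mulr_sumr; apply: eq_bigr => k _; rewrite characterDr mulrC.
rewrite normcM normc_realC ger0_norm ?invr_ge0//.
rewrite /gridmass [leRHS](_ : _ = E^-1 * \sum_(z <- I) \sum_(y <- I)
    normc (\sum_(k <- r) character (z - y) (u k))); last first.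
  rewrite mulr_sumr; apply: eq_bigr => z _; rewrite mulr_sumr.
  by apply: eq_bigr => y _; rewrite mulrC.
rewrite ler_wpM2l ?invr_ge0//; apply: le_trans (normc_sum _ _ _) _.
apply: ler_sum => z _; apply: le_trans (normc_sum _ _ _) _.
by apply: ler_sum => y _; rewrite normcM normc_character mul1r.
Qed.

Lemma vpmaj_grid I J t : E^-1 * \sum_(k <- r) vpmaj I J (u k - t) <= vpgrid I J.
Proof.
rewrite /vpmaj -mulr_suml big_split/= mulrA mulrDr ler_wpM2r ?invr_ge0 ?mulr_ge0//.
by apply: lerD; exact: sqD_grid.
Qed.

(** The pointwise bound is averaged over the sample points; the average of the majorant is at most
    [vpgrid], whatever its centre t. *)
Lemma vp_sampling I J f q : uniq I -> uniq J -> (0 < size J)%N -> 1 <= q ->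
  bperiodic f ->
  E^-1 * \sum_(k <- r) normc (vpsum I J f (u k)) `^ q <=
    vpmass R I J `^ (q - 1) * vpgrid I J * \int[P]_x (normc (f x) `^ q).
Proof.
move=> uI uJ J0 q1 bf; have q0 : 0 <= q by lra.
have bG := bmeasurable_normc_powR q0 bf.
have bwk k : bmeasurable (fun t => vpmaj I J (u k - t) * normc (f t) `^ q).
  by apply: bmeasurableM => //; exact: bmeasurable_vpmaj.
apply: (@le_trans _ _ (E^-1 * \sum_(k <- r) (vpmass R I J `^ (q - 1) *
    \int[P]_t (vpmaj I J (u k - t) * normc (f t) `^ q)))).
  by rewrite ler_wpM2l ?invr_ge0//; apply: ler_sum => k _; exact: vp_pointwise.
rewrite -mulr_sumr mulrCA -mulrA ler_wpM2l ?powR_ge0//.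
rewrite -mean_sum// -!meanZ//; last exact: bmeasurable_sum.
apply: le_mean.
- by apply: bmeasurableM; [exact: bmeasurable_cst|exact: bmeasurable_sum].
- by apply: bmeasurableM => //; exact: bmeasurable_cst.
- move=> t; rewrite -mulr_suml mulrA ler_wpM2r ?powR_ge0//; exact: vpmaj_grid.
Qed.

(** The dual of the sampling inequality, with the two masses exchanged: Jensen over the sample
    points costs W to the power q - 1, and the integration over t then produces [vpmass]. *)
Lemma vp_synthesis I J (H : T -> R[i]) q W : uniq I -> uniq J -> 1 <= q ->
  0 < W -> vpgrid I J <= W ->
  \int[P]_t (normc (E^-1%:C * \sum_(k <- r) H k * vpkernel I J (t - u k)) `^ q) <=
    W `^ (q - 1) * vpmass R I J * (E^-1 * \sum_(k <- r) normc (H k) `^ q).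
Proof.
move=> uI uJ q1 W0 gW; have q0 : 0 <= q by lra.
have bk := bperiodic_trigsum (vpsupp I J) (fun l => (vpcoef R I J l)%:C).
have bw k : bmeasurable (fun t => vpmaj I J (t - u k)).
  under eq_fun do rewrite vpmaj_sym; exact: bmeasurable_vpmaj.
apply: (@le_trans _ _ (\int[P]_t (W `^ (q - 1) *
    \sum_(k <- r) E^-1 * vpmaj I J (t - u k) * normc (H k) `^ q))).
  apply: le_mean.
  - apply: bmeasurable_powR => //; first by move=> x; exact: normc_ge0.
    have mF : cmeasurable (fun t => E^-1%:C * \sum_(k <- r) H k * vpkernel I J (t - u k)).
      apply: cmeasurableM; first exact: cmeasurable_cst.
      apply: cmeasurable_sum => k; apply: cmeasurableM; first exact: cmeasurable_cst.
      by apply: cmeasurable_shift; case: bk.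
    split; first exact: measurable_normc.
    case: bk => _ _ [B kB]; exists (E^-1 * \sum_(k <- r) normc (H k) * B) => t.
    rewrite ger0_norm ?normc_ge0// normcM normc_realC ger0_norm ?invr_ge0//.
    rewrite ler_wpM2l ?invr_ge0//; apply: le_trans (normc_sum _ _ _) _.
    by apply: ler_sum => k _; rewrite normcM ler_wpM2l ?normc_ge0//; exact: kB.
  - apply: bmeasurableM; first exact: bmeasurable_cst.
    apply: bmeasurable_sum => k; apply: bmeasurableM; last exact: bmeasurable_cst.
    by apply: bmeasurableM => //; exact: bmeasurable_cst.
  - move=> t; apply: le_trans (sum_jensen (w := fun k => E^-1 * vpmaj I J (t - u k))
        (u := fun k => normc (H k)) q1 W0 _ _ _).
    + rewrite ge0_ler_powR ?nnegrE ?normc_ge0//.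
        by apply: sumr_ge0 => k _; rewrite mulr_ge0 ?normc_ge0// mulr_ge0 ?vpmaj_ge0// invr_ge0.
      rewrite normcM normc_realC ger0_norm ?invr_ge0//.
      under [leRHS]eq_bigr do rewrite -mulrA.
      rewrite -mulr_sumr ler_wpM2l ?invr_ge0//; apply: le_trans (normc_sum _ _ _) _.
      apply: ler_sum => k _; rewrite normcM mulrC ler_wpM2r ?normc_ge0//.
      exact: normc_vpkernel.
    + by move=> k; rewrite mulr_ge0 ?invr_ge0 ?vpmaj_ge0.
    + by move=> k; exact: normc_ge0.
    + rewrite -mulr_sumr; apply: le_trans gW.
      under eq_bigr do rewrite vpmaj_sym.
      exact: vpmaj_grid.
rewrite meanZ; last first.
  apply: bmeasurable_sum => k; apply: bmeasurableM; last exact: bmeasurable_cst.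
  by apply: bmeasurableM => //; exact: bmeasurable_cst.
rewrite -mulrA ler_wpM2l ?powR_ge0//.
rewrite mean_sum => [|k]; last first.
  apply: bmeasurableM; last exact: bmeasurable_cst.
  by apply: bmeasurableM => //; exact: bmeasurable_cst.
rewrite mulrCA !mulr_sumr; apply: ler_sum => k _.
rewrite (@eq_Rintegral _ _ _ _ _
   (fun t => E^-1 * normc (H k) `^ q * vpmaj I J (u k - t))); last first.
  by move=> t _; rewrite vpmaj_sym mulrAC.
rewrite meanZ; last exact: bmeasurable_vpmaj.
rewrite mean_vpmaj// [leRHS](_ : _ = E^-1 * normc (H k) `^ q * vpmass R I J)//; ring.
Qed.

End sampling.

End vp_inequalities.

(** * The Hausdorff-Young inequality by dyadic interpolation *)

Section hausdorff_young.
Variables (R : realType) (d : nat).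
Local Notation P := (@torus_prob R d).
Implicit Types (s : seq 'cV[int]_d) (c : 'cV[int]_d -> R[i]).

(** If the last power is counted, the sum of all powers up to it is at most b / (b - 1) times that
    power; otherwise the sum is unchanged. *)
Lemma geometric_sum_le (b X : R) n : 1 < b -> 0 <= X ->
  \sum_(i < n | b ^+ i <= X) b ^+ i <= b / (b - 1) * X.
Proof.
move=> b1 X0; have C0 : 0 <= b / (b - 1) by rewrite divr_ge0//; lra.
elim: n => [|n IH]; first by rewrite big_ord0 mulr_ge0.
rewrite big_mkcond big_ord_recr/= -big_mkcond/=; case: ifP => [h|_]; last by rewrite addr0.
apply: (@le_trans _ _ (\sum_(i < n) b ^+ i + b ^+ n)).
  rewrite lerD2r big_mkcond; apply: ler_sum => i _.
  by case: ifP => // _; rewrite exprn_ge0//; lra.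
have -> : \sum_(i < n) b ^+ i + b ^+ n = (b ^+ n.+1 - 1) / (b - 1).
  by rewrite subrX1 big_ord_recr/= mulrAC mulfV ?mul1r// subr_eq0 gt_eqF.
rewrite mulrAC ler_wpM2r ?invr_ge0//; first lra.
rewrite exprS; have : b * b ^+ n <= b * X by rewrite ler_pM2l//; lra.
lra.
Qed.

Lemma dyadic_level (v : R) : 1 <= v -> exists i : nat, 2 ^+ i <= v < 2 ^+ i.+1.
Proof.
move=> v1.
have ex : exists n : nat, v < 2 ^+ n.+1.
  exists (Num.bound v); apply: lt_le_trans (archi_boundP (le_trans ler01 v1)) _.
  rewrite -natrX ler_nat; apply: ltnW; apply: ltn_trans (ltnSn _) _.
  by rewrite ltn_expl.
case: (ex_minnP ex) => i vi mi; exists i; rewrite vi andbT.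
case: i vi mi => [|i] vi mi; first by rewrite expr0.
by rewrite leNgt; apply/negP => /mi; rewrite ltnn.
Qed.

Lemma powR_exprAC (a y : R) i : 0 <= a -> (a ^+ i) `^ y = (a `^ y) ^+ i.
Proof.
move=> a0; elim: i => [|i IH]; first by rewrite !expr0 powR1.
by rewrite !exprS powRM ?exprn_ge0// IH.
Qed.

Variables (p q : R).
Hypotheses (p_gt2 : 2 < p) (pq : p^-1 + q^-1 = 1) (q_gt1 : 1 < q).

Let q_def : (p - 1) * (q - 1) = 1.
Proof.
have p2 := p_gt2; have q1 := q_gt1.
have p0 : p != 0 by rewrite gt_eqF//; lra.
have q0 : q != 0 by rewrite gt_eqF//; lra.
have : p * q * (p^-1 + q^-1) = p * q by rewrite pq mulr1.
have -> : p * q * (p^-1 + q^-1) = q + p by field; rewrite p0 q0.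
by move=> h; rewrite mulrBl mulrBr -h; ring.
Qed.

(** Where the polynomial has size about 2^i, its p-th power is about b^i times its square: [b ^ i]
    is the weight of the L_2 estimate at that level. The cut-off on the coefficients decreases like
    [tau ^ (- i)]. *)
Let b : R := 2 `^ (p - 2).
Let tau : R := 2 `^ (p - 1).

Let powR2_gt1 (x : R) : 0 < x -> 1 < 2 `^ x.
Proof.
move=> x0; have e : 1 `^ x = 1 :> R by rewrite powR1.
by rewrite -e gt0_ltr_powR ?nnegrE//; lra.
Qed.

Let b1 : 1 < b.
Proof. by have p2 := p_gt2; apply: powR2_gt1; lra. Qed.

Let tau1 : 1 < tau.
Proof. by have p2 := p_gt2; apply: powR2_gt1; lra. Qed.

Definition hausdorff_young_cst : R := 2 `^ (p + 2) * (b / (b - 1) * b).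

(* The dyadic levels at which a coefficient of modulus a counts as small. *)
Let coef_weight (a : R) n : 0 <= a ->
  a ^+ 2 * \sum_(i < n | a * tau ^+ i <= tau) b ^+ i <= b / (b - 1) * b * a `^ q.
Proof.
have p2 := p_gt2; have q1 := q_gt1; have b2 := b1; have t1 := tau1.
have q0 : q != 0 by rewrite gt_eqF//; lra.
rewrite le_eqVlt => /predU1P[<-|a0].
  by rewrite expr0n/= mul0r powR0// mulr0.
(* Hence [tau ^ (2 - q) = b]: raised to the power 2 - q, the cut-off on a becomes
   [b ^ i <= b * a ^ (q - 2)], a bound on the terms of a geometric sum. *)
have e2q : (p - 1) * (2 - q) = p - 2.
  have -> : 2 - q = 1 - (q - 1) by ring.
  by rewrite mulrBr q_def; ring.
have q2 : 0 <= 2 - q.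
  have : 0 < (p - 1) * (2 - q) by rewrite e2q; lra.
  by rewrite pmulr_rgt0; lra.
have tauE i : (tau ^+ i) `^ (2 - q) = b ^+ i.
  by rewrite powR_exprAC ?powR_ge0// /tau -powRrM e2q.
have X0 : 0 <= b * a `^ (q - 2) by rewrite mulr_ge0 ?powR_ge0//; lra.
have sum_le : \sum_(i < n | a * tau ^+ i <= tau) b ^+ i <= b / (b - 1) * (b * a `^ (q - 2)).
  apply: le_trans (geometric_sum_le n b1 X0).
  rewrite [leLHS]big_mkcond [leRHS]big_mkcond; apply: ler_sum => i _.
  have bi0 : 0 <= b ^+ i by rewrite exprn_ge0//; lra.
  case: ifP => h; last by case: ifP.
  suff -> : b ^+ i <= b * a `^ (q - 2) by [].
  have ti0 : 0 <= tau ^+ i by rewrite exprn_ge0//; lra.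
  have : (a * tau ^+ i) `^ (2 - q) <= tau `^ (2 - q).
    by rewrite ge0_ler_powR ?nnegrE ?powR_ge0 ?mulr_ge0// ltW.
  rewrite powRM ?(ltW a0)// tauE -[tau in leRHS]expr1 tauE expr1 => h2.
  rewrite -opprB powRN mulrC ler_pdivlMl ?powR_gt0//.
have -> : a `^ q = a ^+ 2 * a `^ (q - 2).
  rewrite -powR_mulrn ?ltW// -powRD ?(gt_eqF a0) ?implybT//.
  by apply: (congr1 (powR a)); ring.
rewrite [leRHS](_ : _ = a ^+ 2 * (b / (b - 1) * (b * a `^ (q - 2)))); last by ring.
by rewrite ler_wpM2l// sqr_ge0.
Qed.

Let small_part s c i : 'cV[R]_d -> R[i] :=
  trigsum s (fun k => if normc (c k) * tau ^+ i <= tau then c k else 0).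

(* Marcinkiewicz interpolation between l^1 -> L^oo and l^2 -> L^2: at height
   2^i the coefficients above tau / tau ^ i contribute at most half. *)
Let large_part_le s c i x : \sum_(k <- s) normc (c k) `^ q <= 1 ->
  normc (trigsum s c x - small_part s c i x) <= 2 ^+ i / 2.
Proof.
move=> c1; have p2 := p_gt2; have q1 := q_gt1; have t1 := tau1.
have t0 : 0 < tau by lra.
rewrite /trigsum /small_part /trigsum -sumrB.
apply: le_trans (normc_sum _ _ _) _.
apply: (@le_trans _ _ (\sum_(k <- s) (2 ^+ i / 2 * normc (c k) `^ q))); last first.
  by rewrite -mulr_sumr ler_piMr// divr_ge0// exprn_ge0.
apply: ler_sum => k _; rewrite -mulrBl normcM normc_character mulr1.
case: ifPn => [_|]; first by rewrite subrr normc0 mulr_ge0 ?powR_ge0// divr_ge0 ?exprn_ge0.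
rewrite -ltNge subr0 => h; set a := normc (c k) in h *.
have a0 : 0 < a.
  by rewrite lt0r normc_ge0 andbT; apply: contraTneq h => ->; rewrite mul0r -leNgt ltW.
have ti0 : 0 < tau ^+ i by rewrite exprn_gt0.
have : tau `^ (q - 1) <= (a * tau ^+ i) `^ (q - 1).
  by rewrite ge0_ler_powR ?nnegrE ?mulr_ge0 ?(ltW a0) ?(ltW ti0) ?(ltW t0) ?(ltW h)//; lra.
have -> : tau `^ (q - 1) = 2 by rewrite /tau -powRrM q_def powRr1.
rewrite powRM ?(ltW a0) ?(ltW ti0)//.
have -> : (tau ^+ i) `^ (q - 1) = 2 ^+ i.
  by rewrite powR_exprAC ?ltW// /tau -powRrM q_def powRr1.
move=> h2; have -> : a `^ q = a * a `^ (q - 1) by rewrite mulr_powRB1 ?ltW//; lra.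
have : a * 2 <= a * (a `^ (q - 1) * 2 ^+ i) by rewrite ler_pM2l.
lra.
Qed.

(** At level 0 the cut-off is tau > 1, while normalised coefficients are at most 1, so nothing is
    removed. *)
Let small_part0 s c x : \sum_(k <- s) normc (c k) `^ q <= 1 ->
  small_part s c 0 x = trigsum s c x.
Proof.
move=> c1; have p2 := p_gt2; have q1 := q_gt1; have t1 := tau1.
rewrite /small_part; congr (_ x); apply: eq_trigsum => k ks.
rewrite expr0 mulr1 ifT//; apply: le_trans (ltW t1).
have : normc (c k) `^ q <= 1.
  apply: le_trans c1; rewrite (big_rem k)//= lerDl.
  by apply: sumr_ge0 => l _; exact: powR_ge0.
move=> h; rewrite leNgt; apply/negP => h2.
have : 1 `^ q < normc (c k) `^ q by rewrite gt0_ltr_powR ?nnegrE ?normc_ge0//; lra.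
by rewrite powR1 ltNge h.
Qed.

(** A single term suffices, the one whose level i satisfies 2^i <= v < 2^(i+1): the small part there
    is at least 2^i / 2. The factor 2^p comes from the upper bound on v, the factor 4 from the
    halving. The choice of n ensures that this level occurs in the sum. *)
Let pointwise_le s c n x : \sum_(k <- s) normc (c k) `^ q <= 1 ->
  \sum_(k <- s) normc (c k) < 2 ^+ n ->
  normc (trigsum s c x) `^ p <=
    2 `^ (p + 2) * \sum_(i < n.+1) b ^+ i * normc (small_part s c i x) ^+ 2.
Proof.
move=> c1 cn; have p2 := p_gt2; have q1 := q_gt1; have b2 := b1.
set v := normc (trigsum s c x).
have v0 : 0 <= v := normc_ge0 _.
have term_ge0 (i : 'I_n.+1) : 0 <= b ^+ i * normc (small_part s c i x) ^+ 2.
  by rewrite mulr_ge0 ?sqr_ge0// exprn_ge0//; lra.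
have one_term (i : 'I_n.+1) (h : v `^ p <= 2 `^ (p + 2) * (b ^+ i * normc (small_part s c i x) ^+ 2)) :
  v `^ p <= 2 `^ (p + 2) * \sum_(i < n.+1) b ^+ i * normc (small_part s c i x) ^+ 2.
  apply: le_trans h _; rewrite ler_pM2l ?powR_gt0// (bigD1 i)//= lerDl.
  exact: sumr_ge0.
(* Below 1 the inequality [v ^ p <= v ^ 2] and level 0, at which nothing is removed, are enough. *)
have [v1|v1] := ltP v 1.
  apply: (one_term ord0); rewrite /= expr0 mul1r small_part0// -/v.
  have : v `^ p <= v ^+ 2.
    have [->|vn0] := eqVneq v 0; first by rewrite powR0 ?expr0n//= gt_eqF//; lra.
    by rewrite -powR_mulrn// ger_powR ?lt0r ?vn0 ?v0 ?ltW//; lra.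
  move=> /le_trans; apply; rewrite ler_peMl ?sqr_ge0//.
  by rewrite ltW// powR2_gt1//; lra.
have [i /andP[iv vi]] := dyadic_level v1.
have in1 : (i < n.+1)%N.
  rewrite ltnS leqNgt; apply/negP => ni.
  have : 2 ^+ i <= v := iv.
  rewrite leNgt => /negP; apply; apply: le_lt_trans (normc_trigsum _ _ _) _.
  by apply: lt_le_trans cn _; rewrite ler_eXn2l ?ltr1n// ltnW.
apply: (one_term (Ordinal in1)) => /=.
set S := normc (small_part s c i x).
have Sge : 2 ^+ i / 2 <= S.
  have := le_normcD (trigsum s c x - small_part s c i x) (small_part s c i x).
  rewrite subrK -/v -/S; have := large_part_le i x c1; lra.
have vp : v `^ p <= (2 ^+ i.+1) `^ p.
  rewrite ge0_ler_powR ?nnegrE ?exprn_ge0 ?(ltW vi)//; lra.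
apply: le_trans vp _.
have S2 : (2 ^+ i / 2) ^+ 2 <= S ^+ 2.
  by rewrite lerXn2r ?nnegrE ?divr_ge0 ?exprn_ge0 ?normc_ge0.
have bi0 : 0 < b ^+ i by rewrite exprn_gt0//; lra.
apply: (@le_trans _ _ (2 `^ (p + 2) * (b ^+ i * (2 ^+ i / 2) ^+ 2))); last first.
  by rewrite ler_pM2l ?powR_gt0// ler_pM2l.
rewrite le_eqVlt; apply/orP; left; apply/eqP.
have b4 : b * 4 = 2 `^ p.
  have -> : 4 = 2 `^ 2 :> R by rewrite powR_mulrn//; ring.
  by rewrite /b -powRD ?pnatr_eq0 ?implybT// subrK.
have -> : 2 `^ (p + 2) = 2 `^ p * 4.
  rewrite powRD ?pnatr_eq0 ?implybT//; congr (_ * _).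
  by rewrite powR_mulrn//; ring.
rewrite powR_exprAC// exprS -b4 exprMn expr_div_n exprAC.
have -> : 2 ^+ 2 = 4 :> R by ring.
by field.
Qed.

Lemma hausdorff_young_normalized s c : uniq s ->
  \sum_(k <- s) normc (c k) `^ q <= 1 ->
  \int[P]_x (normc (trigsum s c x) `^ p) <=
    hausdorff_young_cst * \sum_(k <- s) normc (c k) `^ q.
Proof.
move=> us c1; have p2 := p_gt2; have q1 := q_gt1; have b2 := b1.
have [n cn] : exists n : nat, \sum_(k <- s) normc (c k) < 2 ^+ n.
  exists (Num.bound (\sum_(k <- s) normc (c k))).
  apply: lt_le_trans (archi_boundP _) _.
    by apply: sumr_ge0 => k _; exact: normc_ge0.
  by rewrite -natrX ler_nat; apply: ltnW; rewrite ltn_expl.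
have bsq i : bmeasurable (fun x => normc (small_part s c i x) ^+ 2).
  under eq_fun do rewrite expr2.
  by apply: bmeasurableM; apply: bmeasurable_normc; exact: bperiodic_trigsum.
have bt (i : nat) : bmeasurable (fun x => b ^+ i * normc (small_part s c i x) ^+ 2).
  by apply: bmeasurableM => //; exact: bmeasurable_cst.
apply: (@le_trans _ _ (\int[P]_x (2 `^ (p + 2) *
    \sum_(i < n.+1) b ^+ i * normc (small_part s c i x) ^+ 2))).
  apply: le_mean.
  - by apply: bmeasurable_normc_powR; [lra|exact: bperiodic_trigsum].
  - by apply: bmeasurableM; [exact: bmeasurable_cst|exact: bmeasurable_sum].
  - by move=> x; exact: pointwise_le.
rewrite meanZ; last exact: bmeasurable_sum.
rewrite mean_sum// /hausdorff_young_cst -mulrA ler_pM2l ?powR_gt0//.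
rewrite (eq_bigr (fun i : 'I_n.+1 => \sum_(k <- s)
    (if normc (c k) * tau ^+ i <= tau then normc (c k) ^+ 2 * b ^+ i else 0))); last first.
  move=> i _; rewrite meanZ// [X in _ * X]/Rintegral parseval//= mulr_sumr.
  apply: eq_bigr => k _; case: ifP => _; first by rewrite mulrC.
  by rewrite normc0 expr0n mulr0.
(* After the exchange each coefficient carries the geometric sum over the levels at which it is
   small. *)
rewrite exchange_big/= mulr_sumr; apply: ler_sum => k _.
apply: le_trans (coef_weight n.+1 (normc_ge0 (c k))).
by rewrite mulr_sumr -big_mkcond.
Qed.

Lemma hausdorff_young_cst_ge0 : 0 <= hausdorff_young_cst.
Proof.
have b2 := b1.
by rewrite /hausdorff_young_cst mulr_ge0 ?powR_ge0// mulr_ge0 ?divr_ge0//; lra.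
Qed.

Lemma hausdorff_young_finite s c : uniq s ->
  (Lpnorm p%:E (trigsum s c) <=
    (hausdorff_young_cst `^ p^-1 * (\sum_(k <- s) normc (c k) `^ q) `^ q^-1)%:E)%E.
Proof.
move=> us; have p2 := p_gt2; have q1 := q_gt1.
have p0 : 0 < p by lra.
have q0 : 0 < q by lra.
set Q := \sum_(k <- s) _.
have Q0 : 0 <= Q by apply: sumr_ge0 => k _; exact: powR_ge0.
have bt s' c' : Lqint p (@trigsum R d s' c') = (\int[P]_x (normc (trigsum s' c' x) `^ p))%:E.
  by apply: LqintE; [exact: ltW|exact: bperiodic_trigsum].
rewrite Lpnorm_fin bt poweR_EFin lee_fin.
pose a := Q `^ q^-1.
have [Qz|Qn0] := eqVneq Q 0.
  have c0 k : k \in s -> c k = 0.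
    move=> ks; apply: eq0_normc; apply: (@powR_eq0_eq0 _ _ q).
    apply/eqP; rewrite eq_le powR_ge0 andbT -Qz /Q (big_rem k)//= lerDl.
    by apply: sumr_ge0 => l _; exact: powR_ge0.
  rewrite (_ : trigsum s c = fun=> 0); last first.
    by apply/funext => x; rewrite /trigsum big_seq big1// => k ks; rewrite c0// mul0r.
  by rewrite normc0 powR0 ?gt_eqF// mean_cst powR0 ?invr_neq0 ?gt_eqF// mulr_ge0 ?powR_ge0.
have Qp : 0 < Q by rewrite lt0r Qn0.
have ap : 0 < a by rewrite powR_gt0.
pose c' k := (a^-1)%:C * c k.
have nc' k : normc (c' k) = a^-1 * normc (c k).
  by rewrite normcM normc_realC ger0_norm ?invr_ge0// ltW.
have Q1 : \sum_(k <- s) normc (c' k) `^ q = 1.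
  under eq_bigr do rewrite nc' powRM ?invr_ge0 ?normc_ge0 ?(ltW ap)//.
  have aq : a `^ q = Q by rewrite /a -powRrM mulVf ?gt_eqF// powRr1.
  rewrite -mulr_sumr -/Q -[X in _ * X]aq -powRM ?invr_ge0 ?(ltW ap)//.
  by rewrite mulVf ?gt_eqF// powR1.
have E x : normc (trigsum s c x) `^ p = a `^ p * normc (trigsum s c' x) `^ p.
  rewrite -powRM ?normc_ge0 ?(ltW ap)//; apply: (congr1 (fun z => z `^ p)).
  rewrite -[a in RHS](ger0_norm (ltW ap)) -[in RHS]normc_realC -normcM; congr normc.
  rewrite /trigsum mulr_sumr; apply: eq_bigr => k _.
  by rewrite mulrA; congr (_ * _); rewrite /c' mulrA -rmorphM /= mulfV ?gt_eqF// mul1r.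
under eq_Rintegral do rewrite E.
rewrite meanZ; last by apply: bmeasurable_normc_powR; [exact: ltW|exact: bperiodic_trigsum].
have Qle1 : \sum_(k <- s) normc (c' k) `^ q <= 1 by rewrite Q1.
have := hausdorff_young_normalized us Qle1.
rewrite Q1 mulr1 => h.
rewrite powRM ?powR_ge0//; last by apply: mean_ge0 => x; rewrite powR_ge0.
rewrite -powRrM mulfV ?gt_eqF// powRr1 ?(ltW ap)// mulrC ler_wpM2r ?(ltW ap)//.
rewrite ge0_ler_powR ?nnegrE ?invr_ge0 ?hausdorff_young_cst_ge0 ?(ltW p0)//.
by apply: mean_ge0 => x; rewrite powR_ge0.
Qed.

End hausdorff_young.

(** * Fourier multipliers and reflection *)

Section multipliers.
Variables (R : realType) (d : nat).
Local Notation P := (@torus_prob R d).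
Implicit Types (s : seq 'cV[int]_d) (c : 'cV[int]_d -> R[i]).
Implicit Types (f g F : 'cV[R]_d -> R[i]) (p : \bar R) (q : R).

(** The interpolation constant blows up as p tends to 2, so p = 2 is settled by Parseval's identity;
    for p = oo the sum of the moduli is a bound. *)
Lemma hausdorff_young p q : conjugate_exponents p q -> (2%:E <= p)%E ->
  exists2 C : R, 0 <= C & forall s c, uniq s ->
    (Lpnorm p (trigsum s c) <=
      (C * (\sum_(k <- s) normc (c k) `^ q) `^ q^-1)%:E)%E.
Proof.
move=> [[-> ->] _|[r [-> r1 q1 rq]]].
  exists 1 => // s c us; rewrite mul1r invr1 powRr1; last first.
    by apply: sumr_ge0 => k _; exact: powR_ge0.
  apply: Lpnorm_bounded => //; first exact: cmeasurable_trigsum.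
  move=> x; apply: le_trans (normc_trigsum _ _ _) _.
  by under [leRHS]eq_bigr do rewrite powRr1 ?normc_ge0//.
rewrite lee_fin le_eqVlt => /predU1P[r2|r2].
  have q2 : q = 2.
    have : q^-1 = 2^-1 by move: rq; rewrite -r2; lra.
    by move=> /invr_inj.
  exists 1 => // s c us; rewrite mul1r -r2 q2 Lpnorm_fin /Lqint.
  under eq_integral do rewrite powR_mulrn ?normc_ge0//.
  by rewrite parseval// poweR_EFin; under [in leRHS]eq_bigr do rewrite powR_mulrn ?normc_ge0//.
exists (hausdorff_young_cst r `^ r^-1); first exact: powR_ge0.
by move=> s c us; exact: hausdorff_young_finite.
Qed.

(** This reflection preserves norms and conjugates Fourier coefficients; through it conjugated
    symbols inherit the bounds of the symbols themselves. *)
Definition creflect f : 'cV[R]_d -> R[i] := fun x => (f (- x))^*.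

Lemma bperiodic_creflect f : bperiodic f -> bperiodic (creflect f).
Proof.
move=> [mf pf [B fB]]; split.
- by apply: cmeasurable_conj; exact: cmeasurable_opp.
- by move=> x k; rewrite /creflect opprD -toRN pf.
- by exists B => x; rewrite normc_conj.
Qed.

Lemma Lqint_creflect q f : cmeasurable f -> Lqint q (creflect f) = Lqint q f.
Proof.
move=> mf; rewrite /Lqint /creflect; under eq_integral do rewrite normc_conj.
rewrite (torus_integral_opp (H := fun x => (normc (f x) `^ q)%:E))//.
  exact: measurable_powR_normcE.
by move=> x; rewrite lee_fin powR_ge0.
Qed.

Lemma Lpnorm_creflect_fin q f : cmeasurable f ->
  Lpnorm q%:E (creflect f) = Lpnorm q%:E f.
Proof. by move=> mf; rewrite !Lpnorm_fin Lqint_creflect. Qed.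

Lemma fourier_creflect f k : bperiodic f -> fourier (creflect f) k = (fourier f k)^*.
Proof.
move=> bf; rewrite /fourier -cint_conj; last first.
  by apply: cintegrableM_character; exact: bperiodic_cintegrable.
rewrite -[RHS]cint_opp; last first.
  apply: cmeasurable_conj; apply: cmeasurableM; first by case: bf.
  exact: cmeasurable_character.
congr cint; apply/funext => x.
by rewrite conjCM /creflect characterNr characterNl !conjCK.
Qed.

Lemma creflect_trigsum s c : creflect (trigsum s c) = trigsum s (fun k => (c k)^*).
Proof.
apply/funext => x; rewrite /creflect /trigsum conjC_sum; apply: eq_bigr => k _.
by rewrite conjCM characterNr conjCK.
Qed.

Lemma pairing_creflect f g : bperiodic f -> bperiodic g ->
  pairing (creflect f) g = (pairing f (creflect g))^*.
Proof.
move=> bf bg; rewrite /pairing -cint_conj; last first.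
  have [mg _ [B gB]] := bperiodic_creflect bg.
  apply: cintegrableM_bperiodic => //; first exact: cmeasurable_conj.
  by exists B => x; rewrite normc_conj.
rewrite -[RHS]cint_opp; last first.
  apply: cmeasurable_conj; apply: cmeasurableM; first by case: bf.
  by apply: cmeasurable_conj; case: (bperiodic_creflect bg).
congr cint; apply/funext => x.
by rewrite conjCM /creflect opprK !conjCK.
Qed.

(** The reflection is moved to the test function, whose exponent q is finite; this treats p = oo
    together with the other exponents. *)
Lemma Lpnorm_creflect_le p q f : conjugate_exponents p q -> bperiodic f ->
  (Lpnorm p (creflect f) <= Lpnorm p f)%E.
Proof.
move=> pq bf.
have p0 : (0 < p)%E by rewrite (lt_le_trans lte01 (conj_p_ge1 pq)).
have q0 : (0 < q%:E)%E by rewrite lte_fin (lt_le_trans ltr01 (conj_q_ge1 pq)).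
have ff : Lpnorm p f \is a fin_num by rewrite ge0_fin_numE ?Lpnorm_ge0// bperiodic_Lpnorm.
rewrite -(fineK ff); apply: (Lpnorm_duality pq); first exact: bperiodic_creflect.
  by rewrite fine_ge0 ?Lpnorm_ge0.
move=> g bg; rewrite fineK// pairing_creflect// normc_conj.
rewrite -(Lpnorm_creflect_fin q (f := g)); last by case: bg.
apply: (normc_pairing pq); first by case: bf.
- by case: (bperiodic_creflect bg).
- exact: bperiodic_Lpnorm.
- by apply: bperiodic_Lpnorm => //; exact: bperiodic_creflect.
Qed.

Lemma LpnormZ q (a : R) f : 0 < q -> 0 <= a -> bperiodic f ->
  Lpnorm q%:E (fun x => a%:C * f x) = (a%:E * Lpnorm q%:E f)%E.
Proof.
move=> q0 a0 bf; have [mf pf [B fB]] := bf.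
have baf : bperiodic (fun x => a%:C * f x).
  split.
  - by apply: cmeasurableM => //; exact: cmeasurable_cst.
  - by move=> x k; rewrite pf.
  - exists (a * B) => x; rewrite normcM normc_realC ger0_norm// ler_wpM2l//.
rewrite !Lpnorm_fin !LqintE ?(ltW q0)//.
under eq_Rintegral do rewrite normcM normc_realC (ger0_norm a0) powRM ?normc_ge0//.
rewrite meanZ; last by apply: bmeasurable_normc_powR => //; exact: ltW.
rewrite !poweR_EFin -EFinM powRM ?powR_ge0//; last by apply: mean_ge0 => x; exact: powR_ge0.
by rewrite -powRrM mulfV ?gt_eqF// powRr1.
Qed.

Section multiplier_norm.
Variables (p : \bar R) (q : R) (phi : 'cV[R]_d -> R[i]) (s : seq 'cV[int]_d).
Hypotheses (pq : conjugate_exponents p q) (us : uniq s).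
Hypothesis phi0 : forall k, k \notin s -> fourier phi k = 0.
Local Notation K := (multnorm q phi).

Let q_gt0 : 0 < q.
Proof. by rewrite (lt_le_trans ltr01 (conj_q_ge1 pq)). Qed.

Definition multiplier g : 'cV[R]_d -> R[i] :=
  trigsum s (fun k => fourier phi k * fourier g k).

Lemma multiplierE g :
  (fun x => \sum_(k \in [set: 'cV[int]_d]) fourier phi k * fourier g k * character k x)
  = multiplier g.
Proof.
apply/funext => x; rewrite (fsum_seq us)//.
by move=> k ks; rewrite phi0// !mul0r.
Qed.

Lemma fourier_le_Lpnorm g k : cmeasurable g -> (Lpnorm q%:E g < +oo)%E ->
  ((normc (fourier g k))%:E <= Lpnorm q%:E g)%E.
Proof.
move=> mg gq; apply: le_trans (integral_le_Lqnorm pq mg).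
by apply: normc_fourier; exact: (Lq_cintegrable pq).
Qed.

Lemma multnorm_lty : (K < +oo)%E.
Proof.
apply: (@le_lt_trans _ _ (\sum_(k <- s) normc (fourier phi k))%:E); last exact: ltry.
apply: ge_ereal_sup => _ [g [[mg pg gq] g1] <-]; rewrite multiplierE.
apply: Lpnorm_bounded; [by rewrite lte_fin|exact: cmeasurable_trigsum|move=> x].
apply: le_trans (normc_trigsum _ _ _) _; apply: ler_sum => k _.
rewrite normcM ler_piMr ?normc_ge0// -lee_fin.
exact: le_trans (fourier_le_Lpnorm k mg gq) g1.
Qed.

(** The multiplier is tested on the constant 1, whose only frequency is 0. *)
Lemma multnorm_ge_fourier0 : ((normc (fourier phi 0))%:E <= K)%E.
Proof.
have one : (fun _ : 'cV[R]_d => (1 : R[i])) = trigsum [:: 0] (fun=> 1).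
  by apply/funext => x; rewrite /trigsum big_seq1 character0 mulr1.
have -> : (normc (fourier phi 0))%:E = Lpnorm q%:E (multiplier (fun=> 1)).
  have -> : multiplier (fun=> 1) = fun=> fourier phi 0.
    apply/funext => x; rewrite /multiplier one /trigsum.
    have E k : fourier (trigsum [:: 0] (fun=> 1)) k = (k == 0)%:R :> R[i].
      by rewrite fourier_trigsum// inE; case: eqP.
    under eq_bigr do rewrite E.
    transitivity (\sum_(k <- s) (if k == 0 then fourier phi k else 0)).
      by apply: eq_bigr => k _; case: eqP => [->|]; rewrite ?mulr0 ?mul0r// mulr1 character0 mulr1.
    rewrite sum_uniq_eq//; case: ifPn => // h; by rewrite phi0.
  rewrite Lpnorm_fin /Lqint integral_cst//= probability_setT mule1 poweR_EFin.
  by rewrite -powRrM mulfV ?gt_eqF// powRr1// normc_ge0.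
apply: ereal_sup_ubound; exists (fun=> 1); last by rewrite multiplierE.
split; last by rewrite Lpnorm_cst1// lte_fin.
by split; [exact: cmeasurable_cst|by []|rewrite Lpnorm_cst1 ?lte_fin// ltry].
Qed.

Lemma multnorm_ge0 : (0 <= K)%E.
Proof. by apply: le_trans multnorm_ge_fourier0; rewrite lee_fin normc_ge0. Qed.

Lemma multiplier_le g : bperiodic g ->
  (Lpnorm q%:E (multiplier g) <= K * Lpnorm q%:E g)%E.
Proof.
move=> bg; have [mg pg bdg] := bg.
have gq : (Lpnorm q%:E g < +oo)%E by apply: bperiodic_Lpnorm => //; rewrite lte_fin.
have gf : Lpnorm q%:E g \is a fin_num by rewrite ge0_fin_numE ?Lpnorm_ge0.
set a := fine (Lpnorm q%:E g).
have a0 : 0 <= a by rewrite fine_ge0 ?Lpnorm_ge0.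
(* A test function of norm 0 cannot be normalised, but all its Fourier coefficients vanish. *)
have [az|an0] := eqVneq a 0.
  have -> : multiplier g = fun=> 0.
    apply/funext => x; rewrite /multiplier /trigsum big1// => k _.
    have : ((normc (fourier g k))%:E <= Lpnorm q%:E g)%E by exact: fourier_le_Lpnorm.
    rewrite -(fineK gf) -/a az lee_fin => h.
    by rewrite (@eq0_normc _ (fourier g k)) ?mulr0 ?mul0r//; apply/eqP; rewrite eq_le h normc_ge0.
  rewrite Lpnorm_fin /Lqint normc0 powR0 ?gt_eqF// integral0 poweR_EFin powR0 ?invr_neq0 ?gt_eqF//.
  by rewrite mule_ge0 ?multnorm_ge0 ?Lpnorm_ge0.
have ap : 0 < a by rewrite lt0r an0.
have an : 0 <= a^-1 by rewrite invr_ge0.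
pose g' x := (a^-1)%:C * g x.
have g'1 : Lpnorm q%:E g' = 1%E.
  by rewrite LpnormZ// -(fineK gf) -/a -EFinM mulVf.
have E : multiplier g' = fun x => (a^-1)%:C * multiplier g x.
  apply/funext => x; rewrite /multiplier /trigsum mulr_sumr; apply: eq_bigr => k _.
  by rewrite fourierZ; [ring|exact: bperiodic_cintegrable].
have : (Lpnorm q%:E (multiplier g') <= K)%E.
  apply: ereal_sup_ubound; exists g'; last by rewrite multiplierE.
  split; last by rewrite g'1.
  split; last by rewrite g'1 ltry.
    by apply: cmeasurableM => //; exact: cmeasurable_cst.
  by move=> x k; rewrite /g' pg.
rewrite E LpnormZ//; last exact: bperiodic_trigsum.
have -> : Lpnorm q%:E g = a%:E by rewrite fineK.
by rewrite muleC lee_pdivrMr// .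
Qed.

(** The conjugated symbol appears when phi is moved to the test function. *)
Definition multiplierc g : 'cV[R]_d -> R[i] :=
  trigsum s (fun k => (fourier phi k)^* * fourier g k).

Lemma multiplierc_le g : bperiodic g ->
  (Lpnorm q%:E (multiplierc g) <= K * Lpnorm q%:E g)%E.
Proof.
move=> bg; have -> : multiplierc g = creflect (multiplier (creflect g)).
  rewrite creflect_trigsum; apply: eq_trigsum => k _.
  by rewrite fourier_creflect// conjCM conjCK.
rewrite Lpnorm_creflect_fin; last exact: cmeasurable_trigsum.
apply: le_trans (multiplier_le (bperiodic_creflect bg)) _.
by rewrite Lpnorm_creflect_fin//; case: bg.
Qed.

End multiplier_norm.
End multipliers.

(** * Grid points and residue classes *)

Section grid.
Variables (R : realType) (d : nat) (n : 'I_d -> int).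
Hypothesis n_neq0 : forall i, n i != 0.
Implicit Types (k l v : 'cV[int]_d) (x t : 'cV[R]_d).

Let nR_neq0 i : (n i)%:~R != 0 :> R. Proof. by rewrite intr_eq0. Qed.

Definition gridpt k : 'cV[R]_d := \col_i ((k i ord0)%:~R / (n i)%:~R).

Definition ingrid k : bool :=
  [forall i, (- 2^-1 <= (gridpt k) i ord0) && ((gridpt k) i ord0 < 2^-1)].

(** The representative of k modulo the numbers [n i] whose grid point lies in [-1/2, 1/2)^d.
    Rounding k / n to a nearest integer works for either sign of [n i]. *)
Definition gridrep k : 'cV[int]_d :=
  \col_i (k i ord0 - n i * Num.floor ((k i ord0)%:~R / (n i)%:~R + 2^-1 : R)).

Lemma ingridP k : reflect (forall i, - 2^-1 <= (gridpt k) i ord0 < 2^-1) (ingrid k).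
Proof. exact: forallP. Qed.

Definition gridmul v : 'cV[int]_d := \col_i (n i * v i ord0).

Lemma gridpt_mul v : gridpt (gridmul v) = toR v.
Proof. by apply/colP => i; rewrite !mxE intrM mulrAC mulfV ?mul1r. Qed.

Lemma gridptD k l : gridpt (k + l) = gridpt k + gridpt l.
Proof. by apply/colP => i; rewrite !mxE intrD mulrDl. Qed.

Lemma gridptN k : gridpt (- k) = - gridpt k.
Proof. by apply/colP => i; rewrite !mxE intrN mulNr. Qed.

Lemma gridrepE k : exists v, gridrep k = k + gridmul v.
Proof.
exists (\col_i - Num.floor ((k i ord0)%:~R / (n i)%:~R + 2^-1 : R)).
by apply/colP => i; rewrite !mxE mulrN.
Qed.

Lemma ingrid_gridrep k : ingrid (gridrep k).
Proof.
apply/ingridP => i; rewrite !mxE intrB intrM mulrBl mulrAC mulfV// mul1r.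
by have := floor_itv ((k i ord0)%:~R / (n i)%:~R + 2^-1 : R); rewrite intrD; lra.
Qed.

Lemma ingrid_uniq k v : ingrid k -> ingrid (k + gridmul v) -> v = 0.
Proof.
move=> /ingridP hk /ingridP hkv; apply/colP => i; rewrite mxE.
have := hkv i; rewrite gridptD gridpt_mul !mxE; set z := v i ord0.
have := hk i; rewrite !mxE; set a := _ / _ => h1 h2.
have z1 : -1 < (z%:~R : R) by lra.
have z2 : (z%:~R : R) < 1 by lra.
have : (-1 < z)%R by rewrite -(ltr_int R) mulrN1z.
have : (z < 1)%R by rewrite -(ltr_int R).
by clear; lia.
Qed.

Lemma gridrep_id k : ingrid k -> gridrep k = k.
Proof.
move=> hk; have := ingrid_gridrep k; have [v ->] := gridrepE k => h.
rewrite (ingrid_uniq hk h); apply/colP => i; rewrite !mxE mulr0 addr0//.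
Qed.

Lemma gridrep_eq k v : gridrep (k + gridmul v) = gridrep k.
Proof.
have [w e] := gridrepE k; have [w' e'] := gridrepE (k + gridmul v).
have gD a b : gridmul (a + b) = gridmul a + gridmul b.
  by apply/colP => i; rewrite !mxE mulrDr.
have gN a : gridmul (- a) = - gridmul a.
  by apply/colP => i; rewrite !mxE mulrN.
have h := ingrid_gridrep k; have h' := ingrid_gridrep (k + gridmul v).
have E : gridrep (k + gridmul v) = gridrep k + gridmul (v + w' - w).
  by rewrite e e' !gD gN; apply/colP => i; rewrite !mxE; ring.
by rewrite E in h' *; rewrite (ingrid_uniq h h'); apply/colP => i; rewrite !mxE mulr0 addr0.
Qed.

(** Enumerating through residues 0 <= r i < |n i| gives the cardinality at once and avoids a
    description of the end points, which depend on the sign and parity of [n i]. *)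
Definition gridseq : seq 'cV[int]_d :=
  [seq gridrep (\col_i (r i)%:Z) | r : {dffun forall i : 'I_d, 'I_(`|n i|)}].

Lemma gridseq_uniq : uniq gridseq.
Proof.
rewrite map_inj_uniq ?enum_uniq// => r r' e; apply/ffunP => i; apply: val_inj => /=.
have [v ev] := gridrepE (\col_i (r i)%:Z); have [v' ev'] := gridrepE (\col_i (r' i)%:Z).
have := e; rewrite ev ev' => /colP/(_ i); rewrite !mxE => h.
have e1 : ((r i)%:Z %% n i)%Z = ((r' i)%:Z %% n i)%Z.
  have := congr1 (fun z => (z %% n i)%Z) h.
  by rewrite ![n i * _]mulrC !(addrC (Posz _)) !modzMDl.
have rm (r0 : 'I_(`|n i|)) : ((r0 : nat)%:Z %% n i)%Z = (r0 : nat)%:Z.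
  by rewrite -[LHS]modz_abs modz_nat modn_small.
by move: e1; rewrite !rm => -[].
Qed.

Lemma mem_gridseq k : (k \in gridseq) = ingrid k.
Proof.
apply/mapP/idP => [[r _ ->]|hk]; first exact: ingrid_gridrep.
have hr i : (`|(k i ord0 %% n i)%Z| < `|n i|)%N.
  by rewrite -ltz_nat gez0_abs ?modz_ge0//; have := ltz_mod (k i ord0) (n_neq0 i); rewrite abszE.
exists [ffun i => Ordinal (hr i)]; first by rewrite mem_enum.
rewrite -[LHS]gridrep_id//.
have -> : \col_i ([ffun i => Ordinal (hr i)] i : nat)%:Z = k + gridmul (\col_i - (k i ord0 %/ n i)%Z).
  apply/colP => i; rewrite !mxE ffunE /= gez0_abs ?modz_ge0//.
  by rewrite /modz mulrN mulrC.
by rewrite gridrep_eq.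
Qed.

Lemma size_gridseq : size gridseq = \prod_i `|n i|%N.
Proof.
rewrite size_map -cardE card_dep_ffun foldrE big_map big_enum/=.
by apply: eq_bigr => i _; rewrite card_ord.
Qed.

(** The map sending k to [gridrep (k + v)] is an injection of the finite list into itself, hence a
    permutation of it. *)
Lemma sum_grid_shift (V : nmodType) (F : 'cV[int]_d -> V) v :
  (forall k w, F (k + gridmul w) = F k) ->
  \sum_(k <- gridseq) F (k + v) = \sum_(k <- gridseq) F k.
Proof.
move=> Fp; have Fr k : F (gridrep k) = F k by have [w ->] := gridrepE k.
transitivity (\sum_(k <- gridseq) F (gridrep (k + v))).
  by apply: eq_bigr => k _; rewrite Fr.
rewrite -(big_map (fun k => gridrep (k + v)) predT F); apply: perm_big.
have inj : {in gridseq &, injective (fun k => gridrep (k + v))}.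
  move=> k k'; rewrite !mem_gridseq => hk hk' /= e.
  have [w ew] := gridrepE (k + v); have [w' ew'] := gridrepE (k' + v).
  rewrite -(gridrep_id hk) -(gridrep_id hk').
  have -> : k = k' + gridmul (w' - w).
    have := e; rewrite ew ew' => /colP h; apply/colP => i; have := h i.
    rewrite !mxE => e1; apply: (addIr (v i ord0 + n i * w i ord0)).
    by rewrite addrA e1; ring.
  by rewrite gridrep_eq.
have um : uniq [seq gridrep (k + v) | k <- gridseq].
  by rewrite map_inj_in_uniq// gridseq_uniq.
apply: uniq_perm => //; first exact: gridseq_uniq.
have sub : {subset [seq gridrep (k + v) | k <- gridseq] <= gridseq}.
  by move=> _ /mapP[k _ ->]; rewrite mem_gridseq ingrid_gridrep.
have [_ h] := uniq_min_size um sub (eq_leq (esym (size_map _ _))).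
by move=> k; rewrite h.
Qed.

End grid.

(** * Character sums on the grid and integration over a cell *)

Section grid_analysis.
Variables (R : realType) (d : nat) (n : 'I_d -> int).
Hypothesis n_neq0 : forall i, n i != 0.
Local Notation P := (@torus_prob R d).
Implicit Types (k l v : 'cV[int]_d) (x t : 'cV[R]_d).
Local Notation gseq := (gridseq R n).
Local Notation gpt := (gridpt R n).

Let nR_neq0 i : (n i)%:~R != 0 :> R. Proof. by rewrite intr_eq0. Qed.

Lemma cexpi_eq1 (t : R) : cexpi t = 1 -> exists z : int, t = z%:~R.
Proof.
move=> t1; exists (Num.floor t).
set a := t - (Num.floor t)%:~R.
have a1 : cexpi a = 1 by rewrite cexpiD cexpiN cexpi_int conjC1 mulr1.
have a01 : 0 <= a < 1.
  by have := floor_itv t; rewrite intrD /a; lra.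
suff : a = 0 by move/eqP; rewrite subr_eq0 => /eqP.
apply/eqP; rewrite eq_le; have /andP[-> aub] := a01; rewrite andbT leNgt; apply/negP => a0.
(* This follows from cos (2 pi a) = 1, but the sine is positive on (0, pi). *)
have : sin (pi * a) = 0.
  have c1 : cos (2 * pi * a) = 1 by case: a1.
  have : cos ((pi * a) *+ 2) = 1 by rewrite -c1 -mulr_natl mulrA.
  rewrite cos_mulr2n cos2sin2 mulrnBl => h.
  by apply/eqP; rewrite -sqrf_eq0; apply/eqP; lra.
have : 0 < sin (pi * a).
  by apply: sin_gt0_pi; rewrite mulr_gt0 ?pi_gt0//= -[ltRHS]mulr1 ltr_pM2l ?pi_gt0.
by move=> + e; rewrite e ltxx.
Qed.

Lemma Zperiodic_gridpt (T : Type) (f : 'cV[R]_d -> T) k w :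
  (forall x l, f (x + toR l) = f x) -> f (gpt (k + gridmul n w)) = f (gpt k).
Proof. by move=> fp; rewrite gridptD gridpt_mul. Qed.

Lemma sum_character_grid l : \sum_(k <- gseq) character l (gpt k) =
  if [forall i, (n i %| l i ord0)%Z] then (size gseq)%:R else 0 :> R[i].
Proof.
case: ifPn => [/forallP h|].
  have [v ->] : exists v, l = gridmul n v.
    exists (\col_i (l i ord0 %/ n i)%Z); apply/colP => i; rewrite !mxE.
    by rewrite mulrC divzK.
  transitivity (\sum_(k <- gseq) (1 : R[i])); last first.
    by rewrite big_const_seq count_predT iter_addr_0.
  apply: eq_bigr => k _; rewrite /character (_ : dotp _ _ = dotp (toR v) (toR k)).
    by have [z ->] := @dotp_toR R d v k; rewrite cexpi_int.
  by apply: eq_bigr => i _; rewrite !mxE intrM; field.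
rewrite negb_forall => /existsP[i hi].
set S := \sum_(k <- _) _; pose v : 'cV[int]_d := delta_mx i ord0.
have cv1 : character l (gpt v) != 1 :> R[i].
  apply/eqP => h; have [z] := cexpi_eq1 h.
  rewrite /dotp (bigD1 i)//= big1 ?addr0; last first.
    by move=> j ji; rewrite !mxE (negbTE ji) mul0r mulr0.
  rewrite !mxE !eqxx mul1r => e; move/negP: hi; apply; apply/dvdzP; exists z.
  by apply: (@intr_inj R); rewrite intrM -e divfK.
(* Translating the grid by the i-th unit step only permutes it, yet multiplies S by a number
   different from 1; so S = 0. *)
have : S = character l (gpt v) * S.
  rewrite /S -{1}(sum_grid_shift R n_neq0 v (F := fun k => character l (gpt k))).
    by rewrite mulr_sumr; apply: eq_bigr => k _; rewrite gridptD characterDr mulrC.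
  by move=> k w; apply: Zperiodic_gridpt; exact: Zperiodic_character.
move/eqP; rewrite -subr_eq0 -{1}[S]mul1r -mulrBl mulf_eq0 subr_eq0 eq_sym.
by rewrite (negbTE cv1) => /eqP.
Qed.

Lemma size_gridseq_gt0 : (0 < size gseq)%N.
Proof. by rewrite size_gridseq prodn_gt0// => i; rewrite absz_gt0. Qed.

Lemma gridchar_le l : gridchar gseq gpt l <= [forall i, (n i %| l i ord0)%Z]%:R :> R.
Proof.
have s0 := size_gridseq_gt0.
rewrite /gridchar sum_character_grid; case: ifP => _; last by rewrite normc0 mul0r.
rewrite -(rmorph_nat (real_complex R)) normc_realC ger0_norm// mulfV//.
by rewrite pnatr_eq0 -lt0n.
Qed.

Lemma torus_integral0 N (H : 'cV[R]_N -> \bar R) :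
  measurable_fun [set: 'cV[R]_N] H -> (forall y, 0 <= H y)%E ->
  (forall y : 'cV[R]_N, (forall i, `|y i ord0| <= 2^-1) -> H y = 0%E) ->
  (\int[torus_prob N]_y H y = 0)%E.
Proof.
elim: N H => [|N IH] H mH H0 Hc.
  by rewrite (eq_integral (cst 0%E)) ?integral0// => x _; rewrite Hc// => -[].
rewrite torus_probS// (eq_integral (cst 0%E)) ?integral0// => a.
rewrite inE/= in_itv/= => ha; apply: IH => //; first exact: measurable_consr.
move=> y hy; apply: Hc => i; rewrite /cV_cons.
have [j ->|j ->] := @split_ordP 1 N i.
  by rewrite (@col_mxEu _ 1 N 1) mxE ord1 eqxx mulr1n ler_norml.
by rewrite (@col_mxEd _ 1 N 1).
Qed.

Definition gridcell : set 'cV[R]_d :=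
  [set x | forall i, - 2^-1 <= (n i)%:~R * x i ord0 < 2^-1].

Lemma measurable_gridcell : measurable gridcell.
Proof.
rewrite (_ : gridcell = \bigcap_(i in [set: 'I_d])
    [set x | - 2^-1 <= (n i)%:~R * x i ord0 < 2^-1]); last first.
  by apply/seteqP; split => x h i //=; apply: h.
apply: fin_bigcap_measurable => // i _.
have m : measurable_fun [set: 'cV[R]_d] (fun x => (n i)%:~R * x i ord0).
  by apply: measurable_funM; [exact: measurable_cst|exact: measurable_coord].
have mI := measurable_itv `[- 2^-1, (2^-1 : R)[.
have := m measurableT _ mI; by rewrite setTI; congr measurable.
Qed.

(** The Z^d-periodic extension of the cell; the shift invariance of [torus_prob] is available for
    periodic functions. *)
Let cells : set 'cV[R]_d :=
  \bigcup_(z in [set: 'cV[int]_d]) [set x | gridcell (x + toR z)].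

Let measurable_cells : measurable cells.
Proof.
apply: countable_bigcupT_measurable => [|z]; first exact: countableP.
rewrite -[X in measurable X]setTI.
exact: (measurable_cV_shift _ measurableT measurable_gridcell).
Qed.

Hypothesis n_ge2 : forall i, (2 <= `|n i|)%N.

Lemma ge0_integral_gridcell (H : 'cV[R]_d -> \bar R) :
  measurable_fun [set: 'cV[R]_d] H -> (forall x, 0 <= H x)%E ->
  (forall x v, H (x + gpt v) = H x) ->
  (\int[P]_x H x <= (size gseq)%:R%:E * \int[P]_(x in gridcell) H x)%E.
Proof.
move=> mH H0 Hp.
have Hz x z : H (x + toR z) = H x by rewrite -(gridpt_mul R n_neq0) Hp.
pose chi x : R := \1_cells x.
have mchi : measurable_fun [set: 'cV[R]_d] chi by exact: measurable_indic.
have chi0 x : 0 <= chi x by rewrite /chi indicE.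
have chip x z : chi (x + toR z) = chi x.
  rewrite /chi !indicE; congr (_%:R); congr nat_of_bool; apply/idP/idP; rewrite !inE.
    by move=> -[w _ /= h]; exists (z + w) => //=; rewrite toRD addrA.
  by move=> -[w _ /= h]; exists (w - z) => //=; rewrite toRD toRN addrA addrAC addrK.
have mHchi t : measurable_fun [set: 'cV[R]_d] (fun x => H x * (chi (x + t))%:E)%E.
  apply: emeasurable_funM => //; apply/measurable_EFinP.
  exact: (measurableT_comp mchi (measurable_cV_shift t)).
have Hchi0 t x : (0 <= H x * (chi (x + t))%:E)%E by rewrite mule_ge0 ?lee_fin.
(* Rounding n_i x_i to a nearest integer selects the translated cell containing x, up to an integer
   vector v. *)
have cover x : 1 <= \sum_(r <- gseq) chi (x - gpt r).
  pose w : 'cV[int]_d := \col_i Num.floor ((n i)%:~R * x i ord0 + 2^-1).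
  have [v ev] := gridrepE R n w.
  have hw : gridrep R n w \in gseq by rewrite mem_gridseq// ingrid_gridrep.
  rewrite (big_rem (gridrep R n w))//= ler_wpDr//; first exact: sumr_ge0.
  rewrite /chi indicE mem_set//; exists v => //= i; rewrite ev gridptD gridpt_mul//.
  rewrite !mxE; have := floor_itv ((n i)%:~R * x i ord0 + 2^-1).
  rewrite intrD; set z := (Num.floor _)%:~R => h.
  have -> : (n i)%:~R * (x i ord0 - (z / (n i)%:~R + (v i ord0)%:~R) + (v i ord0)%:~R) =
     (n i)%:~R * x i ord0 - z by field.
  lra.
apply: (@le_trans _ _ (\int[P]_x \sum_(r <- gseq) (H x * (chi (x - gpt r))%:E))%E).
  apply: ge0_le_integral => //.
  - by apply: emeasurable_sum => r; exact: mHchi.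
  - move=> x _; rewrite -ge0_sume_distrr; last by move=> r _; rewrite lee_fin.
    by rewrite -[leLHS]mule1 lee_wpmul2l// sumEFin lee_fin.
rewrite ge0_integral_sum//.
rewrite (eq_bigr (fun=> \int[P]_x (H x * (chi x)%:E)))%E; last first.
  move=> r _; rewrite -(torus_integral_shift (gpt r) (mHchi _) (Hchi0 _)); last first.
    by move=> x z; rewrite Hz addrAC chip.
  by apply: eq_integral => x _; rewrite Hp addrK.
have mHc : measurable_fun [set: 'cV[R]_d] (fun x => H x * (chi x)%:E)%E.
  by apply: emeasurable_funM => //; exact/measurable_EFinP.
have -> : (\int[P]_x (H x * (chi x)%:E) = \int[P]_(x in gridcell) H x)%E.
  rewrite [RHS]integral_mkcond.
  have mr : measurable_fun [set: 'cV[R]_d] (H \_ gridcell).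
    by apply/(measurable_restrictT _ measurable_gridcell); exact: measurable_funTS.
  have le x : ((H \_ gridcell) x <= H x * (chi x)%:E)%E.
    rewrite patchE; case: ifPn => h; last by rewrite mule_ge0 ?lee_fin.
    rewrite /chi indicE mem_set ?mule1//; exists 0 => //=.
    by rewrite toR0 addr0; move: h; rewrite inE.
  have r0 x : (0 <= (H \_ gridcell) x)%E by rewrite patchE; case: ifP.
  apply/eqP; rewrite eq_le; apply/andP; split; last first.
    by apply: ge0_le_integral => //; move=> x _; exact: le.
  (* The other integer translates of the cell miss the closed unit cube, because |n i| >= 2 puts the
     cell inside [-1/4, 1/4]^d. They carry no mass. *)
  pose B : set 'cV[R]_d := cells `\` gridcell.
  have mB : measurable B by apply: measurableD => //; exact: measurable_gridcell.
  have B0 : (\int[P]_x (H \_ B) x = 0)%E.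
    apply: torus_integral0.
    - by apply/(measurable_restrictT _ mB); exact: measurable_funTS.
    - by move=> x; rewrite patchE; case: ifP.
    - move=> x hx; rewrite patchE; case: ifPn => //; rewrite inE => -[[z _ /= hz] nx].
      exfalso; apply: nx; suff z0 : z = 0 by rewrite z0 toR0 addr0 in hz.
      apply/colP => i; rewrite mxE; have := hx i; have := hz i; rewrite !mxE.
      set y := x i ord0 => h1 h2.
      have n2 : 2 <= `|(n i)%:~R : R|.
        by rewrite -intr_norm -[leRHS]/((`|n i|%N%:Z)%:~R) -pmulrn ler_nat.
      have h3 : `|y + (z i ord0)%:~R| <= 4^-1.
        have : `|(n i)%:~R * (y + (z i ord0)%:~R)| <= 2^-1.
          by rewrite ler_norml; lra.
        rewrite normrM => h4.
        have : 2 * `|y + (z i ord0)%:~R| <= 2^-1.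
          by apply: le_trans h4; rewrite ler_wpM2r.
        lra.
      have h5 : `|(z i ord0)%:~R| < 1 :> R.
        have := ler_normB (y + (z i ord0)%:~R) y; rewrite addrAC subrr add0r; lra.
      move: h5; rewrite ltr_norml => /andP[]; set c := z i ord0 => z1 z2.
      have : (-1 < c)%R by rewrite -(ltr_int R) mulrN1z.
      have : (c < 1)%R by rewrite -(ltr_int R).
      by clear; lia.
  apply: (@le_trans _ _ (\int[P]_x ((H \_ gridcell) x + (H \_ B) x))%E).
    apply: ge0_le_integral => //.
    - by move=> x _; rewrite mule_ge0 ?lee_fin.
    - by apply: emeasurable_funD => //; apply/(measurable_restrictT _ mB); exact: measurable_funTS.
    - move=> x _; rewrite /chi indicE.
      case: (boolP (x \in cells)) => hc; last first.
        by rewrite mule0 adde_ge0// patchE; case: ifP.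
      rewrite mule1 !patchE; case: (boolP (x \in gridcell)) => hg.
        by rewrite leeDl//; case: ifP.
      rewrite add0e mem_set//; split; first by move: hc; rewrite inE.
      by move: hg; rewrite notin_setE.
  rewrite ge0_integralD//.
  - by rewrite B0 adde0.
  - by move=> x _; rewrite patchE; case: ifP.
  - by apply/(measurable_restrictT _ mB); exact: measurable_funTS.
have I0 : (0 <= \int[P]_(x in gridcell) H x)%E by exact: integral_ge0.
elim: gseq => [|r s IH]; first by rewrite big_nil mul0e.
by rewrite big_cons /= -natr1 EFinD ge0_muleDl ?lee_fin// mul1e [leRHS]addeC leeD2l.
Qed.

End grid_analysis.

(** * Boxes of frequencies and the constants of their kernels *)

Section boxes.
Variables (R : realType) (d : nat).
Implicit Types (k l y z : 'cV[int]_d) (c : 'I_d -> int) (N a len : 'I_d -> nat).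

Definition box c len : seq 'cV[int]_d :=
  [seq \col_i (c i + (r i)%:Z) | r : {dffun forall i : 'I_d, 'I_(len i)}].

Lemma box_uniq c len : uniq (box c len).
Proof.
rewrite map_inj_uniq ?enum_uniq// => r r' /colP e; apply/ffunP => i.
by have := e i; rewrite !mxE => /addrI [] /val_inj.
Qed.

Lemma mem_box c len z :
  (z \in box c len) = [forall i, (c i <= z i ord0) && (z i ord0 < c i + (len i)%:Z)].
Proof.
apply/mapP/forallP => [[r _ ->] i|h].
  by rewrite mxE lerDl ltrD2l ltz_nat ltn_ord andbT.
have hr i : (`|z i ord0 - c i| < len i)%N.
  by move: (h i); set u := z i ord0; move: (c i) (len i) u; clear=> C L u; lia.
exists [ffun i => Ordinal (hr i)]; first by rewrite mem_enum.
apply/colP => i; rewrite mxE ffunE /= gez0_abs; last by move: (h i); set u := z i ord0; move: (c i) (len i) u; clear=> C L u; lia.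
by rewrite [RHS]addrC subrK.
Qed.

Lemma size_box c len : size (box c len) = (\prod_i len i)%N.
Proof.
rewrite size_map -cardE card_dep_ffun foldrE big_map big_enum/=.
by apply: eq_bigr => i _; rewrite card_ord.
Qed.

(** The box [vpJ N] has sides [0, N i) and [vpI a N] extends it by [a i] on both sides, so that |l
    i| <= a i gives l + J inside I, hence coefficient 1. *)
Definition vpI a N := box (fun i => - (a i)%:Z) (fun i => (N i + 2 * a i)%N).
Definition vpJ N := box (fun=> 0) N.

Lemma vpcoef_box_eq1 a N l : (forall i, 0 < N i)%N ->
  (forall i, (`|l i ord0| <= a i)%N) -> vpcoef R (vpI a N) (vpJ N) l = 1.
Proof.
move=> N0 la; apply: vpcoef_eq1.
  by rewrite size_box prodn_gt0.
move=> y; rewrite !mem_box => /forallP hy; apply/forallP => i; rewrite mxE.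
move: (hy i) (la i); set u := y i ord0; set v := l i ord0; move: (a i) (N i) u v; clear.
by move=> A B u v; lia.
Qed.

Lemma vpcoef_box_neq0 a N l : vpcoef R (vpI a N) (vpJ N) l != 0 ->
  forall i, (`|l i ord0| < a i + N i)%N.
Proof.
move=> h i; have : has (fun y => l + y \in vpI a N) (vpJ N).
  rewrite has_count lt0n; apply: contra h => /eqP e.
  by rewrite /vpcoef e mul0r.
move=> /hasP[y]; rewrite !mem_box => /forallP/(_ i) hy /forallP/(_ i).
rewrite mxE; move: hy; set u := y i ord0; set v := l i ord0.
by move: (a i) (N i) u v; clear=> A B u v; lia.
Qed.

Lemma vpmass_box_le a N (kappa : R) : (forall i, 0 < N i)%N -> 1 <= kappa ->
  (forall i, (N i + 2 * a i)%:R <= kappa * (N i)%:R) ->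
  vpmass R (vpI a N) (vpJ N) <= kappa ^+ d.
Proof.
move=> N0 k1 h.
have k0 : 0 <= kappa by lra.
have J0 : 0 < \prod_i (N i)%:R :> R by apply: prodr_gt0 => i _; rewrite ltr0n.
rewrite /vpmass !size_box !natr_prod.
have hI : \prod_i (N i + 2 * a i)%:R <= kappa ^+ d * \prod_i (N i)%:R :> R.
  rewrite -[d in kappa ^+ d]card_ord -prodr_const -big_split/=.
  by apply: ler_prod => i _; rewrite ler0n h.
have kd : 1 <= kappa ^+ d by rewrite exprn_ege1.
rewrite ler_pdivrMr ?mulr_gt0//.
have : \prod_i (N i)%:R <= kappa ^+ d * \prod_i (N i)%:R :> R by rewrite ler_peMl// ltW.
lra.
Qed.

Section with_grid.
Variable n : 'I_d -> int.
Hypothesis n_neq0 : forall i, n i != 0.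
Local Notation gseq := (gridseq R n).
Local Notation gpt := (gridpt R n).

(** Integer division of y - c by |n| is injective on a residue class and maps the box into one with
    sides len / |n| + 1. *)
Lemma count_box_residue c len z :
  (count (fun y => [forall i, (n i %| (z - y)%R i ord0)%Z]) (box c len) <=
    \prod_i (len i %/ `|n i| + 1))%N.
Proof.
set Q := fun y : 'cV[int]_d => _.
pose B := box (fun=> 0) (fun i => (len i %/ `|n i| + 1)%N).
pose f y : 'cV[int]_d := \col_i ((y i ord0 - c i) %/ (`|n i|%N : int))%Z.
have n0 i : (`|n i|%N : int) != 0 by rewrite eqz_nat absz_eq0.
rewrite -size_filter -(size_map f) -(size_box (fun=> 0)).
apply: uniq_leq_size.
  rewrite map_inj_in_uniq ?filter_uniq ?box_uniq// => y y'.
  rewrite !mem_filter => /andP[/forallP hy _] /andP[/forallP hy' _] /colP e.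
  apply/colP => i; have := e i; rewrite !mxE => ei.
  have hd : (`|n i|%N %| y i ord0 - y' i ord0)%Z.
    have -> : y i ord0 - y' i ord0 = (z - y') i ord0 - (z - y) i ord0 by rewrite !mxE; ring.
    by rewrite rpredB// ?dvdz_abs.
  have hm : ((y i ord0 - c i) %% (`|n i|%N : int))%Z = ((y' i ord0 - c i) %% (`|n i|%N : int))%Z.
    apply/eqP; rewrite eqz_mod_dvd.
    by have -> : y i ord0 - c i - (y' i ord0 - c i) = y i ord0 - y' i ord0 by ring.
  apply: (addIr (- c i)).
  by rewrite (divz_eq (y i ord0 - c i) (`|n i|%N : int)) ei hm -divz_eq.
move=> _ /mapP[y + ->]; rewrite mem_filter => /andP[_].
rewrite !mem_box => /forallP h; apply/forallP => i; rewrite mxE.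
have := h i => /andP[h1 h2].
have g0 : 0 <= y i ord0 - c i by rewrite subr_ge0.
have gn : (0 < `|n i|)%N by rewrite absz_gt0.
rewrite add0r; set w := y i ord0 - c i in g0 *.
have hw : (`|w| < len i)%N.
  move: h1 h2; rewrite /w; set u := y i ord0; move: (c i) (len i) u; clear=> C L u; lia.
rewrite -[w](gez0_abs g0) divz_nat lez_nat ltz_nat /= addn1 ltnS.
by apply: leq_div2r; exact: ltnW.
Qed.

(** For fixed z only the y congruent to z modulo n contribute, each at most 1. *)
Lemma gridmass_box_le c len : gridmass gseq gpt (box c len) <=
  (\prod_i len i)%:R * (\prod_i (len i %/ `|n i| + 1))%:R :> R.
Proof.
rewrite /gridmass -(size_box c len).
apply: (@le_trans _ _ (\sum_(z <- box c len) (\prod_i (len i %/ `|n i| + 1))%:R)); last first.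
  by rewrite big_const_seq count_predT iter_addr_0 mulr_natl.
apply: ler_sum => z _.
apply: (@le_trans _ _ (count (fun y => [forall i, (n i %| (z - y) i ord0)%Z]) (box c len))%:R).
  rewrite -sum1_count natr_sum [leRHS]big_mkcond/=; apply: ler_sum => y _.
  apply: le_trans (gridchar_le R n_neq0 _) _.
  by case: ifP.
by rewrite ler_nat count_box_residue.
Qed.

Lemma vpgrid_box_le a N (kappa L : R) : (forall i, 0 < N i)%N -> 1 <= kappa ->
  (forall i, (N i + 2 * a i)%:R <= kappa * (N i)%:R) -> 0 <= L ->
  (\prod_i ((N i + 2 * a i) %/ `|n i| + 1))%:R <= L ->
  vpgrid gseq gpt (vpI a N) (vpJ N) <= kappa ^+ d * L.
Proof.
move=> N0 k1 h L0 hL.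
have hJ : (\prod_i (N i %/ `|n i| + 1))%:R <= L.
  apply: le_trans hL; rewrite ler_nat; apply: leq_prod => i _.
  by rewrite leq_add2r leq_div2r// leq_addr.
apply: (@le_trans _ _ (vpmass R (vpI a N) (vpJ N) * L)); last first.
  by rewrite ler_wpM2r// vpmass_box_le.
rewrite /vpgrid /vpmass [leRHS]mulrAC [X in _ <= X / _]mulrDl ler_wpM2r ?invr_ge0 ?mulr_ge0//.
apply: lerD.
  apply: le_trans (gridmass_box_le _ _) _; rewrite size_box.
  by rewrite ler_wpM2l.
apply: le_trans (gridmass_box_le _ _) _; rewrite size_box.
by rewrite ler_wpM2l.
Qed.

End with_grid.
End boxes.

Lemma conjC_realC (R : realType) (a : R) : (a%:C : R[i])^* = a%:C.
Proof. exact: conjc_real. Qed.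

(** * Dual bounds for kernel sums and for samples *)

Section dual_bounds.
Variables (R : realType) (d : nat) (p : \bar R) (q : R).
Hypothesis pq : conjugate_exponents p q.
Local Notation P := (@torus_prob R d).
Implicit Types (f g F G : 'cV[R]_d -> R[i]).
Implicit Types (I J s : seq 'cV[int]_d) (c : 'cV[int]_d -> R[i]).

Let q_ge1 : 1 <= q. Proof. exact: conj_q_ge1 pq. Qed.
Let q_gt0 : 0 < q. Proof. exact: lt_le_trans ltr01 q_ge1. Qed.
Let p_gt0 : (0 < p)%E. Proof. exact: lt_le_trans lte01 (conj_p_ge1 pq). Qed.

Definition qnorm g : R := fine (Lpnorm q%:E g).

Lemma qnorm_ge0 g : 0 <= qnorm g.
Proof. by rewrite fine_ge0 ?Lpnorm_ge0. Qed.

Lemma qnormE g : bperiodic g -> Lpnorm q%:E g = (qnorm g)%:E.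
Proof.
by move=> bg; rewrite fineK// ge0_fin_numE ?Lpnorm_ge0// bperiodic_Lpnorm.
Qed.

Lemma qnorm_powR g : bperiodic g -> qnorm g `^ q = \int[P]_x (normc (g x) `^ q).
Proof.
move=> bg; rewrite /qnorm Lpnorm_fin LqintE ?(ltW q_gt0)// poweR_EFin /=.
rewrite -powRrM mulVf ?gt_eqF// powRr1//.
by apply: mean_ge0 => x; exact: powR_ge0.
Qed.

Lemma qnorm_le g (B : R) : bperiodic g -> 0 <= B ->
  \int[P]_x (normc (g x) `^ q) <= B `^ q -> qnorm g <= B.
Proof.
move=> bg B0 h; rewrite leNgt; apply/negP => h2.
have : B `^ q < qnorm g `^ q by rewrite gt0_ltr_powR ?nnegrE ?qnorm_ge0.
by rewrite qnorm_powR// ltNge h.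
Qed.

Definition pnorm f : R := fine (Lpnorm p f).

Lemma pnorm_ge0 f : 0 <= pnorm f.
Proof. by rewrite fine_ge0 ?Lpnorm_ge0. Qed.

Lemma pnormE f : (Lpnorm p f < +oo)%E -> Lpnorm p f = (pnorm f)%:E.
Proof. by move=> fp; rewrite fineK// ge0_fin_numE ?Lpnorm_ge0. Qed.

Lemma normc_pairing_le f g : cmeasurable f -> (Lpnorm p f < +oo)%E -> bperiodic g ->
  normc (pairing f g) <= pnorm f * qnorm g.
Proof.
move=> mf fp bg; rewrite -lee_fin EFinM -pnormE// -qnormE//.
by apply: (normc_pairing pq) => //; [case: bg|exact: bperiodic_Lpnorm].
Qed.

(** An L_p bound in dual form: it involves the finite exponent q only, and it adds up over
    decompositions of F. *)
Definition dualbound F (B : R) := forall g, bperiodic g ->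
  normc (pairing F g) <= B * qnorm g.

Lemma dualbound_Lpnorm F B : bperiodic F -> 0 <= B -> dualbound F B ->
  (Lpnorm p F <= B%:E)%E.
Proof.
move=> bF B0 h; apply: (Lpnorm_duality pq) => // g bg.
by rewrite qnormE// -EFinM lee_fin h.
Qed.

Lemma dualbound_pnorm F B : bperiodic F -> 0 <= B -> dualbound F B -> pnorm F <= B.
Proof.
move=> bF B0 h; rewrite -lee_fin -pnormE ?bperiodic_Lpnorm//.
exact: dualbound_Lpnorm.
Qed.

Lemma pnorm_dualbound F : bperiodic F -> dualbound F (pnorm F).
Proof.
by move=> bF g bg; apply: normc_pairing_le => //; [case: bF|exact: bperiodic_Lpnorm].
Qed.

Lemma cintegrable_pairing_bperiodic F g : cintegrable F -> bperiodic g ->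
  cintegrable (fun x => F x * (g x)^*).
Proof.
move=> iF [mg _ [B gB]]; apply: cintegrableM => //; first exact: cmeasurable_conj.
by exists B => x; rewrite normc_conj.
Qed.

Lemma pairingD F G g : cintegrable F -> cintegrable G -> bperiodic g ->
  pairing (fun x => F x + G x) g = pairing F g + pairing G g.
Proof.
move=> iF iG bg; rewrite /pairing -cintD; try exact: cintegrable_pairing_bperiodic.
by congr cint; apply/funext => x; rewrite mulrDl.
Qed.

Lemma pairingN F g : cintegrable F -> bperiodic g ->
  pairing (fun x => - F x) g = - pairing F g.
Proof.
move=> iF bg; rewrite -mulN1r /pairing -cintZ; last exact: cintegrable_pairing_bperiodic.
by congr cint; apply/funext => x; rewrite mulN1r mulNr.
Qed.

Lemma bperiodicD F G : bperiodic F -> bperiodic G -> bperiodic (fun x => F x + G x).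
Proof.
move=> [mF pF [B FB]] [mG pG [B' GB]]; split; first exact: cmeasurableD.
  by move=> x k; rewrite pF pG.
by exists (B + B') => x; apply: le_trans (le_normcD _ _) _; exact: lerD.
Qed.

Lemma bperiodicN F : bperiodic F -> bperiodic (fun x => - F x).
Proof.
move=> [mF pF [B FB]]; split.
- by under eq_fun do rewrite -mulN1r; apply: cmeasurableM => //; exact: cmeasurable_cst.
- by move=> x k; rewrite pF.
- by exists B => x; rewrite normcN.
Qed.

Lemma dualboundD F G B B' : bperiodic F -> bperiodic G ->
  dualbound F B -> dualbound G B' -> dualbound (fun x => F x + G x) (B + B').
Proof.
move=> bF bG hF hG g bg.
rewrite pairingD//; try exact: bperiodic_cintegrable.
apply: le_trans (le_normcD _ _) _; rewrite mulrDl; apply: lerD; [exact: hF|exact: hG].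
Qed.

Lemma dualboundN F B : bperiodic F -> dualbound F B -> dualbound (fun x => - F x) B.
Proof.
move=> bF hF g bg; rewrite pairingN//; last exact: bperiodic_cintegrable.
by rewrite normcN; exact: hF.
Qed.

Lemma le_dualbound F B B' : B <= B' -> dualbound F B -> dualbound F B'.
Proof.
move=> BB h g bg; apply: le_trans (h g bg) _.
by rewrite ler_wpM2r// qnorm_ge0.
Qed.

Lemma pairing_trigsum_r f s c : cintegrable f ->
  pairing f (trigsum s c) = \sum_(l <- s) (c l)^* * fourier f l.
Proof.
move=> fi; rewrite /pairing /trigsum.
rewrite (_ : (fun x => _) = fun x => \sum_(l <- s) (c l)^* * (f x * character (- l) x)); last first.
  apply/funext => x; rewrite conjC_sum mulr_sumr; apply: eq_bigr => l _.
  by rewrite conjCM characterNl mulrCA.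
rewrite cint_sum => [|l]; last by apply: cintegrableZ; exact: cintegrableM_character.
by apply: eq_bigr => l _; rewrite cintZ//; exact: cintegrableM_character.
Qed.

(** The kernel coefficients are real, so the operator is self-adjoint and can act on the bounded
    test function instead of f. *)
Lemma vpsum_dualbound I J f (kappa : R) : uniq I -> uniq J -> (0 < size J)%N ->
  vpmass R I J <= kappa ->
  cmeasurable f -> (Lpnorm p f < +oo)%E ->
  dualbound (vpsum I J f) (kappa * pnorm f).
Proof.
move=> uI uJ J0 mk mf fp g bg.
have fi : cintegrable f := Lp_cintegrable pq mf fp.
have gi := bperiodic_cintegrable bg.
have -> : pairing (vpsum I J f) g = pairing f (vpsum I J g).
  rewrite pairing_trigsum// pairing_trigsum_r//; apply: eq_bigr => l _.
  by rewrite conjCM conjC_realC; ring.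
have k0 : 0 <= kappa := le_trans (vpmass_ge0 R I J) mk.
apply: le_trans (normc_pairing_le mf fp (bperiodic_trigsum _ _)) _.
rewrite mulrAC mulrC ler_wpM2r ?pnorm_ge0//; apply: qnorm_le.
- exact: bperiodic_trigsum.
- by rewrite mulr_ge0 ?qnorm_ge0.
- apply: le_trans (vp_bound uI uJ J0 q_ge1 bg) _.
  rewrite (powRM _ k0 (qnorm_ge0 g)) (qnorm_powR bg) ler_wpM2r//.
    by apply: mean_ge0 => x; exact: powR_ge0.
  by rewrite ge0_ler_powR ?nnegrE ?vpmass_ge0// ltW.
Qed.

Lemma vpsum_id I J s c : uniq s ->
  (forall l, l \in s -> c l != 0 -> vpcoef R I J l = 1) ->
  vpsum I J (trigsum s c) = trigsum s c.
Proof.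
move=> us h; apply/funext => x; rewrite /vpsum /trigsum -/(trigsum s c).
pose F l := (vpcoef R I J l)%:C * fourier (trigsum s c) l * character l x.
have F0 l : l \notin s -> F l = 0.
  by move=> /negbTE ls; rewrite /F fourier_trigsum// ls mulr0 mul0r.
have F0' l : l \notin vpsupp I J -> F l = 0.
  by move=> ls; rewrite /F vpcoef_out// !mul0r.
rewrite -(fsum_seq (vpsupp_uniq I J) F0') (fsum_seq us F0).
apply: eq_big_seq => l ls; rewrite /F fourier_trigsum// ls.
by have [->|cl] := eqVneq (c l) 0; rewrite ?mulr0// h// mul1r.
Qed.

Lemma vpkernel_opp I J (x : 'cV[R]_d) : vpkernel I J (- x) = (vpkernel I J x)^*.
Proof.
rewrite /vpkernel /trigsum conjC_sum; apply: eq_bigr => l _.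
by rewrite conjCM conjC_realC characterNr.
Qed.

(** The kernel reproduces the polynomial, so its samples are integrals against translated kernels.
    The sum of these kernels weighted by H is bounded in L_q by synthesis, so that samples are
    controlled by the L_p norm, also for p = oo. *)
Lemma sampled_pairing (T : Type) (r : seq T) (u : T -> 'cV[R]_d) (H : T -> R[i])
    I J s c (kappa W : R) : uniq I -> uniq J -> uniq s ->
  (forall l, l \in s -> c l != 0 -> vpcoef R I J l = 1) ->
  vpmass R I J <= kappa -> 0 < W -> vpgrid r u I J <= W ->
  normc ((size r)%:R^-1%:C * \sum_(k <- r) trigsum s c (u k) * (H k)^*) <=
    pnorm (trigsum s c) * (W `^ (q - 1) * kappa *
      ((size r)%:R^-1 * \sum_(k <- r) normc (H k) `^ q)) `^ q^-1.
Proof.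
move=> uI uJ us cs mk W0 gW.
set E := (size r)%:R^-1.
have E0 : 0 <= E by rewrite invr_ge0.
have bk := bperiodic_trigsum (vpsupp I J) (fun l => (vpcoef R I J l)%:C).
pose F t := E%:C * \sum_(k <- r) H k * vpkernel I J (t - u k).
have bF : bperiodic F.
  have [mk' pk [B kB]] := bk; split.
  - apply: cmeasurableM; first exact: cmeasurable_cst.
    apply: cmeasurable_sum => k; apply: cmeasurableM; first exact: cmeasurable_cst.
    exact: cmeasurable_shift.
  - move=> x k; rewrite /F; congr (_ * _); apply: eq_bigr => t _.
    by rewrite addrAC [vpkernel _ _ _]pk.
  - exists (E * \sum_(k <- r) normc (H k) * B) => t.
    rewrite normcM normc_realC ger0_norm// ler_wpM2l//.
    apply: le_trans (normc_sum _ _ _) _; apply: ler_sum => k _.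
    by rewrite normcM ler_wpM2l ?normc_ge0//; exact: kB.
have bG := bperiodic_trigsum s c.
have iG := bperiodic_cintegrable bG.
have -> : E%:C * \sum_(k <- r) trigsum s c (u k) * (H k)^* = pairing (trigsum s c) F.
  rewrite /pairing.
  have e t : trigsum s c t * (F t)^* =
      E%:C * \sum_(k <- r) (H k)^* * (trigsum s c t * vpkernel I J (u k - t)).
    rewrite /F conjCM conjC_realC mulrCA; congr (_ * _).
    rewrite conjC_sum mulr_sumr; apply: eq_bigr => k _.
    by rewrite conjCM -vpkernel_opp opprB mulrCA.
  under [X in cint X]eq_fun do rewrite e.
  have ik k : cintegrable (fun t => trigsum s c t * vpkernel I J (u k - t)).
    apply: cintegrableM => //; first by apply: cmeasurable_reflect; case: bk.
    by case: bk => _ _ [B kB]; exists B => t; exact: kB.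
  rewrite cintZ; last by apply: cintegrable_sum => k; exact: cintegrableZ.
  congr (_ * _); rewrite cint_sum => [|k]; last exact: cintegrableZ.
  apply: eq_bigr => k _; rewrite cintZ// mulrC; congr (_ * _).
  rewrite -[in LHS](vpsum_id us cs) /vpsum trigsum_convolution//.
apply: le_trans (normc_pairing_le _ _ bF) _; first by case: bG.
  exact: bperiodic_Lpnorm.
rewrite ler_wpM2l ?pnorm_ge0//.
have k0 : 0 <= kappa := le_trans (vpmass_ge0 R I J) mk.
have S0 : 0 <= E * \sum_(k <- r) normc (H k) `^ q.
  by rewrite mulr_ge0//; apply: sumr_ge0 => k _; exact: powR_ge0.
apply: qnorm_le => //; first exact: powR_ge0.
rewrite -powRrM mulVf ?gt_eqF// powRr1; last first.
  by apply: mulr_ge0 => //; rewrite mulr_ge0 ?powR_ge0.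
apply: le_trans (vp_synthesis H uI uJ q_ge1 W0 gW) _.
by rewrite ler_wpM2r// ler_wpM2l ?powR_ge0.
Qed.

Lemma sampled_powR_le (T : Type) (r : seq T) (u : T -> 'cV[R]_d) I J s c (kappa W : R) :
  uniq I -> uniq J -> (0 < size J)%N -> uniq s ->
  (forall l, l \in s -> c l != 0 -> vpcoef R I J l = 1) ->
  vpmass R I J <= kappa -> vpgrid r u I J <= W ->
  (size r)%:R^-1 * \sum_(k <- r) normc (trigsum s c (u k)) `^ q <=
    kappa `^ (q - 1) * W * qnorm (trigsum s c) `^ q.
Proof.
move=> uI uJ J0 us cs mk gW.
have bG := bperiodic_trigsum s c.
have := vp_sampling r u uI uJ J0 q_ge1 bG.
rewrite (vpsum_id us cs) => /le_trans; apply.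
have vg0 : 0 <= vpgrid r u I J.
  rewrite /vpgrid divr_ge0 ?mulr_ge0// addr_ge0//; do 2 apply: sumr_ge0 => ? _;
    by rewrite /gridchar divr_ge0 ?normc_ge0.
rewrite qnorm_powR// ler_wpM2r//.
  by apply: mean_ge0 => x; exact: powR_ge0.
rewrite ler_pM ?powR_ge0// ge0_ler_powR ?nnegrE ?vpmass_ge0 ?subr_ge0//.
exact: le_trans (vpmass_ge0 R I J) mk.
Qed.

End dual_bounds.

(** * The operator on a single grid *)

Section quasi_projection.
Variables (R : realType) (d : nat) (p : \bar R) (q : R).
Hypothesis pq : conjugate_exponents p q.
Variable n : 'I_d -> int.
Hypothesis n_neq0 : forall i, n i != 0.
Variables (phi : 'cV[R]_d -> R[i]) (s : seq 'cV[int]_d) (A : nat).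
Hypotheses (us : uniq s) (phi0 : forall k, k \notin s -> fourier phi k = 0).
Hypothesis phiE : phi = trigsum s (fourier phi).
Hypothesis phi_supp : forall l, fourier phi l != 0 ->
  forall i, (`|l i ord0| <= A * `|n i|)%N.
Local Notation P := (@torus_prob R d).
Local Notation gseq := (gridseq R n).
Local Notation gpt := (gridpt R n).
Implicit Types (f g F G : 'cV[R]_d -> R[i]) (c : 'cV[int]_d -> R[i]).

Let q_ge1 : 1 <= q. Proof. exact: conj_q_ge1 pq. Qed.
Let q_gt0 : 0 < q. Proof. exact: lt_le_trans ltr01 q_ge1. Qed.

Local Notation Ninv := ((size gseq)%:R^-1 : R).

Definition qproj c : 'cV[R]_d -> R[i] :=
  fun x => Ninv%:C * \sum_(k <- gseq) c k * phi (x - gpt k).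

Definition Kphi : R := fine (multnorm q phi).

Lemma KphiE : multnorm q phi = Kphi%:E.
Proof.
rewrite fineK// ge0_fin_numE; first exact: multnorm_lty pq us phi0.
exact: multnorm_ge0 pq us phi0.
Qed.

Lemma Kphi_ge_fourier0 : normc (fourier phi 0) <= Kphi.
Proof. by rewrite -lee_fin -KphiE; exact: multnorm_ge_fourier0 pq us phi0. Qed.

Lemma Kphi_ge0 : 0 <= Kphi.
Proof. exact: le_trans (normc_ge0 _) Kphi_ge_fourier0. Qed.

Local Notation Hop := (multiplierc phi s).

Lemma qnorm_multiplierc g : bperiodic g -> qnorm q (Hop g) <= Kphi * qnorm q g.
Proof.
move=> bg; rewrite -lee_fin EFinM -KphiE -!(qnormE pq)//; last exact: bperiodic_trigsum.
exact: multiplierc_le pq us phi0 _ bg.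
Qed.

Lemma bperiodic_qproj c : bperiodic (qproj c).
Proof.
have [mf pf [B fB]] : bperiodic phi by rewrite phiE; exact: bperiodic_trigsum.
split.
- apply: cmeasurableM; first exact: cmeasurable_cst.
  apply: cmeasurable_sum => k; apply: cmeasurableM; first exact: cmeasurable_cst.
  exact: cmeasurable_shift.
- move=> x k; rewrite /qproj; congr (_ * _); apply: eq_bigr => t _.
  by rewrite addrAC pf.
- exists (Ninv * \sum_(k <- gseq) normc (c k) * B) => t.
  rewrite normcM normc_realC ger0_norm ?invr_ge0// ler_wpM2l ?invr_ge0//.
  apply: le_trans (normc_sum _ _ _) _; apply: ler_sum => k _.
  by rewrite normcM ler_wpM2l ?normc_ge0.
Qed.

Lemma phi_shift y x : phi (x - y) = trigsum s (fun l => fourier phi l * (character l y)^*) x.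
Proof.
rewrite [LHS](congr1 (fun f => f (x - y)) phiE) /trigsum; apply: eq_bigr => l _.
by rewrite characterDr characterNr; ring.
Qed.

Lemma pairing_qproj c g : bperiodic g ->
  pairing (qproj c) g = Ninv%:C * \sum_(k <- gseq) c k * (Hop g (gpt k))^*.
Proof.
move=> bg; have gi := bperiodic_cintegrable bg.
rewrite /pairing.
have e x : qproj c x * (g x)^* = Ninv%:C * \sum_(k <- gseq) c k * (phi (x - gpt k) * (g x)^*).
  by rewrite /qproj -mulrA mulr_suml; congr (_ * _); apply: eq_bigr => k _; rewrite mulrA.
under [X in cint X]eq_fun do rewrite e.
have ik k : cintegrable (fun x => phi (x - gpt k) * (g x)^*).
  under eq_fun do rewrite phi_shift.
  apply: cintegrable_pairing_bperiodic => //; exact: cintegrable_trigsum.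
rewrite cintZ; last by apply: cintegrable_sum => k; exact: cintegrableZ.
congr (_ * _); rewrite cint_sum => [|k]; last exact: cintegrableZ.
apply: eq_bigr => k _; rewrite cintZ//; congr (_ * _).
under [X in cint X]eq_fun do rewrite phi_shift.
rewrite -/(pairing _ g) pairing_trigsum// /multiplierc /trigsum conjC_sum.
by apply: eq_bigr => l _; rewrite !conjCM conjCK; ring.
Qed.

(** Constants of the kernel with N = |n| and a = A |n|: the ratio of sides is 2A + 1, and each
    residue class meets the larger box in at most 2A + 2 points per coordinate. *)
Definition mz_cst : R :=
  ((2 * A + 1)%:R ^+ d) `^ (q - 1) * ((2 * A + 1)%:R ^+ d * (2 * A + 2)%:R ^+ d).

Lemma mz_cst_ge0 : 0 <= mz_cst.
Proof. by rewrite mulr_ge0 ?powR_ge0// mulr_ge0 ?exprn_ge0. Qed.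

Lemma sampled_multiplier g : bperiodic g ->
  Ninv * \sum_(k <- gseq) normc (Hop g (gpt k)) `^ q <=
    mz_cst * (Kphi * qnorm q g) `^ q.
Proof.
move=> bg.
pose N i := `|n i|%N; pose a i := (A * `|n i|)%N.
have N0 i : (0 < N i)%N by rewrite absz_gt0.
have h i : (N i + 2 * a i)%:R <= (2 * A + 1)%:R * (N i)%:R :> R.
  by rewrite -natrM ler_nat /N /a; lia.
have k1 : 1 <= (2 * A + 1)%:R :> R by rewrite ler1n addn1.
apply: (@le_trans _ _ (mz_cst * qnorm q (Hop g) `^ q)); last first.
  rewrite ler_wpM2l ?mz_cst_ge0// ge0_ler_powR ?nnegrE ?qnorm_ge0 ?(ltW q_gt0)//.
    by rewrite mulr_ge0 ?qnorm_ge0 ?Kphi_ge0.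
  exact: qnorm_multiplierc.
have cs l : l \in s -> (fourier phi l)^* * fourier g l != 0 ->
    vpcoef R (vpI a N) (vpJ N) l = 1.
  move=> _ cl; apply: vpcoef_box_eq1 => // i; apply: phi_supp.
  by apply: contraNneq cl => ->; rewrite conjC0 mul0r.
have J0 : (0 < size (vpJ N))%N by rewrite size_box prodn_gt0.
have hm := vpmass_box_le N0 k1 h.
have hg : vpgrid gseq gpt (vpI a N) (vpJ N) <= (2 * A + 1)%:R ^+ d * (2 * A + 2)%:R ^+ d.
  apply: (vpgrid_box_le n_neq0 N0 k1 h); first exact: exprn_ge0.
  rewrite -natrX ler_nat -[d in (_ ^ d)%N]card_ord -prod_nat_const.
  apply: leq_prod => i _; rewrite /N /a.
  rewrite (_ : (`|n i| + 2 * (A * `|n i|) = (2 * A + 1) * `|n i|)%N); last by ring.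
  by rewrite mulnK ?absz_gt0//; lia.
exact: (sampled_powR_le pq (box_uniq _ _) (box_uniq _ _) J0 us cs hm hg).
Qed.

Section finer_grid.
Variables (n' : 'I_d -> int) (w : 'I_d -> nat).
Hypotheses (w_gt0 : forall i, (0 < w i)%N) (n'E : forall i, `|n' i|%N = (w i * `|n i|)%N).

(** Here the kernel has N = a = |n'|: the ratio of sides is 3, and each residue class has at most 3w
    + 1 <= 4w points per coordinate, whence 12 = 3 * 4. The product of the w is kept apart. *)
Definition grid_pairing_cst : R := ((12%:R ^+ d) `^ (q - 1) * 3%:R ^+ d) `^ q^-1.

(** The frequencies of the polynomial are on the scale |n'| = w |n|, while the samples are taken on
    the grid of n. The oversampling costs the product of the w to the power 1 - 1/q, that is 1/p. *)
Lemma grid_pairing_bound (H : 'cV[int]_d -> R[i]) s' c : uniq s' ->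
  (forall l, l \in s' -> c l != 0 -> forall i, (`|l i ord0| <= `|n' i|)%N) ->
  normc (Ninv%:C * \sum_(k <- gseq) trigsum s' c (gpt k) * (H k)^*) <=
    grid_pairing_cst * (\prod_i w i)%:R `^ (1 - q^-1) * pnorm p (trigsum s' c) *
    (Ninv * \sum_(k <- gseq) normc (H k) `^ q) `^ q^-1.
Proof.
move=> us' hc.
pose N i := `|n' i|%N.
have N0 i : (0 < N i)%N by rewrite /N n'E muln_gt0 w_gt0 absz_gt0 n_neq0.
have h i : (N i + 2 * N i)%:R <= 3%:R * (N i)%:R :> R.
  by rewrite -natrM ler_nat; lia.
pose L : R := 4%:R ^+ d * (\prod_i w i)%:R.
have L0 : 0 <= L by rewrite mulr_ge0 ?exprn_ge0.
have w0 : (0 < \prod_i w i)%N by rewrite prodn_gt0.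
have hL : (\prod_i ((N i + 2 * N i) %/ `|n i| + 1))%:R <= L.
  rewrite /L -natrX -natrM ler_nat -[d in (_ ^ d)%N]card_ord -prod_nat_const -big_split/=.
  apply: leq_prod => i _; rewrite /N n'E.
  rewrite (_ : (w i * `|n i| + 2 * (w i * `|n i|) = 3 * w i * `|n i|)%N); last by ring.
  by rewrite mulnK ?absz_gt0//; have := w_gt0 i; lia.
pose W : R := 3%:R ^+ d * L.
have W0 : 0 < W by rewrite !mulr_gt0 ?exprn_gt0// ltr0n.
have c3 : 1 <= 3%:R :> R by rewrite ler1n.
have := sampled_pairing pq H (box_uniq _ _) (box_uniq _ _) us'
  (fun l ls cl => vpcoef_box_eq1 R N0 (hc l ls cl)) (vpmass_box_le N0 c3 h) W0
  (vpgrid_box_le n_neq0 N0 c3 h L0 hL).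
move=> /le_trans; apply.
set X := Ninv * _.
have X0 : 0 <= X.
  by rewrite mulr_ge0 ?invr_ge0//; apply: sumr_ge0 => k _; exact: powR_ge0.
have -> : W `^ (q - 1) = (12%:R ^+ d) `^ (q - 1) * (\prod_i w i)%:R `^ (q - 1).
  rewrite -powRM ?exprn_ge0//; apply: (congr1 (fun z => z `^ (q - 1))).
  by rewrite /W /L mulrA -exprMn -natrM.
have M0 : 0 <= (12%:R ^+ d) `^ (q - 1) * 3%:R ^+ d :> R.
  by rewrite mulr_ge0 ?powR_ge0 ?exprn_ge0.
rewrite [_ * _ * _ * X](_ : _ = (12%:R ^+ d) `^ (q - 1) * 3%:R ^+ d *
   ((\prod_i w i)%:R `^ (q - 1) * X)); last by ring.
rewrite (powRM _ M0) ?(powRM _ (powR_ge0 _ _) X0); last by rewrite mulr_ge0 ?powR_ge0.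
rewrite -[(_ `^ (q - 1)) `^ q^-1]powRrM mulrBl mulfV ?gt_eqF// mul1r -/grid_pairing_cst.
by rewrite le_eqVlt; apply/orP; left; apply/eqP; ring.
Qed.

Definition qproj_cst : R := grid_pairing_cst * mz_cst `^ q^-1.

Lemma qproj_cst_ge0 : 0 <= qproj_cst.
Proof. by rewrite mulr_ge0 ?powR_ge0. Qed.

Lemma qproj_sampled_bound s' c g : uniq s' -> bperiodic g ->
  (forall l, l \in s' -> c l != 0 -> forall i, (`|l i ord0| <= `|n' i|)%N) ->
  normc (pairing (qproj (fun k => trigsum s' c (gpt k))) g) <=
    qproj_cst * (\prod_i w i)%:R `^ (1 - q^-1) * Kphi * pnorm p (trigsum s' c) * qnorm q g.
Proof.
move=> us' bg hc; rewrite pairing_qproj//.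
apply: le_trans (grid_pairing_bound (fun k => Hop g (gpt k)) us' hc) _.
have K0 := Kphi_ge0; have Q0 := qnorm_ge0 q g.
rewrite [leRHS](_ : _ = grid_pairing_cst * (\prod_i w i)%:R `^ (1 - q^-1) *
  pnorm p (trigsum s' c) * (mz_cst `^ q^-1 * (Kphi * qnorm q g))); last first.
  by rewrite /qproj_cst; ring.
rewrite ler_wpM2l ?mulr_ge0 ?powR_ge0 ?pnorm_ge0//.
have KQ0 : 0 <= Kphi * qnorm q g by rewrite mulr_ge0.
have -> : mz_cst `^ q^-1 * (Kphi * qnorm q g) = (mz_cst * (Kphi * qnorm q g) `^ q) `^ q^-1.
  by rewrite (powRM _ mz_cst_ge0 (powR_ge0 _ _)) -powRrM mulfV ?gt_eqF// powRr1.
rewrite ge0_ler_powR ?nnegrE ?invr_ge0 ?(ltW q_gt0)//.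
- by rewrite mulr_ge0 ?invr_ge0//; apply: sumr_ge0 => k _; exact: powR_ge0.
- by rewrite mulr_ge0 ?powR_ge0 ?mz_cst_ge0.
- exact: sampled_multiplier.
Qed.

End finer_grid.

(** Summation over the grid identifies frequencies congruent modulo n. Among those congruent to l
    only l itself can lie in the spectrum of phi, so there is no aliasing. *)
Lemma qproj_multiplier s' c : uniq s' ->
  (forall l v, l \in s' -> c l != 0 -> v != 0 -> fourier phi (l + gridmul n v) = 0) ->
  qproj (fun k => trigsum s' c (gpt k)) = trigsum s' (fun l => c l * fourier phi l).
Proof.
move=> us' hc; apply/funext => x; rewrite /qproj.
have s0 := size_gridseq_gt0 R n_neq0.
transitivity (\sum_(l <- s') \sum_(m <- s) c l * (fourier phi m * character m x) *
    (Ninv%:C * \sum_(k <- gseq) character (l - m) (gpt k))).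
  rewrite mulr_sumr.
  transitivity (\sum_(k <- gseq) \sum_(l <- s') \sum_(m <- s)
     c l * (fourier phi m * character m x) * (Ninv%:C * character (l - m) (gpt k))).
    apply: eq_bigr => k _; rewrite phi_shift /trigsum mulr_suml mulr_sumr.
    apply: eq_bigr => l _; rewrite !mulr_sumr; apply: eq_bigr => m _.
    by rewrite characterDl characterNl; ring.
  rewrite exchange_big/=; apply: eq_bigr => l _; rewrite exchange_big/=.
  by apply: eq_bigr => m _; rewrite -mulr_sumr -mulr_sumr.
apply: eq_big_seq => l ls.
transitivity (\sum_(m <- s) (if m == l then c l * (fourier phi m * character m x) else 0)).
  apply: eq_bigr => m _; rewrite sum_character_grid//.
  have [->|ml] := eqVneq m l.
    rewrite ifT; last by apply/forallP => i; rewrite subrr mxE dvdz0.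
    rewrite -(rmorph_nat (real_complex R)) -rmorphM /= mulVf ?mulr1//.
    by rewrite pnatr_eq0 -lt0n.
  case: ifPn => [/forallP h|_]; last by rewrite !mulr0.
  have [cl|cl] := eqVneq (c l) 0; first by rewrite cl !mul0r.
  pose v : 'cV[int]_d := \col_i ((m - l) i ord0 %/ n i)%Z.
  have mE : m = l + gridmul n v.
    apply/colP => i; rewrite !mxE mulrC divzK; first by ring.
    have := h i; rewrite !mxE => hd.
    by rewrite -opprB rpredN.
  have v0 : v != 0.
    by apply: contraNneq ml => v0; rewrite mE v0; apply/eqP/colP => i; rewrite !mxE mulr0 addr0.
  by rewrite mE hc// mul0r mulr0 mul0r.
rewrite sum_uniq_eq//; case: ifPn => [_|h]; first by rewrite mulrA.
by rewrite phi0// mulr0 mul0r.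
Qed.

(** By duality the multiplier norm on L_q also bounds the action on L_p. *)
Lemma multiplier_pairing_bound s' c g : uniq s' -> bperiodic g ->
  normc (pairing (trigsum s' (fun l => c l * fourier phi l)) g) <=
    Kphi * pnorm p (trigsum s' c) * qnorm q g.
Proof.
move=> us' bg; have gi := bperiodic_cintegrable bg.
have bH := bperiodic_trigsum s (fun k => (fourier phi k)^* * fourier g k).
have -> : pairing (trigsum s' (fun l => c l * fourier phi l)) g =
    pairing (trigsum s' c) (Hop g).
  rewrite !pairing_trigsum//; last exact: bperiodic_cintegrable.
  apply: eq_bigr => l _; rewrite fourier_trigsum//; case: ifPn => ls.
    by rewrite conjCM conjCK; ring.
  by rewrite phi0// !(mulr0, mul0r, conjC0).
have bT := bperiodic_trigsum s' c.
apply: le_trans (normc_pairing_le pq _ _ bH) _; first by case: bT.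
  by apply: bperiodic_Lpnorm => //; exact: lt_le_trans lte01 (conj_p_ge1 pq).
rewrite [Kphi * _]mulrC -mulrA ler_wpM2l ?pnorm_ge0//.
exact: qnorm_multiplierc.
Qed.

End quasi_projection.

(** * Diagonal dilations in coordinates *)

Section diagonal_dilation.
Variables (R : realType) (d : nat) (M : 'M[int]_d).
Hypotheses (M_diag : is_diag_mx M) (M_dil : @dilation R d M).
Implicit Types (x y : 'cV[R]_d) (k l : 'cV[int]_d) (j : nat).

Definition dgrid j : 'I_d -> int := fun i => M i i ^+ j.

(** Each diagonal entry is an eigenvalue, with a unit row vector as eigenvector; an integer of
    modulus greater than 1 has modulus at least 2. *)
Lemma dilation_entry_ge2 i : (2 <= `|M i i|)%N.
Proof.
have [r Mr] := elimT (diag_mxP M) M_diag.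
suff : eigenvalue (map_mx intr M : 'M[R[i]]_d) (M i i)%:~R.
  move=> /M_dil; rewrite -(rmorph_int (real_complex R)) normc_realC -intr_norm.
  by rewrite -[ltLHS]/(1%:~R) ltr_int; lia.
apply/eigenvalueP; exists (delta_mx 0 i).
  apply/rowP => k; rewrite Mr !mxE (bigD1 i)//= big1 ?addr0; last first.
    by move=> m /negbTE mi; rewrite !mxE mi andbF mul0r.
  rewrite !mxE !eqxx mul1r mulr1n.
  by rewrite [k == i]eq_sym; case: eqVneq => _; rewrite ?mulr1n ?mulr1// mulr0n mulr0.
apply/eqP => /rowP/(_ i)/eqP; rewrite !mxE !eqxx oner_eq0//.
Qed.

Lemma dgrid_neq0 j i : dgrid j i != 0.
Proof. by rewrite expf_neq0// -absz_gt0; apply: leq_trans (dilation_entry_ge2 i). Qed.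

Lemma abs_dgrid j i : `|dgrid j i|%N = (`|M i i| ^ j)%N.
Proof. by rewrite /dgrid abszX. Qed.

Lemma dgrid_ge2 j i : (0 < j)%N -> (2 <= `|dgrid j i|)%N.
Proof.
move=> j0; rewrite abs_dgrid; apply: leq_trans (dilation_entry_ge2 i) _.
by rewrite -{1}[`|M i i|%N]expn1 leq_pexp2l// (leq_trans _ (dilation_entry_ge2 i)).
Qed.

Let dR_neq0 j i : (dgrid j i)%:~R != 0 :> R.
Proof. by rewrite intr_eq0 dgrid_neq0. Qed.

Lemma map_diag : map_mx intr M = diag_mx (\row_i (M i i)%:~R) :> 'M[R]_d.
Proof.
have [r Mr] := elimT (diag_mxP M) M_diag.
by apply/matrixP => i k; rewrite Mr !mxE eqxx mulr1n; case: eqP => [->|]; rewrite ?mulr1n ?mulr0n.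
Qed.

Lemma diag_mx_exp (v : 'rV[R]_d) j : diag_mx v ^+ j = diag_mx (\row_i v 0 i ^+ j).
Proof.
elim: j => [|j IH].
  rewrite expr0 -[1]/(1%:M); apply/matrixP => i k; rewrite !mxE expr0//.
rewrite exprS IH; apply/matrixP => i k; rewrite -mulmxE mul_diag_mx !mxE.
by case: eqP => [->|]; rewrite ?mulr1n ?mulr0n ?mulr0// exprS.
Qed.

Lemma MpowE j : Mpow M j = diag_mx (\row_i (dgrid j i)%:~R) :> 'M[R]_d.
Proof.
rewrite /Mpow map_diag diag_mx_exp; congr diag_mx.
by apply/rowP => i; rewrite !mxE rmorphXn.
Qed.

Lemma MspowE j : Mspow M j = Mpow M j :> 'M[R]_d.
Proof. by rewrite /Mspow /Mpow map_diag tr_diag_mx. Qed.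

Lemma MspowNE j : MspowN M j = MpowN M j :> 'M[R]_d.
Proof. by rewrite /MspowN MspowE. Qed.

Lemma Mpow_mul j x i : (Mpow M j *m x) i ord0 = (dgrid j i)%:~R * x i ord0.
Proof. by rewrite MpowE mul_diag_mx !mxE. Qed.

Lemma invmx_diag (v : 'I_d -> R) : (forall i, v i != 0) ->
  invmx (diag_mx (\row_i v i)) = diag_mx (\row_i (v i)^-1).
Proof.
move=> v0.
have h : diag_mx (\row_i v i) *m diag_mx (\row_i (v i)^-1) = 1%:M.
  apply/matrixP => i k; rewrite mul_diag_mx !mxE.
  by case: eqP => [->|]; rewrite ?mulr1n ?mulr0n ?mulr0// mulfV.
have [u _] := mulmx1_unit h.
by rewrite -[RHS]mul1mx -(mulVmx u) -mulmxA h mulmx1.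
Qed.

Lemma scaled_MpowN_mul (e : R) j x i : e != 0 ->
  (invmx (e *: Mpow M j) *m x) i ord0 = x i ord0 / (e * (dgrid j i)%:~R).
Proof.
move=> e0; rewrite MpowE (_ : _ *: _ = diag_mx (\row_i (e * (dgrid j i)%:~R))).
  by rewrite invmx_diag => [|m]; rewrite ?mulf_neq0// mul_diag_mx !mxE mulrC.
by apply/matrixP => m k; rewrite !mxE; case: eqP; rewrite ?mulr1n ?mulr0n ?mulr0.
Qed.

Lemma MpowN_mul j x i : (MpowN M j *m x) i ord0 = x i ord0 / (dgrid j i)%:~R.
Proof. by rewrite /MpowN -[Mpow M j]scale1r scaled_MpowN_mul ?oner_neq0// mul1r. Qed.

Lemma MpowN_gridpt j k : MpowN M j *m toR k = gridpt R (dgrid j) k.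
Proof. by apply/colP => i; rewrite MpowN_mul !mxE. Qed.

Lemma D_ingrid j k : D (@Mpow R d M j) k <-> ingrid R (dgrid j) k.
Proof.
split=> [[x xc xk]|/ingridP h].
  apply/ingridP => i; have := xc i; rewrite !mxE.
  have /colP/(_ i) := xk; rewrite Mpow_mul mxE => <-.
  by rewrite mulrAC mulfV ?mul1r.
exists (gridpt R (dgrid j) k); first exact: h.
by apply/colP => i; rewrite Mpow_mul !mxE mulrC divfK.
Qed.

Lemma D_gridseq j : D (@Mpow R d M j) = [set` gridseq R (dgrid j)].
Proof.
apply/seteqP; split => k /=; rewrite mem_gridseq; try exact: dgrid_neq0.
  by move=> /D_ingrid.
by move=> ?; apply/D_ingrid.
Qed.

Lemma sum_D (V : nmodType) j (F : 'cV[int]_d -> V) :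
  \sum_(k \in D (@Mpow R d M j)) F k = \sum_(k <- gridseq R (dgrid j)) F k.
Proof. by rewrite D_gridseq -fsbig_seq// gridseq_uniq//; exact: dgrid_neq0. Qed.

Lemma absdetE : absdet M = (\prod_i `|M i i|%N)%:R :> R.
Proof.
rewrite /absdet; have [r Mr] := elimT (diag_mxP M) M_diag.
rewrite {1}Mr det_diag normr_prod rmorph_prod natr_prod; apply: eq_bigr => i _.
have -> : r 0 i = M i i by rewrite Mr mxE eqxx mulr1n.
by rewrite -abszE.
Qed.

Lemma absdet_gt0 : 0 < absdet M :> R.
Proof.
rewrite absdetE ltr0n prodn_gt0// => i.
exact: leq_trans (dilation_entry_ge2 i).
Qed.

Lemma absdet_exp j : absdet M ^+ j = (size (gridseq R (dgrid j)))%:R :> R.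
Proof.
rewrite (size_gridseq R (dgrid j)) absdetE -natrX; congr _%:R.
rewrite (big_morph (expn^~ j) (fun a b => expnMn a b j) (exp1n j)).
by apply: eq_bigr => i _; rewrite abs_dgrid.
Qed.

Lemma QopE j c phi : Qop M j c phi = qproj (dgrid j) phi c :> ('cV[R]_d -> R[i]).
Proof.
apply/funext => x; rewrite /Qop /qproj absdet_exp sum_D; congr (_ * _).
by apply: eq_bigr => k _; rewrite MpowN_gridpt.
Qed.

Lemma character_gridpt j k l :
  cexpi (dotp (toR k) (MspowN M j *m toR l)) = character l (gridpt R (dgrid j) k).
Proof.
rewrite MspowNE /character; congr cexpi; apply: eq_bigr => i _.
by rewrite MpowN_mul !mxE mulrCA.
Qed.

Lemma trigpairE j s c (u : ('cV[R]_d -> R[i]) -> R[i]) k : uniq s ->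
  trigpair M j (trigsum s c) u k =
  trigsum s (fun l => c l * (dfourier u l)^*) (gridpt R (dgrid j) k).
Proof.
move=> us; rewrite /trigpair (fsum_seq us).
  by apply: eq_big_seq => l ls; rewrite character_gridpt fourier_trigsum// ls.
by move=> l /negbTE ls; rewrite fourier_trigsum// ls !mul0r.
Qed.

Lemma enorm_ge0 x : 0 <= enorm x. Proof. exact: sqrtr_ge0. Qed.

Lemma enorm_ge_coord x i : `|x i ord0| <= enorm x.
Proof.
rewrite -sqrtr_sqr ler_wsqrtr// (bigD1 i)//= lerDl.
by apply: sumr_ge0 => k _; exact: sqr_ge0.
Qed.

Lemma enorm_le_sum x : enorm x <= \sum_i `|x i ord0|.
Proof.
have S0 : 0 <= \sum_i `|x i ord0| by exact: sumr_ge0.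
rewrite -(ger0_norm S0) -sqrtr_sqr ler_wsqrtr// expr2 mulr_suml; apply: ler_sum => i _.
rewrite -real_normK ?num_real// expr2 ler_wpM2l// (bigD1 i)//= lerDl.
exact: sumr_ge0.
Qed.

Lemma le_enorm x y : (forall i, `|x i ord0| <= `|y i ord0|) -> enorm x <= enorm y.
Proof.
move=> h; rewrite ler_wsqrtr//; apply: ler_sum => i _.
by rewrite -(real_normK (num_real (x i ord0))) -(real_normK (num_real (y i ord0))) lerXn2r ?nnegrE.
Qed.

Lemma enormZ (a : R) x : enorm (a *: x) = `|a| * enorm x.
Proof.
rewrite /enorm; under eq_bigr do rewrite mxE exprMn.
by rewrite -mulr_sumr sqrtrM ?sqr_ge0// sqrtr_sqr.
Qed.

Lemma MpowN_contract j x : enorm (MpowN M j *m x) <= enorm x.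
Proof.
apply: le_enorm => i; rewrite MpowN_mul normrM normfV ler_piMr//.
rewrite invf_le1 ?normr_gt0//.
rewrite -intr_norm -[leLHS]/(1%:~R) ler_int.
by have := dgrid_neq0 j i; lia.
Qed.

Lemma enorm0 : enorm (0 : 'cV[R]_d) = 0.
Proof. by rewrite /enorm big1 ?sqrtr0// => i _; rewrite mxE expr0n. Qed.

Lemma opnorm_le j x : enorm (MpowN M j *m x) <= opnorm (@MpowN R d M j) * enorm x.
Proof.
set S := [set enorm (MpowN M j *m y) | y in [set y : 'cV[R]_d | enorm y <= 1]].
(* The supremum is meaningful only for a nonempty bounded set; the bound 1 comes from the
   contraction property. *)
have hS : has_sup S.
  split; first by exists (enorm (MpowN M j *m (0 : 'cV[R]_d))); exists 0 => //=; rewrite enorm0.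
  exists 1 => _ [y /= y1 <-]; exact: le_trans (MpowN_contract j y) y1.
have [x0|x0] := eqVneq (enorm x) 0.
  have := MpowN_contract j x; rewrite x0 mulr0 => h; exact: h.
have xp : 0 < enorm x by rewrite lt0r x0 enorm_ge0.
have : enorm (MpowN M j *m ((enorm x)^-1 *: x)) <= sup S.
  apply: sup_ubound => //; first by case: hS.
  exists ((enorm x)^-1 *: x) => //=.
  by rewrite enormZ ger0_norm ?invr_ge0 ?enorm_ge0// mulVf.
rewrite -scalemxAr enormZ ger0_norm ?invr_ge0 ?enorm_ge0//.
by rewrite ler_pdivrMl// mulrC.
Qed.

Lemma opnorm_ge0 j : 0 <= opnorm (@MpowN R d M j).
Proof.
rewrite (le_trans (enorm_ge0 (MpowN M j *m (0 : 'cV[R]_d))))// sup_ubound//.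
  exists 1 => _ [y /= y1 <-]; exact: le_trans (MpowN_contract j y) y1.
by exists 0 => //=; rewrite enorm0.
Qed.

Lemma cube_gridcell j : (mulmx (@MpowN R d M j)) @` cube = gridcell (dgrid j).
Proof.
apply/seteqP; split => [_ [x xc <-] i|x h].
  by rewrite MpowN_mul mulrC divfK.
exists (Mpow M j *m x); first by move=> i; rewrite Mpow_mul.
by apply/colP => i; rewrite MpowN_mul Mpow_mul mulrAC mulfV ?mul1r.
Qed.

End diagonal_dilation.

(** * Trigonometric polynomials on a common list of frequencies *)

Section trigonometric_polynomials.
Variables (R : realType) (d : nat).
Implicit Types (F G T : 'cV[R]_d -> R[i]) (s : seq 'cV[int]_d) (c : 'cV[int]_d -> R[i]).

Lemma trigpoly_bperiodic T : trigpoly T -> bperiodic T.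
Proof. by move=> [s [c ->]]; exact: bperiodic_trigsum. Qed.

Lemma trigpoly_common F G : trigpoly F -> trigpoly G -> exists s,
  [/\ uniq s, F = trigsum s (fourier F) & G = trigsum s (fourier G)].
Proof.
move=> /trigpolyP[s1 [u1 F1 h1]] /trigpolyP[s2 [u2 G2 h2]].
exists (undup (s1 ++ s2)); split; first exact: undup_uniq.
  rewrite {1}F1; apply/funext => x; rewrite /trigsum.
  rewrite -(fsum_seq u1) => [|k ks]; last by rewrite h1// mul0r.
  rewrite -(fsum_seq (undup_uniq _))// => k.
  by rewrite mem_undup mem_cat => /norP[ks _]; rewrite h1// mul0r.
rewrite {1}G2; apply/funext => x; rewrite /trigsum.
rewrite -(fsum_seq u2) => [|k ks]; last by rewrite h2// mul0r.
rewrite -(fsum_seq (undup_uniq _))// => k.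
by rewrite mem_undup mem_cat => /norP[_ ks]; rewrite h2// mul0r.
Qed.

Lemma trigsumB s c c' : (fun x => trigsum s c x - trigsum s c' x) =
  trigsum s (fun l => c l - c' l) :> ('cV[R]_d -> R[i]).
Proof.
apply/funext => x; rewrite /trigsum -sumrB; apply: eq_bigr => l _.
by rewrite mulrBl.
Qed.

Lemma trigpoly0 : trigpoly (fun _ : 'cV[R]_d => 0 : R[i]).
Proof. by exists [::], (fun=> 0); apply/funext => x; rewrite big_nil. Qed.

Lemma fourier0 k : fourier (fun _ : 'cV[R]_d => 0 : R[i]) k = 0.
Proof. by rewrite /fourier; under eq_fun do rewrite mul0r; exact: cint_cst. Qed.

Lemma bperiodicB F G : bperiodic F -> bperiodic G -> bperiodic (fun x => F x - G x).
Proof. by move=> bF bG; apply: bperiodicD => //; exact: bperiodicN. Qed.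

Lemma cmeasurableB F G : cmeasurable F -> cmeasurable G -> cmeasurable (fun x => F x - G x).
Proof.
move=> mF mG; apply: cmeasurableD => //.
by under eq_fun do rewrite -mulN1r; apply: cmeasurableM => //; exact: cmeasurable_cst.
Qed.

End trigonometric_polynomials.

(** * Best approximation as an infimum *)

Section best_approximation.
Variables (R : realType) (d : nat) (p : \bar R).
Implicit Types (f T : 'cV[R]_d -> R[i]) (A : 'M[R]_d).

Definition approximant A T := trigpoly T /\
  spec T `<=` [set k | enorm (invmx A *m toR k) < 1].

Lemma approximant0 A : approximant A (fun=> 0).
Proof. by split=> [|k]; [exact: trigpoly0|rewrite /spec /= fourier0 eqxx]. Qed.

Lemma bestapprox_ge0 A f : (0 <= bestapprox A p f)%E.
Proof. by apply: le_ereal_inf_tmp => _ [T _ <-]; exact: Lpnorm_ge0. Qed.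

Lemma bestapprox_le A f T : approximant A T ->
  (bestapprox A p f <= Lpnorm p (fun x => f x - T x)%R)%E.
Proof. by move=> hT; apply: ereal_inf_lbound; exists T. Qed.

Lemma bestapprox_le_Lpnorm A f : (bestapprox A p f <= Lpnorm p f)%E.
Proof.
apply: le_trans (bestapprox_le f (approximant0 A)) _.
by under eq_fun do rewrite subr0.
Qed.

(** Transfers an estimate valid for every approximant to the infimum, which need not be attained. *)
Lemma le_bestapprox A f (X : \bar R) (a b : R) : 0 <= b ->
  (forall T, approximant A T ->
    (X <= a%:E + b%:E * Lpnorm p (fun x => (f x - T x)%R))%E) ->
  (X <= a%:E + b%:E * bestapprox A p f)%E.
Proof.
move=> b0 h; rewrite -leeBlDl//.
have [bE|bN] := eqVneq b 0.
  have := h _ (approximant0 A); rewrite bE !mul0e adde0 => hX.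
  by rewrite leeBlDl// adde0.
have bp : 0 < b by rewrite lt0r bN.
rewrite -lee_pdivrMl//; apply: le_ereal_inf_tmp => _ [T hT <-].
by rewrite lee_pdivrMl// leeBlDl//; exact: h.
Qed.

Lemma le_bestapprox_mx A B f :
  (forall x, enorm (invmx B *m x) <= enorm (invmx A *m x)) ->
  (bestapprox B p f <= bestapprox A p f)%E.
Proof.
move=> h; apply: le_ereal_inf => _ [T [tT sT] <-]; exists T => //; split => // k /sT.
exact: le_lt_trans (h _).
Qed.

End best_approximation.

(** * Convergence of complex sequences *)

Section complex_sequences.
Variable R : realType.
Implicit Types (x : nat -> R) (z : nat -> R[i]) (l : R[i]).

(** Telescoping writes x as a constant plus an absolutely convergent series. *)
Lemma cvg_bounded_variation x (B : R) :
  (forall n, \sum_(i < n) `|x i.+1 - x i| <= B) -> cvgn x.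
Proof.
move=> hB; have nB n : series (fun i => `|x i.+1 - x i|) n <= B.
  by rewrite /series /= big_mkord.
have c : cvgn (series (fun i => x i.+1 - x i)).
  apply: normed_cvg; apply: nondecreasing_is_cvgn.
    by apply: nondecreasing_series => i _ _; exact: normr_ge0.
  by exists B => _ [n _ <-]; exact: nB.
have -> : x = (fun=> x 0%N) \+ series (fun i => x i.+1 - x i).
  apply/funext => n /=; rewrite /series /= telescope_sumr//.
  by rewrite addrC subrK.
by apply: is_cvgD => //; exact: is_cvg_cst.
Qed.

Lemma ccvg_bounded_variation z (B : R) :
  (forall n, \sum_(i < n) normc (z i.+1 - z i) <= B) -> exists l, ccvg z l.
Proof.
move=> hB.
have cr : cvgn (fun n => complex.Re (z n)).
  apply: (@cvg_bounded_variation _ B) => n; apply: le_trans (hB n).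
  apply: ler_sum => i _; apply: le_trans (ReC_le _).
  by case: (z i.+1) (z i) => ? ? [].
have ci : cvgn (fun n => complex.Im (z n)).
  apply: (@cvg_bounded_variation _ B) => n; apply: le_trans (hB n).
  apply: ler_sum => i _; apply: le_trans (ImC_le _).
  by case: (z i.+1) (z i) => ? ? [].
exists (lim (complex.Re (z n) @[n --> \oo]) +i* lim (complex.Im (z n) @[n --> \oo])).
set a := lim _; set b := lim _.
have h : `|complex.Re (z n) - a| + `|complex.Im (z n) - b| @[n --> \oo] --> (0 : R).
  have h1 (x : nat -> R) : cvgn x -> `|x n - lim (x k @[k --> \oo])| @[n --> \oo] --> (0 : R).
    move=> cx; rewrite -(normr0 R); apply: cvg_norm.
    by rewrite -(subrr (lim (x k @[k --> \oo]))); apply: cvgB; [exact: cx|exact: cvg_cst].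
  by rewrite -[0 : R]addr0; apply: cvgD; exact: h1.
apply: (squeeze_cvgr _ (cvg_cst 0) h); apply: nearW => n.
rewrite normc_ge0/=; apply: le_trans (normc_le_ReIm _) _.
by case: (z n).
Qed.

Lemma ccvg_shift z l (j : nat) : ccvg (fun n => z (n + j)%N) l -> ccvg z l.
Proof. by rewrite /ccvg -(cvg_shiftn j (fun n => normc (z n - l))). Qed.

Lemma ccvg_le z z' l (b : nat -> R) : ccvg z l -> b n @[n --> \oo] --> (0 : R) ->
  (\forall n \near \oo, normc (z' n - z n) <= b n) -> ccvg z' l.
Proof.
move=> zl b0 zz.
have h : b n + normc (z n - l) @[n --> \oo] --> (0 : R).
  by rewrite -[0 : R]addr0; apply: cvgD.
apply: (squeeze_cvgr _ (cvg_cst 0) h); near=> n.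
rewrite normc_ge0/=; have -> : z' n - l = (z' n - z n) + (z n - l) by ring.
apply: le_trans (le_normcD _ _) _; rewrite lerD2r.
by near: n.
Unshelve. all: by end_near.
Qed.

Lemma cvg0_le_add (x B : R) (b : nat -> R) (j : nat) : b n @[n --> \oo] --> (0 : R) ->
  (forall n, (j <= n)%N -> x <= B + b n) -> x <= B.
Proof.
move=> b0 h; apply/ler_addgt0Pr => e e0.
have [n _ hn] : \forall n \near \oo, b n < e by apply: (cvgr_lt 0).
apply: le_trans (h _ (leq_maxl j n)) _; rewrite lerD2l ltW//.
by apply: hn => /=; exact: leq_maxr.
Qed.

Lemma cvg0_sum (I : eqType) (r : seq I) (F : I -> nat -> R) :
  (forall i, i \in r -> F i n @[n --> \oo] --> (0 : R)) ->
  \sum_(i <- r) F i n @[n --> \oo] --> (0 : R).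
Proof.
elim: r => [|i r IH] h.
  by under eq_fun do rewrite big_nil; exact: cvg_cst.
have hr : \sum_(k <- r) F k n @[n --> \oo] --> (0 : R).
  by apply: IH => k kr; apply: h; rewrite in_cons kr orbT.
have -> : (fun n => \sum_(k <- i :: r) F k n) = F i \+ (fun n => \sum_(k <- r) F k n).
  by apply/funext => n; rewrite big_cons.
by have := cvgD (h i (mem_head _ _)) hr; rewrite addr0; apply.
Qed.

End complex_sequences.

(** * Near-best approximants *)

Section near_best_approximation.
Variables (R : realType) (d : nat) (M : 'M[int]_d) (p : \bar R) (q delta : R).
Hypotheses (M_diag : is_diag_mx M) (M_dil : @dilation R d M).
Hypothesis pq : conjugate_exponents p q.
Hypotheses (delta_gt0 : 0 < delta) (delta_lt : delta < 2^-1).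
Implicit Types (nu : nat) (i : 'I_d) (f T : 'cV[R]_d -> R[i]) (l : 'cV[int]_d).
Local Notation b nu i := (`|dgrid M nu i|%N).

Let b_gt0 nu i : (0 < b nu i)%N.
Proof. by rewrite absz_gt0; exact: (dgrid_neq0 M_diag M_dil). Qed.

Let p_ge1 : (1 <= p)%E. Proof. exact: conj_p_ge1 pq. Qed.

(** The largest integer strictly below delta b, because the spectra of admissible polynomials are
    given by a strict inequality. *)
Definition nba nu i : nat := (`|Num.ceil (delta * (b nu i)%:R)|%N).-1.
(** Chosen so that a + N is b / 2 rounded up. Frequencies below it satisfy 2 |l i| < b and thus lie
    in the half-open cell for either sign of the dilation. *)
Definition nbN nu i : nat := (uphalf (b nu i) - nba nu i)%N.

Lemma leq_nba nu i (k : nat) : (k <= nba nu i)%N = (k%:R < delta * (b nu i)%:R).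
Proof.
have x0 : 0 < delta * (b nu i)%:R by rewrite mulr_gt0// ltr0n.
have c0 : 0 < Num.ceil (delta * (b nu i)%:R) by rewrite ceil_gt_int.
have -> : (k%:R < delta * (b nu i)%:R) = (k%:Z < Num.ceil (delta * (b nu i)%:R)).
  by rewrite ceil_gt_int.
by rewrite /nba; move: (Num.ceil _) c0 => z; lia.
Qed.

Lemma nba_lt nu i : (nba nu i < uphalf (b nu i))%N.
Proof.
have : (nba nu i)%:R < delta * (b nu i)%:R by rewrite -leq_nba.
have b0 := b_gt0 nu i.
have bR : 0 < (b nu i)%:R :> R by rewrite ltr0n.
move=> h; have : (2 * nba nu i)%:R < (b nu i)%:R :> R.
  by rewrite natrM; have dl := delta_lt; nra.
by rewrite ltr_nat uphalf_half; lia.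
Qed.

Lemma nbN_gt0 nu i : (0 < nbN nu i)%N.
Proof. by rewrite subn_gt0 nba_lt. Qed.

(** The quotient of the bounds N + 2a <= 2b and N >= (1/2 - delta) b; positivity of the denominator
    is the condition delta < 1/2. *)
Definition nb_mass : R := 2 / (2^-1 - delta).

Lemma nb_mass_ge1 : 1 <= nb_mass.
Proof.
by have := delta_gt0; have := delta_lt => h1 h2; rewrite ler_pdivlMr; lra.
Qed.

Lemma nbN_mass nu i : (nbN nu i + 2 * nba nu i)%:R <= nb_mass * (nbN nu i)%:R.
Proof.
have dl := delta_lt; have d0 := delta_gt0; have h := nba_lt nu i.
have h1 : (nba nu i)%:R < delta * (b nu i)%:R by rewrite -leq_nba.
have h2 : (2 * (nbN nu i + nba nu i))%:R >= (b nu i)%:R :> R.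
  by rewrite ler_nat /nbN subnK ?(ltnW h)// uphalf_half; lia.
have h3 : (nbN nu i + 2 * nba nu i)%:R <= 2 * (b nu i)%:R :> R.
  by rewrite -natrM ler_nat; have := b_gt0 nu i; move: h; rewrite /nbN uphalf_half; lia.
apply: le_trans h3 _; rewrite mulrAC ler_pdivlMr; last by lra.
rewrite -mulrA ler_wpM2l//.
by move: h2; rewrite natrM natrD; lra.
Qed.

Definition nbI nu := vpI (nba nu) (nbN nu).
Definition nbJ nu := vpJ (nbN nu).
Definition nbsum nu f := vpsum (nbI nu) (nbJ nu) f.
Local Notation eta nu := (vpcoef R (nbI nu) (nbJ nu)).
Local Notation supp nu := (vpsupp (nbI nu) (nbJ nu)).

Lemma nb_vpmass nu : vpmass R (nbI nu) (nbJ nu) <= nb_mass ^+ d.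
Proof. exact: vpmass_box_le (nbN_gt0 nu) nb_mass_ge1 (nbN_mass nu). Qed.

Lemma nbcoef_eq1 nu l :
  (forall i, (`|l i ord0|%N)%:R < delta * (b nu i)%:R) -> eta nu l = 1.
Proof.
by move=> h; apply: vpcoef_box_eq1 => [|i]; [exact: nbN_gt0|rewrite leq_nba].
Qed.

Lemma nbcoef_neq0 nu l : eta nu l != 0 -> forall i, (2 * `|l i ord0| < b nu i)%N.
Proof.
move=> /vpcoef_box_neq0 h i; have := h i; rewrite addnC /nbN subnK ?(ltnW (nba_lt _ _))//.
by rewrite uphalf_half; lia.
Qed.

Lemma half_ingrid nu l : (forall i, (2 * `|l i ord0| < b nu i)%N) ->
  ingrid R (dgrid M nu) l.
Proof.
move=> h; apply/ingridP => i; rewrite mxE.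
have hl : 2 * `|(l i ord0)%:~R| < `|(dgrid M nu i)%:~R| :> R.
  by rewrite -!intr_norm -[2]/(2%:~R) -intrM ltr_int; have := h i; lia.
have n0 : 0 < `|(dgrid M nu i)%:~R| :> R by apply: le_lt_trans hl; rewrite mulr_ge0.
have : `|(l i ord0)%:~R / (dgrid M nu i)%:~R| < 2^-1 :> R.
  by rewrite normrM normfV ltr_pdivrMr//; lra.
by rewrite ltr_norml => /andP[? ?]; apply/andP; split; [exact: ltW|].
Qed.

Lemma approximant_coord nu T l : approximant (delta *: Mpow M nu) T ->
  fourier T l != 0 -> forall i, (`|l i ord0|%N)%:R < delta * (b nu i)%:R.
Proof.
move=> [_ sT] /sT /= h i; have := le_lt_trans (enorm_ge_coord _ i) h.
rewrite (scaled_MpowN_mul M_diag M_dil) ?gt_eqF// mxE normrM normfV normrM.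
rewrite (gtr0_norm delta_gt0) -!intr_norm -!abszE.
by rewrite ltr_pdivrMr ?mul1r// mulr_gt0// ltr0n.
Qed.

Lemma trigpoly_nbsum nu f : trigpoly (nbsum nu f).
Proof. exact: trigpoly_trigsum. Qed.

Lemma nbsum_id nu T : approximant (delta *: Mpow M nu) T -> nbsum nu T = T.
Proof.
move=> hT; have [s [us TE _]] := trigpolyP hT.1.
rewrite TE; apply: vpsum_id => // l _ cl; apply: nbcoef_eq1.
exact: approximant_coord hT cl.
Qed.

Lemma nbsumB nu f g : cintegrable f -> cintegrable g ->
  (fun x => nbsum nu f x - nbsum nu g x) = nbsum nu (fun x => f x - g x).
Proof.
move=> fi gi; rewrite /nbsum /vpsum trigsumB; apply: eq_trigsum => l _ /=.
by rewrite fourierB// mulrBr.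
Qed.

Lemma nbsum_dualbound nu f : cmeasurable f -> (Lpnorm p f < +oo)%E ->
  dualbound q (nbsum nu f) (nb_mass ^+ d * pnorm p f).
Proof.
move=> mf fp; apply: (vpsum_dualbound pq) => //; try exact: box_uniq.
  by rewrite size_box prodn_gt0// => i; exact: nbN_gt0.
exact: nb_vpmass.
Qed.

Lemma nb_mass_exp_ge0 : 0 <= nb_mass ^+ d.
Proof. by rewrite exprn_ge0// (le_trans ler01 nb_mass_ge1). Qed.

Lemma nbsum_Lpnorm nu f : cmeasurable f -> (Lpnorm p f < +oo)%E ->
  (Lpnorm p (nbsum nu f) <= (nb_mass ^+ d)%:E * Lpnorm p f)%E.
Proof.
move=> mf fp; rewrite (pnormE fp) -EFinM; apply: (dualbound_Lpnorm pq).
- exact: bperiodic_trigsum.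
- by rewrite mulr_ge0 ?pnorm_ge0 ?nb_mass_exp_ge0.
- exact: nbsum_dualbound.
Qed.

Lemma LpnormB_lty f T : cmeasurable f -> (Lpnorm p f < +oo)%E -> bperiodic T ->
  (Lpnorm p (fun x => f x - T x)%R < +oo)%E.
Proof.
move=> mf fp bT; have [mN _ _] := bperiodicN bT.
apply: le_lt_trans (Lpnorm_triangle p_ge1 mf mN) _.
rewrite lte_add_pinfty// LpnormN; apply: bperiodic_Lpnorm => //.
exact: lt_le_trans lte01 p_ge1.
Qed.

(** With V the kernel operator and T any approximant, V T = T gives f - V f = (f - T) - V (f -
    T). *)
Lemma nbsum_near_best nu f : cmeasurable f -> (Lpnorm p f < +oo)%E ->
  (Lpnorm p (fun x => f x - nbsum nu f x)%R <=
    (1 + nb_mass ^+ d)%:E * bestapprox (delta *: Mpow M nu) p f)%E.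
Proof.
move=> mf fp; rewrite -[leRHS]add0e; apply: le_bestapprox => [|T hT].
  by rewrite addr_ge0 ?nb_mass_exp_ge0.
rewrite add0e; have bT := trigpoly_bperiodic hT.1; have [mT _ _] := bT.
have hp := LpnormB_lty mf fp bT; have mh := cmeasurableB mf mT.
have fi := Lp_cintegrable pq mf fp.
have -> : (fun x => f x - nbsum nu f x) =
    fun x => (f x - T x) + - nbsum nu (fun x => f x - T x) x.
  apply/funext => x; rewrite -nbsumB//; last exact: bperiodic_cintegrable.
  by rewrite (nbsum_id hT); ring.
have bV : bperiodic (nbsum nu (fun x => f x - T x)) by exact: bperiodic_trigsum.
have [mV _ _] := bperiodicN bV.
apply: le_trans (Lpnorm_triangle p_ge1 mh mV) _.
rewrite EFinD ge0_muleDl ?lee_fin ?nb_mass_exp_ge0// mul1e leeD2l// LpnormN.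
exact: nbsum_Lpnorm.
Qed.

(** Near-best sequences exist; without one, the condition in [distpair] would hold for every
    value. *)
Lemma near_best_nbsum f : inLp p f ->
  near_best M delta (1 + nb_mass ^+ d) p f (fun nu => nbsum nu f).
Proof.
move=> [mf pf fp] nu; split; [exact: trigpoly_nbsum| |exact: nbsum_near_best].
move=> l; rewrite /spec /= fourier_trigsum ?vpsupp_uniq//.
case: ifPn => _; last by rewrite eqxx.
move=> h; apply/(D_ingrid M_diag M_dil)/half_ingrid/nbcoef_neq0.
by apply: contraNneq h => ->; rewrite mul0r.
Qed.

End near_best_approximation.

(** * Synthesis from grid translates of an L_q function *)

Section grid_synthesis.
Variables (R : realType) (d : nat) (n : 'I_d -> int) (q : R) (g : 'cV[R]_d -> R[i]).
Hypotheses (n_neq0 : forall i, n i != 0) (q_ge1 : 1 <= q).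
Hypotheses (mg : cmeasurable g) (pg : Zperiodic g).
Local Notation P := (@torus_prob R d).
Local Notation gseq := (gridseq R n).
Local Notation gpt := (gridpt R n).
Local Notation Ninv := ((size gseq)%:R^-1 : R).
Implicit Types (H : 'cV[int]_d -> R[i]) (x t : 'cV[R]_d).

Let q_gt0 : 0 < q. Proof. exact: lt_le_trans ltr01 q_ge1. Qed.
Let N_gt0 : 0 < (size gseq)%:R :> R. Proof. by rewrite ltr0n size_gridseq_gt0. Qed.
Let Ninv_ge0 : 0 <= Ninv. Proof. by rewrite invr_ge0. Qed.

Definition gridavg x : R := Ninv * \sum_(k <- gseq) normc (g (x - gpt k)).

(** The integral behind [Lqjnorm], spread from one cell over the whole torus. Since [gridavg] is
    invariant under the grid, it is at most the number of cells times the integral over one cell. *)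
Definition gridint : \bar R := (\int[P]_x ((gridavg x) `^ q)%:E)%E.

Lemma gridavg_ge0 x : 0 <= gridavg x.
Proof. by rewrite mulr_ge0//; apply: sumr_ge0 => k _; exact: normc_ge0. Qed.

Lemma gridavg_shift x v : gridavg (x + gpt v) = gridavg x.
Proof.
congr (_ * _); rewrite -[RHS](sum_grid_shift R n_neq0 (- v)) => [|k w].
  by apply: eq_bigr => k _; rewrite gridptD gridptN opprD opprK addrA addrAC.
rewrite gridptD gridpt_mul// opprD addrA -[- toR w](toRN R).
by rewrite pg.
Qed.

Lemma measurable_gridavg : measurable_fun [set: 'cV[R]_d] gridavg.
Proof.
apply: measurable_funM; first exact: measurable_cst.
apply: measurable_sum => k; apply: measurable_normc; exact: cmeasurable_shift.
Qed.

Let measurable_gridavg_powR r :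
  measurable_fun [set: 'cV[R]_d] (fun x => gridavg x `^ r).
Proof. exact: (measurableT_comp (measurable_powR r) measurable_gridavg). Qed.

Let wt k t := Ninv * normc (g (t - gpt k)).

Let wt_ge0 k t : 0 <= wt k t.
Proof. by rewrite mulr_ge0 ?normc_ge0. Qed.

Let sum_wt t : \sum_(k <- gseq) wt k t = gridavg t.
Proof. by rewrite -mulr_sumr. Qed.

Definition gridsynth H t : R[i] := Ninv%:C * \sum_(k <- gseq) H k * g (t - gpt k).

Lemma cmeasurable_gridsynth H : cmeasurable (gridsynth H).
Proof.
apply: cmeasurableM; first exact: cmeasurable_cst.
apply: cmeasurable_sum => k; apply: cmeasurableM; first exact: cmeasurable_cst.
exact: cmeasurable_shift.
Qed.

(** Jensen's inequality with the weights [wt k t], whose sum is [gridavg t]. *)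
Lemma normc_gridsynth H t :
  normc (gridsynth H t) `^ q <=
  \sum_(k <- gseq) normc (H k) `^ q * (gridavg t `^ (q - 1) * wt k t).
Proof.
have h : normc (gridsynth H t) <= \sum_(k <- gseq) wt k t * normc (H k).
  rewrite /gridsynth normcM normc_realC ger0_norm//.
  apply: le_trans (ler_wpM2l Ninv_ge0 (normc_sum _ _ _)) _.
  rewrite mulr_sumr; apply: ler_sum => k _.
  by rewrite normcM /wt -mulrA [X in _ * X]mulrC.
have S0 : 0 <= \sum_(k <- gseq) wt k t * normc (H k).
  by apply: sumr_ge0 => k _; rewrite mulr_ge0 ?normc_ge0.
apply: (@le_trans _ _ ((\sum_(k <- gseq) wt k t * normc (H k)) `^ q)).
  by rewrite ge0_ler_powR ?nnegrE ?normc_ge0 ?(ltW q_gt0).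
(* Jensen requires a positive total weight; if the total is 0, every single weight vanishes. *)
have [G0|G0] := eqVneq (gridavg t) 0.
  rewrite big_seq big1 => [|k kg].
    rewrite powR0 ?gt_eqF//; apply: sumr_ge0 => k _.
    by rewrite mulr_ge0 ?powR_ge0// mulr_ge0 ?powR_ge0.
  suff -> : wt k t = 0 by rewrite mul0r.
  apply/eqP; rewrite eq_le wt_ge0 andbT -G0 -sum_wt (bigD1_seq k) ?gridseq_uniq//=.
  by rewrite lerDl; apply: sumr_ge0.
have Gp : 0 < gridavg t by rewrite lt0r G0 gridavg_ge0.
have := sum_jensen (r := gseq) (u := fun k => normc (H k)) q_ge1 Gp (wt_ge0 ^~ t)
  (fun k => normc_ge0 _).
rewrite sum_wt => /(_ (lexx _)) /le_trans; apply.
by rewrite mulr_sumr; apply: ler_sum => k _; rewrite mulrA mulrC.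
Qed.

(* All the weights [gridavg ^ (q - 1) * wt k] have the same integral, because
   they are translates of each other along the grid. *)
Lemma integral_gridsynth H :
  (\int[P]_x ((normc (gridsynth H x)) `^ q)%:E <=
    (Ninv * \sum_(k <- gseq) normc (H k) `^ q)%:E * gridint)%E.
Proof.
pose F k x : \bar R := (gridavg x `^ (q - 1) * wt k x)%:E.
have mF k : measurable_fun [set: 'cV[R]_d] (F k).
  apply/measurable_EFinP; apply: measurable_funM => //.
  apply: measurable_funM; first exact: measurable_cst.
  by apply: measurable_normc; exact: cmeasurable_shift.
have F0 k x : (0 <= F k x)%E by rewrite lee_fin mulr_ge0 ?powR_ge0.
pose a := (\int[P]_x F (0 : 'cV[int]_d)%R x)%E.
have a0 : (0 <= a)%E by exact: integral_ge0.
have Fa k : (\int[P]_x F k x = a)%E.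
  rewrite /a -(torus_integral_shift (- gpt k) (mF 0)) => [|x|x v].
  - apply: eq_integral => x _; rewrite /F /wt -gridptN gridavg_shift.
    by rewrite (_ : gpt 0 = 0) ?subr0 ?gridptN//; apply/colP => i; rewrite !mxE mul0r.
  - exact: F0.
  - by rewrite /F /wt -{1}(gridpt_mul R n_neq0 v) gridavg_shift addrAC pg.
(* Summing the equal integrals over the grid restores [gridavg ^ q], since the weights add up to
   [gridavg]. *)
have NaE : ((size gseq)%:R%:E * a = gridint)%E.
  transitivity (\sum_(k <- gseq) \int[P]_x F k x)%E.
    under eq_bigr do rewrite Fa.
    elim: gseq => [|k r IH]; first by rewrite big_nil mul0e.
    by rewrite big_cons -IH /= -natr1 addrC EFinD ge0_muleDl ?lee_fin// mul1e.
  rewrite -ge0_integral_sum//; apply: eq_integral => x _; rewrite sumEFin; congr EFin.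
  by rewrite -mulr_sumr sum_wt mulrC mulr_powRB1 ?gridavg_ge0.
apply: (@le_trans _ _ (\int[P]_x \sum_(k <- gseq) ((normc (H k) `^ q)%:E * F k x))%E).
  apply: ge0_le_integral => //.
  - by move=> x _; rewrite lee_fin powR_ge0.
  - by apply: measurable_powR_normcE; exact: cmeasurable_gridsynth.
  - by apply: emeasurable_sum => k; apply: measurable_funeM.
  - move=> x _; under eq_bigr do rewrite -EFinM.
    by rewrite sumEFin lee_fin; exact: normc_gridsynth.
rewrite ge0_integral_sum//; last 2 first.
- by move=> k; apply: measurable_funeM.
- by move=> k x _; rewrite mule_ge0// lee_fin powR_ge0.
under eq_bigr => k _.
  rewrite ge0_integralZl_EFin//; last by rewrite powR_ge0.
  rewrite Fa; over.
rewrite -NaE muleA -EFinM mulrAC mulVf ?mul1r ?gt_eqF//.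
rewrite -ge0_sume_distrl; last by move=> k _; rewrite lee_fin powR_ge0.
by rewrite sumEFin.
Qed.

Lemma gridint_cell : (forall i, (2 <= `|n i|)%N) ->
  (gridint <= (size gseq)%:R%:E * \int[P]_(x in gridcell n) ((gridavg x) `^ q)%:E)%E.
Proof.
move=> n2; apply: (ge0_integral_gridcell n_neq0 n2).
- exact/measurable_EFinP.
- by move=> x; rewrite lee_fin powR_ge0.
- by move=> x v; rewrite gridavg_shift.
Qed.

Lemma Lpnorm_gridsynth H (lam : R) : 0 <= lam -> (gridint <= (lam `^ q)%:E)%E ->
  (Lpnorm q%:E (gridsynth H) <=
    (lam * (Ninv * \sum_(k <- gseq) normc (H k) `^ q) `^ q^-1)%:E)%E.
Proof.
move=> lam0 hl; set X := Ninv * _.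
have X0 : 0 <= X by rewrite mulr_ge0//; apply: sumr_ge0 => k _; exact: powR_ge0.
have h : (Lqint q (gridsynth H) <= (X * lam `^ q)%:E)%E.
  apply: le_trans (integral_gridsynth H) _.
  by rewrite -/X (EFinM X); apply: lee_wpmul2l => //; rewrite lee_fin.
rewrite Lpnorm_fin; apply: (@le_trans _ _ ((X * lam `^ q)%:E `^ q^-1)%E).
  rewrite gt0_ler_poweR ?invr_ge0 ?(ltW q_gt0) ?in_itv/= ?leey ?andbT ?Lqint_ge0 ?lee_fin//.
  by rewrite mulr_ge0 ?powR_ge0.
by rewrite poweR_EFin powRM ?powR_ge0// -powRrM mulfV ?gt_eqF// powRr1// mulrC.
Qed.

End grid_synthesis.

(** * Characters as smooth test functions *)

Section smooth_characters.
Variables (R : realType) (d : nat).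
Implicit Types (k : 'cV[int]_d) (x v : 'cV[R]_d) (i : 'I_d) (z : R[i]).

Lemma is_derive_line (f : 'cV[R]_d -> R) x v (df : R) :
  is_derive (0 : R) 1 (fun h : R => f (h *: v + x)) df -> is_derive x v f df.
Proof.
move=> hd.
have e : (fun h : R => h^-1 *: ((f \o shift x) (h *: v) - f x)) =
    fun h : R => h^-1 *: (((fun h : R => f (h *: v + x)) \o shift 0) (h *: (1 : R)) -
      f (0 *: v + x)).
  by apply/funext => h /=; rewrite addr0 scale0r add0r [h *: 1]mulr1.
have hdv := @ex_derive _ _ _ _ _ _ _ hd; have hv := @derive_val _ _ _ _ _ _ _ hd.
split; first by rewrite /derivable e; exact: hdv.
by rewrite -hv /derive e.
Qed.

Lemma is_derive_wave (a b c e h : R) :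
  is_derive h 1 (fun h : R => a * cos (c + e * h) + b * sin (c + e * h))
    (a * (- sin (c + e * h) * e) + b * (cos (c + e * h) * e)).
Proof.
have ha : is_derive h 1 (fun h : R => c + e * h) e.
  have -> : (fun h : R => c + e * h) = cst c + (e \*: (@id R)) by apply/funext => u /=.
  by apply: is_derive_eq; rewrite add0r -[RHS]mulr1.
exact: (is_deriveD (is_deriveZ a (is_derive1_comp (is_derive_cos _) ha))
  (is_deriveZ b (is_derive1_comp (is_derive_sin _) ha))).
Qed.

(** Scalar multiples of a character are closed under partial derivatives, which handles all iterated
    derivatives at once. *)
Definition wave z k x : R[i] := z * character k x.

Let ReW z k x : complex.Re (wave z k x) = complex.Re z * cos (2 * pi * dotp (toR k) x) +
  (- complex.Im z) * sin (2 * pi * dotp (toR k) x).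
Proof. by case: z => a b; rewrite mulNr. Qed.

Let ImW z k x : complex.Im (wave z k x) = complex.Im z * cos (2 * pi * dotp (toR k) x) +
  complex.Re z * sin (2 * pi * dotp (toR k) x).
Proof. by case: z => a b; rewrite [RHS]addrC. Qed.

Let dotp_line k i x (h : R) : 2 * pi * dotp (toR k) (h *: delta_mx i ord0 + x) =
  2 * pi * dotp (toR k) x + 2 * pi * (k i ord0)%:~R * h.
Proof.
suff -> : dotp (toR k) (h *: delta_mx i ord0 + x) = (k i ord0)%:~R * h + dotp (toR k) x.
  by ring.
rewrite /dotp; under eq_bigr => l _ do rewrite [X in _ * X]mxE mulrDr.
rewrite big_split/=; congr (_ + _); rewrite (bigD1 i)//= big1 ?addr0.
  by rewrite !mxE !eqxx mulr1.
by move=> l /negbTE li; rewrite !mxE li /= !mulr0.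
Qed.

Let dwave z k i x (e := 2 * pi * (k i ord0)%:~R) (c := 2 * pi * dotp (toR k) x) :
  is_derive x (delta_mx i ord0) (fun y => complex.Re (wave z k y))
    (complex.Re z * (- sin c * e) + (- complex.Im z) * (cos c * e)) /\
  is_derive x (delta_mx i ord0) (fun y => complex.Im (wave z k y))
    (complex.Im z * (- sin c * e) + complex.Re z * (cos c * e)).
Proof.
have hd a b := is_derive_wave a b c e 0; rewrite mulr0 addr0 in hd.
split; apply: is_derive_line.
  rewrite (_ : (fun h => _) = fun h => complex.Re z * cos (c + e * h) +
    - complex.Im z * sin (c + e * h)); first exact: hd.
  by apply/funext => h; rewrite ReW dotp_line.
rewrite (_ : (fun h => _) = fun h => complex.Im z * cos (c + e * h) +
  complex.Re z * sin (c + e * h)); first exact: hd.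
by apply/funext => h; rewrite ImW dotp_line.
Qed.

Lemma partial_wave z k i : partial i (wave z k) = wave (z * (0 +i* (2 * pi * (k i ord0)%:~R))) k.
Proof.
apply/funext => x; rewrite /partial; have [dr di] := dwave z k i x.
rewrite (@derive_val _ _ _ _ _ _ _ dr) (@derive_val _ _ _ _ _ _ _ di).
apply/eqP; rewrite eq_complex ReW ImW; case: z {dr di} => a b /=.
by apply/andP; split; apply/eqP; ring.
Qed.

Lemma partials_wave z k (s : seq 'I_d) : exists z', partials s (wave z k) = wave z' k.
Proof.
elim: s => [|i s [z' e]]; first by exists z.
by exists (z' * (0 +i* (2 * pi * (k i ord0)%:~R))); rewrite /= e partial_wave.
Qed.

Let continuous_dotp k : continuous (fun x => 2 * pi * dotp (toR k) x).
Proof.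
move=> x.
have h : continuous (fun y : 'cV[R]_d => dotp (toR k) y).
  apply: continuous_big => [|l _ y]; first exact: add_continuous.
  exact: (cvgM (cvg_cst (toR k l ord0)) (@coord_continuous R d 1 l ord0 y)).
exact: (cvgM (cvg_cst (2 * pi)) (h x)).
Qed.

Lemma ccontinuous_wave z k : ccontinuous (wave z k).
Proof.
have cc a b : continuous (fun x => a * cos (2 * pi * dotp (toR k) x) +
    b * sin (2 * pi * dotp (toR k) x)).
  move=> x; have hd : {for x, continuous (fun y : 'cV[R]_d => 2 * pi * dotp (toR k) y)} by exact: continuous_dotp.
  have hc := continuous_comp hd (@continuous_cos R _).
  have hs := continuous_comp hd (@continuous_sin R _).
  exact: (cvgD (cvgM (cvg_cst a) hc) (cvgM (cvg_cst b) hs)).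
split; first by under eq_fun do rewrite ReW; exact: cc.
by under eq_fun do rewrite ImW; exact: cc.
Qed.

Lemma testfun_character k : testfun (@character R d k).
Proof.
have -> : character k = wave 1 k by apply/funext => x; rewrite /wave mul1r.
split=> [x l|s]; first by rewrite /wave Zperiodic_character.
have [z ->] := partials_wave 1 k s; split; first exact: ccontinuous_wave.
move=> i x; have [dr di] := dwave z k i x.
by split; [exact: (@ex_derive _ _ _ _ _ _ _ dr)|exact: (@ex_derive _ _ _ _ _ _ _ di)].
Qed.

(** The relation [induced_by] speaks of smooth test functions only, so the smoothness of characters
    is what allows the comparison. *)
Lemma dfourier_induced (g : 'cV[R]_d -> R[i]) (u : ('cV[R]_d -> R[i]) -> R[i]) k :
  induced_by g u -> dfourier u k = fourier g k.
Proof. by move=> h; rewrite /dfourier h//; exact: testfun_character. Qed.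

End smooth_characters.

(** * Polynomials of level nu sampled at level j *)

Section sampled_trigonometric_polynomials.
Variables (R : realType) (d : nat) (M : 'M[int]_d) (p : \bar R) (q N CS : R) (A : nat).
Variables (phi : nat -> 'cV[R]_d -> R[i]) (phit : nat -> ('cV[R]_d -> R[i]) -> R[i]).
Hypotheses (M_diag : is_diag_mx M) (M_dil : @dilation R d M).
Hypothesis pq : conjugate_exponents p q.
Hypothesis phi_trig : forall j, (0 < j)%N -> trigpoly (phi j).
Hypothesis phi_supp : forall j l, (0 < j)%N -> fourier (phi j) l != 0 ->
  forall i, (`|l i ord0| <= A * `|dgrid M j i|)%N.
Hypothesis phit_S : forall (j n : nat) T, (0 < j)%N -> (j <= n)%N -> trigpoly T ->
  spec T `<=` [set k | enorm (@MpowN R d M n *m toR k) <= 1] ->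
  (Lpnorm p (Defs.conv T (phit j))
    <= (CS * absdet M `^ (N / d%:R * (n%:R - j%:R)))%:E * Lpnorm p T)%E.
Implicit Types (j nu : nat) (i : 'I_d) (f g T : 'cV[R]_d -> R[i]) (k l : 'cV[int]_d).
Implicit Types (s : seq 'cV[int]_d) (c : 'cV[int]_d -> R[i]).
Local Notation m := (@absdet R d M).
Local Notation b nu i := (`|dgrid M nu i|%N).
Local Notation gseq j := (gridseq R (dgrid M j)).
Local Notation gpt j := (gridpt R (dgrid M j)).
Local Notation K j := (Kphi q (phi j)).
Local Notation al := (1 - q^-1 + N / d%:R).

Let q_ge1 : 1 <= q. Proof. exact: conj_q_ge1 pq. Qed.
Let q_gt0 : 0 < q. Proof. exact: lt_le_trans ltr01 q_ge1. Qed.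
Let p_gt0 : (0 < p)%E. Proof. exact: lt_le_trans lte01 (conj_p_ge1 pq). Qed.
Let m_gt0 : 0 < m. Proof. exact: absdet_gt0 M_diag M_dil. Qed.
Let n_neq0 j i : dgrid M j i != 0. Proof. exact: (dgrid_neq0 M_diag M_dil). Qed.

(** The class S' is tested on Euclidean balls, whereas the spectra here lie in boxes. After d
    further dilations each coordinate is at most 2^-d in modulus, and d <= 2^d. *)
Lemma enorm_coarse nu l : (forall i, (`|l i ord0| <= b nu i)%N) ->
  enorm (@MpowN R d M (nu + d) *m toR l) <= 1.
Proof.
move=> h; apply: le_trans (enorm_le_sum _) _.
apply: (@le_trans _ _ (\sum_(i < d) (2 ^ d)%:R^-1)); last first.
  rewrite sumr_const card_ord -[_ *+ d]mulr_natl ler_pdivrMr ?ltr0n ?expn_gt0//.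
  by rewrite mul1r ler_nat ltnW// ltn_expl.
apply: ler_sum => i _; rewrite (MpowN_mul M_diag M_dil) mxE normrM normfV -!intr_norm -!abszE.
have bE : b (nu + d) i = (b nu i * `|M i i| ^ d)%N.
  by rewrite !abs_dgrid expnD.
have b0 : (0 < b nu i)%N by rewrite absz_gt0.
have M2 : (2 ^ d <= `|M i i| ^ d)%N.
  rewrite leq_exp2r ?(leq_ltn_trans (leq0n i) (ltn_ord i))//.
  exact: (dilation_entry_ge2 M_diag M_dil).
rewrite ler_pdivrMr; last by rewrite ltr0n absz_gt0.
rewrite bE ler_pdivlMl ?ltr0n ?expn_gt0// -natrM ler_nat mulnC.
exact: leq_mul.
Qed.

(** The second factor pays for the d extra levels at which the class S' is applied; the absolute
    value makes the constant nonnegative. *)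
Definition phit_cst : R := `|CS| * m `^ (N / d%:R * d%:R).

Lemma phit_cst_ge0 : 0 <= phit_cst.
Proof. by rewrite mulr_ge0 ?powR_ge0. Qed.

(* T * conj(phit) is the reflection of (T reflected) * phit. *)
Lemma phit_conj_bound j nu s c : (0 < j)%N -> (j <= nu)%N -> uniq s ->
  (forall l, l \in s -> c l != 0 -> forall i, (`|l i ord0| <= b nu i)%N) ->
  pnorm p (trigsum s (fun l => c l * (dfourier (phit j) l)^*)) <=
    phit_cst * m `^ (N / d%:R * (nu%:R - j%:R)) * pnorm p (trigsum s c).
Proof.
move=> j0 jnu us hc; set F := trigsum s c.
have bF : bperiodic F by exact: bperiodic_trigsum.
have Fp : (Lpnorm p F < +oo)%E by exact: bperiodic_Lpnorm.
have cE : Defs.conv (creflect F) (phit j) = trigsum s (fun l => (c l)^* * dfourier (phit j) l).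
  apply/funext => x; rewrite /Defs.conv creflect_trigsum (fsum_seq us).
    by apply: eq_big_seq => l ls; rewrite fourier_trigsum// ls.
  by move=> l /negbTE ls; rewrite fourier_trigsum// ls !mul0r.
have -> : trigsum s (fun l => c l * (dfourier (phit j) l)^*) =
    creflect (Defs.conv (creflect F) (phit j)).
  by rewrite cE creflect_trigsum; apply: eq_trigsum => l _; rewrite conjCM conjCK.
have bcv : bperiodic (Defs.conv (creflect F) (phit j)) by rewrite cE; exact: bperiodic_trigsum.
have sC : spec (creflect F) `<=` [set k | enorm (@MpowN R d M (nu + d) *m toR k) <= 1].
  move=> l; rewrite /spec /= fourier_creflect// fourier_trigsum//.
  case: ifPn => [ls|_]; last by rewrite conjC0 eqxx.
  rewrite conjC_eq0 => cl; apply: enorm_coarse; exact: hc.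
have tC : trigpoly (creflect F) by rewrite creflect_trigsum; exact: trigpoly_trigsum.
have := phit_S j0 (leq_trans jnu (leq_addr d nu)) tC sC => h.
rewrite -lee_fin EFinM -!pnormE//; last first.
  by apply: bperiodic_Lpnorm => //; exact: bperiodic_creflect.
apply: le_trans (Lpnorm_creflect_le pq bcv) _; apply: le_trans h _.
apply: (@le_trans _ _ ((phit_cst * m `^ (N / d%:R * (nu%:R - j%:R)))%:E *
   Lpnorm p (creflect F))%E); last first.
  apply: lee_wpmul2l; last exact: Lpnorm_creflect_le pq bF.
  by rewrite lee_fin mulr_ge0 ?powR_ge0 ?phit_cst_ge0.
rewrite lee_wpmul2r ?Lpnorm_ge0// lee_fin natrD addrAC mulrDr powRD; last first.
  by rewrite (gt_eqF m_gt0) implybT.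
rewrite /phit_cst -[leRHS]mulrA [X in _ <= _ * X]mulrC ler_wpM2r ?ler_norm//.
by rewrite mulr_ge0 ?powR_ge0.
Qed.

Let w j nu i := (`|M i i| ^ (nu - j))%N.

Let w_gt0 j nu i : (0 < w j nu i)%N.
Proof. by rewrite expn_gt0 (ltnW (dilation_entry_ge2 M_diag M_dil i)). Qed.

Let bE j nu i : (j <= nu)%N -> b nu i = (w j nu i * b j i)%N.
Proof. by move=> jnu; rewrite !abs_dgrid -expnD subnK. Qed.

(** The oversampling factor is m^(nu - j); together with the growth allowed by S' it yields the
    exponent 1/p + N/d. *)
Let prod_w j nu : (j <= nu)%N ->
  (\prod_i w j nu i)%:R `^ (1 - q^-1) * m `^ (N / d%:R * (nu%:R - j%:R)) =
  m `^ (al * (nu%:R - j%:R)).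
Proof.
move=> jnu; have -> : (\prod_i w j nu i)%:R = m `^ (nu%:R - j%:R).
  rewrite -natrB// powR_mulrn ?(ltW m_gt0)// absdetE// -natrX; congr _%:R.
  by rewrite (big_morph (expn^~ (nu - j)%N) (fun a b => expnMn a b _) (exp1n _)).
rewrite -powRrM -powRD; last by rewrite (gt_eqF m_gt0) implybT.
by apply: (congr1 (powR _)); ring.
Qed.

Let conj_supp nu j s c :
  (forall l, l \in s -> c l != 0 -> forall i, (`|l i ord0| <= b nu i)%N) ->
  forall l, l \in s -> c l * (dfourier (phit j) l)^* != 0 ->
    forall i, (`|l i ord0| <= b nu i)%N.
Proof.
by move=> h l ls hl; apply: h => //; apply: contraNneq hl => ->; rewrite mul0r.
Qed.

Definition Qop_cst : R := qproj_cst d q A * phit_cst.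

Lemma Qop_cst_ge0 : 0 <= Qop_cst.
Proof. by rewrite mulr_ge0 ?qproj_cst_ge0 ?phit_cst_ge0. Qed.

Lemma Qop_dualbound j nu s c : (0 < j)%N -> (j <= nu)%N -> uniq s ->
  (forall l, l \in s -> c l != 0 -> forall i, (`|l i ord0| <= b nu i)%N) ->
  dualbound q (Qop M j (trigpair M j (trigsum s c) (phit j)) (phi j))
    (Qop_cst * m `^ (al * (nu%:R - j%:R)) * K j * pnorm p (trigsum s c)).
Proof.
move=> j0 jnu us hc g bg.
have [r [ur phiE phi0]] := trigpolyP (phi_trig j0).
have -> : trigpair M j (trigsum s c) (phit j) =
    fun k => trigsum s (fun l => c l * (dfourier (phit j) l)^*) (gpt j k).
  by apply/funext => k; rewrite trigpairE.
rewrite QopE//.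
have h := qproj_sampled_bound pq (@n_neq0 j) ur phi0 phiE (fun l => phi_supp (l := l) j0)
  (@w_gt0 j nu) (fun i => bE i jnu) us bg (conj_supp (j := j) hc).
apply: le_trans h _.
rewrite ler_wpM2r ?qnorm_ge0// /Qop_cst -prod_w//.
rewrite [leRHS](_ : _ = qproj_cst d q A * (\prod_i w j nu i)%:R `^ (1 - q^-1) * K j *
  (phit_cst * m `^ (N / d%:R * (nu%:R - j%:R)) * pnorm p (trigsum s c))); last by ring.
rewrite ler_wpM2l ?phit_conj_bound//.
by rewrite !mulr_ge0 ?qproj_cst_ge0 ?powR_ge0// (Kphi_ge0 pq ur phi0).
Qed.

(** A single sample is isolated by taking H to be the indicator of k. The constant depends on j and
    serves the convergence of the samples as nu grows. *)
Lemma trigpair_bound j k : (0 < j)%N -> k \in gseq j -> exists2 C : R, 0 <= C &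
  forall nu s c, (j <= nu)%N -> uniq s ->
  (forall l, l \in s -> c l != 0 -> forall i, (`|l i ord0| <= b nu i)%N) ->
  normc (trigpair M j (trigsum s c) (phit j) k) <= C * m `^ (al * nu%:R) * pnorm p (trigsum s c).
Proof.
move=> j0 kg; set Sz : R := (size (gseq j))%:R.
have S0 : 0 < Sz by rewrite ltr0n size_gridseq_gt0.
pose C := Sz * (grid_pairing_cst d q * Sz^-1 `^ q^-1) * phit_cst * m `^ (al * - j%:R).
have C0 : 0 <= C by rewrite !mulr_ge0 ?powR_ge0 ?phit_cst_ge0// ltW.
have pick (V : nmodType) (F : 'cV[int]_d -> V) :
    (forall k', k' != k -> F k' = 0) -> \sum_(k' <- gseq j) F k' = F k.
  by move=> h; rewrite (bigD1_seq k) ?gridseq_uniq//= big1 ?addr0.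
exists C => // nu s c jnu us hc; rewrite trigpairE//.
set G := trigsum s _.
have := grid_pairing_bound pq (@n_neq0 j) us (@w_gt0 j nu) (fun i => bE i jnu)
  (fun k' => (k' == k)%:R) us (conj_supp hc (j := j)).
rewrite pick => [|k' /negbTE ->]; last by rewrite conjC0 mulr0.
rewrite pick => [|k' /negbTE ->]; last by rewrite normc0 powR0 ?gt_eqF ?invr_gt0.
rewrite eqxx conjC1 mulr1 normc1 powR1 mulr1 normcM normc_realC ger0_norm ?invr_ge0//.
rewrite -/Sz -/G ler_pdivrMl// => /le_trans; apply.
have hG := phit_conj_bound j0 jnu us hc; rewrite -/G in hG.
have mE : m `^ (al * - j%:R) * m `^ (al * nu%:R) = m `^ (al * (nu%:R - j%:R)).
  rewrite -powRD; last by rewrite (gt_eqF m_gt0) implybT.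
  by rewrite -mulrDr [- _ + _]addrC.
rewrite [leRHS](_ : _ = Sz * (grid_pairing_cst d q * (\prod_i w j nu i)%:R `^ (1 - q^-1) *
   (phit_cst * m `^ (N / d%:R * (nu%:R - j%:R)) * pnorm p (trigsum s c)) * Sz^-1 `^ q^-1)).
  rewrite ler_wpM2l ?(ltW S0)// ler_wpM2r ?powR_ge0// ler_wpM2l//.
  by rewrite mulr_ge0 ?powR_ge0.
by rewrite /C -[_ * m `^ (al * nu%:R)]mulrA mE -(prod_w jnu); ring.
Qed.

Variables (delta sm cw : R).
Hypothesis p_ge2 : (2%:E <= p)%E.
Hypotheses (delta_gt0 : 0 < delta) (delta_lt : delta < 2^-1) (sm_gt0 : 0 < sm).
Hypothesis phi_gap : forall j l v, (0 < j)%N ->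
  enorm (@MpowN R d M j *m toR l) < delta -> v != 0 ->
  fourier (phi j) (l + gridmul (dgrid M j) v) = 0.
Hypothesis compat : forall j l, (0 < j)%N -> D (@Mspow R d M j) l ->
  normc (1 - fourier (phi j) l * (dfourier (phit j) l)^*)
    <= cw * enorm (@MspowN R d M j *m toR l) `^ sm.
Local Notation eta j := (vpcoef R (nbI M delta j) (nbJ M delta j)).
Local Notation supp j := (vpsupp (nbI M delta j) (nbJ M delta j)).
Local Notation nb_cst := (nb_mass delta ^+ d).
Local Notation nbs := (nbsum M delta).

Let nb_cst_ge0 : 0 <= nb_cst.
Proof. exact: nb_mass_exp_ge0. Qed.

Lemma eta_le_dgrid j l : eta j l != 0 -> forall i, (`|l i ord0| <= b j i)%N.
Proof.
move=> h i; have := nbcoef_neq0 M_diag M_dil pq delta_gt0 delta_lt h i.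
by move: (`|_|%N) (`|_|%N) => u v; clear; lia.
Qed.

Lemma enorm_scaled_MpowN j (x : 'cV[R]_d) :
  enorm (invmx (delta *: Mpow M j) *m x) = delta^-1 * enorm (MpowN M j *m x).
Proof.
rewrite -[delta^-1]gtr0_norm ?invr_gt0// -enormZ; congr enorm; apply/colP => i.
rewrite (scaled_MpowN_mul M_diag M_dil) ?gt_eqF// [RHS]mxE (MpowN_mul M_diag M_dil).
by rewrite invfM; ring.
Qed.

(** T is first rewritten as its own kernel sum, so that the same weights eta appear here as in the
    kernel sum of f. The gap of the spectrum of phi around nonzero lattice points excludes
    aliasing. *)
Lemma Qop_approximant j T : (0 < j)%N -> approximant (delta *: Mpow M j) T ->
  Qop M j (trigpair M j T (phit j)) (phi j) =
  trigsum (supp j) (fun l => (eta j l)%:C * fourier T l * (dfourier (phit j) l)^* *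
    fourier (phi j) l).
Proof.
move=> j0 hT; have [r [ur phiE phi0]] := trigpolyP (phi_trig j0).
have TE : T = trigsum (supp j) (fun l => (eta j l)%:C * fourier T l).
  by rewrite -{1}(nbsum_id M_diag M_dil pq delta_gt0 delta_lt hT).
rewrite QopE// {1}TE.
have -> : trigpair M j (trigsum (supp j) (fun l => (eta j l)%:C * fourier T l)) (phit j) =
    fun k => trigsum (supp j)
      (fun l => (eta j l)%:C * fourier T l * (dfourier (phit j) l)^*) (gpt j k).
  by apply/funext => k; rewrite trigpairE ?vpsupp_uniq.
rewrite (qproj_multiplier (@n_neq0 j) ur phi0 phiE)// ?vpsupp_uniq// => l v _ hl v0.
apply: phi_gap => //.
have : fourier T l != 0 by apply: contraNneq hl => ->; rewrite mulr0 mul0r.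
move=> /(hT.2) /=; rewrite enorm_scaled_MpowN mulrC ltr_pdivrMr// mul1r.
exact.
Qed.

Lemma normc_compat j l : (0 < j)%N -> l \in gseq j ->
  normc (1 - fourier (phi j) l * (dfourier (phit j) l)^*) <=
    `|cw| * opnorm (@MpowN R d M j) `^ sm * (1 + enorm (toR l : 'cV[R]_d) ^+ 2) `^ (sm / 2).
Proof.
move=> j0 lg; have lD : D (@Mspow R d M j) l by rewrite MspowE// D_gridseq.
apply: le_trans (compat j0 lD) _; rewrite MspowNE// -mulrA.
apply: (@le_trans _ _ (`|cw| * enorm (MpowN M j *m (toR l : 'cV[R]_d)) `^ sm)).
  by rewrite ler_wpM2r ?powR_ge0 ?ler_norm.
have o0 : 0 <= opnorm (@MpowN R d M j) by exact: opnorm_ge0.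
have e0 := enorm_ge0 (toR l : 'cV[R]_d).
rewrite ler_wpM2l//; apply: (@le_trans _ _
  ((opnorm (@MpowN R d M j) * enorm (toR l : 'cV[R]_d)) `^ sm)).
  by rewrite ge0_ler_powR ?nnegrE ?(ltW sm_gt0) ?enorm_ge0 ?mulr_ge0 ?opnorm_le.
rewrite powRM// ler_wpM2l ?powR_ge0//.
have -> : enorm (toR l : 'cV[R]_d) `^ sm = (enorm (toR l : 'cV[R]_d) ^+ 2) `^ (sm / 2).
  rewrite -powR_mulrn// -powRrM; apply: (congr1 (powR _)).
  by rewrite mulrC divfK.
rewrite ge0_ler_powR ?nnegrE ?divr_ge0 ?(ltW sm_gt0) ?sqr_ge0//.
  by rewrite addr_ge0 ?sqr_ge0.
by rewrite lerDr.
Qed.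

Local Notation In j f := (opnorm (@MpowN R d M j) `^ sm * Innorm M q sm j f).

Lemma incompat_sum j f : (0 < j)%N ->
  (\sum_(l <- supp j) normc ((eta j l)%:C * fourier f l *
    (1 - fourier (phi j) l * (dfourier (phit j) l)^*)) `^ q) `^ q^-1 <=
  `|cw| * In j f.
Proof.
move=> j0; pose F l := normc ((eta j l)%:C * fourier f l *
  (1 - fourier (phi j) l * (dfourier (phit j) l)^*)) `^ q.
rewrite -/(\sum_(l <- supp j) F l).
have Fout l : eta j l = 0 -> F l = 0.
  by move=> e; rewrite /F e !mul0r normc0 powR0 ?gt_eqF.
(* Both lists contain all l with nonzero eta, the second because such l satisfy 2 |l i| < b. *)
have -> : \sum_(l <- supp j) F l = \sum_(l <- gseq j) F l.
  rewrite -!fsum_seq ?vpsupp_uniq ?gridseq_uniq// => l.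
    rewrite mem_gridseq// => h; apply: Fout; apply/eqP; apply: contraNT h => h.
    apply: (half_ingrid M_diag pq delta_gt0 delta_lt).
    exact: (nbcoef_neq0 M_diag M_dil pq delta_gt0 delta_lt).
  by move=> h; apply: Fout; exact: vpcoef_out.
set o := opnorm _ `^ sm.
have o0 : 0 <= o by exact: powR_ge0.
have X0 : 0 <= `|cw| * o by rewrite mulr_ge0.
have S0 : 0 <= \sum_(l <- gseq j) normc (fourier f l) `^ q *
    (1 + enorm (toR l : 'cV[R]_d) ^+ 2) `^ (sm * q / 2).
  by apply: sumr_ge0 => l _; rewrite mulr_ge0 ?powR_ge0.
have -> : `|cw| * (o * Innorm M q sm j f) = ((`|cw| * o) `^ q *
    \sum_(l <- gseq j) normc (fourier f l) `^ q *
    (1 + enorm (toR l : 'cV[R]_d) ^+ 2) `^ (sm * q / 2)) `^ q^-1.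
  rewrite powRM ?powR_ge0// -powRrM mulfV ?gt_eqF// powRr1// mulrA; congr (_ * _).
  by rewrite /Innorm MspowE// sum_D.
rewrite ge0_ler_powR ?nnegrE ?invr_ge0 ?(ltW q_gt0)//.
- by apply: sumr_ge0 => l _; exact: powR_ge0.
- by rewrite mulr_ge0 ?powR_ge0.
rewrite mulr_sumr [leLHS]big_seq [leRHS]big_seq; apply: ler_sum => l lg.
set Y := (1 + _) `^ _.
have YE : Y = ((1 + enorm (toR l : 'cV[R]_d) ^+ 2) `^ (sm / 2)) `^ q.
  by rewrite -powRrM; apply: (congr1 (powR _)); ring.
have f0 := normc_ge0 (fourier f l).
rewrite mulrCA YE -(powRM _ X0) ?powR_ge0// -(powRM _ f0); last by rewrite mulr_ge0 ?powR_ge0.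
rewrite /F ge0_ler_powR ?nnegrE ?(ltW q_gt0) ?normc_ge0//.
  by rewrite !mulr_ge0 ?powR_ge0.
rewrite !normcM normc_realC ger0_norm ?vpcoef_ge0//.
apply: ler_pM; rewrite ?mulr_ge0 ?normc_ge0 ?vpcoef_ge0//; last exact: normc_compat.
by rewrite ler_piMl ?vpcoef_le1.
Qed.

(* With h = f - T, V the operator nbsum and mu = 1 - phi^ conj(phit^),
   T - Q T = mu(V f) - V h + phi * conj(phit) * V h. *)
Lemma approximant_error : exists2 C : R, 0 <= C &
  forall j f T, (0 < j)%N -> cmeasurable f -> (Lpnorm p f < +oo)%E ->
  approximant (delta *: Mpow M j) T ->
  dualbound q (fun x => T x - Qop M j (trigpair M j T (phit j)) (phi j) x)
    (C * In j f + nb_cst * (1 + phit_cst * K j) * pnorm p (fun x => f x - T x)).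
Proof.
have [CH CH0 HY] := hausdorff_young d pq p_ge2.
exists (CH * `|cw|); first by rewrite mulr_ge0.
move=> j f T j0 mf fp hT.
have bT := trigpoly_bperiodic hT.1; have [mT _ _] := bT.
have [r [ur phiE phi0]] := trigpolyP (phi_trig j0).
set h := fun x => f x - T x.
have mh : cmeasurable h by exact: cmeasurableB.
have hp : (Lpnorm p h < +oo)%E by exact: (LpnormB_lty pq mf fp bT).
have fi := Lp_cintegrable pq mf fp.
pose mu l := 1 - fourier (phi j) l * (dfourier (phit j) l)^*.
pose F1 := trigsum (supp j) (fun l => (eta j l)%:C * fourier f l * mu l).
pose F3 := trigsum (supp j) (fun l =>
  (eta j l)%:C * fourier h l * (dfourier (phit j) l)^* * fourier (phi j) l).
have b1 : bperiodic F1 by exact: bperiodic_trigsum.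
have b2 : bperiodic (nbs j h) by exact: bperiodic_trigsum.
have b3 : bperiodic F3 by exact: bperiodic_trigsum.
have -> : (fun x => T x - Qop M j (trigpair M j T (phit j)) (phi j) x) =
    fun x => F1 x + (- nbs j h x + F3 x).
  rewrite (Qop_approximant j0 hT).
  rewrite -{1}(nbsum_id M_diag M_dil pq delta_gt0 delta_lt hT).
  rewrite trigsumB; apply/funext => x; rewrite /F1 /F3 /nbsum /vpsum /trigsum.
  rewrite -sumrN -!big_split/=; apply: eq_bigr => l _.
  rewrite /h fourierB//; last exact: bperiodic_cintegrable.
  by rewrite /mu; ring.
have D1 : dualbound q F1 (CH * `|cw| * In j f).
  apply: le_dualbound (pnorm_dualbound pq b1).
  rewrite -lee_fin -pnormE; last by apply: bperiodic_Lpnorm.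
  apply: le_trans (HY _ _ (vpsupp_uniq _ _)) _.
  by rewrite lee_fin -mulrA ler_wpM2l//; exact: incompat_sum.
have D2 : dualbound q (fun x => - nbs j h x) (nb_cst * pnorm p h).
  by apply: dualboundN => //; exact: (nbsum_dualbound M_diag M_dil pq delta_gt0 delta_lt).
(* Three bounds in succession: the multiplier norm of phi, the class S' for frequencies of level j,
   and the kernel operator. *)
have D3 : dualbound q F3 (nb_cst * (phit_cst * K j) * pnorm p h).
  move=> g bg; have := multiplier_pairing_bound pq ur phi0
    (fun l => (eta j l)%:C * fourier h l * (dfourier (phit j) l)^*) (vpsupp_uniq _ _) bg.
  move=> /(_ (nbI M delta j) (nbJ M delta j)) /le_trans; apply.
  rewrite ler_wpM2r ?qnorm_ge0//.
  have hs l : l \in supp j -> (eta j l)%:C * fourier h l != 0 ->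
      forall i, (`|l i ord0| <= b j i)%N.
    by move=> _ hl; apply: eta_le_dgrid; apply: contraNneq hl => ->; rewrite mul0r.
  have := phit_conj_bound j0 (leqnn j) (vpsupp_uniq _ _) hs.
  rewrite subrr mulr0 powRr0 mulr1 => h1.
  have h2 : pnorm p (nbs j h) <= nb_cst * pnorm p h.
    apply: (dualbound_pnorm pq) => //; first by rewrite mulr_ge0 ?pnorm_ge0.
    exact: (nbsum_dualbound M_diag M_dil pq delta_gt0 delta_lt).
  have K0 := Kphi_ge0 pq ur phi0.
  rewrite [leRHS](_ : _ = K j * (phit_cst * (nb_cst * pnorm p h))); last by ring.
  rewrite ler_wpM2l//; apply: le_trans h1 _.
  by rewrite ler_wpM2l ?phit_cst_ge0.
have bN := bperiodicN b2.
apply: le_dualbound (dualboundD b1 (bperiodicD bN b3) D1 (dualboundD bN b3 D2 D3)).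
by rewrite le_eqVlt; apply/orP; left; apply/eqP; ring.
Qed.

Hypothesis d_gt0 : (0 < d)%N.
Local Notation E nu f := (bestapprox (delta *: @Mpow R d M nu) p f).
Local Notation wE nu f := ((m `^ (al * nu%:R))%:E * E nu f)%E.

Lemma weighted_bestapprox_ge0 nu f : (0 <= wE nu f)%E.
Proof. by rewrite mule_ge0 ?bestapprox_ge0// lee_fin powR_ge0. Qed.

(** The Besov condition involves M^nu, the tail delta M^nu. If delta 2^n0 >= 1, then delta M^(nu +
    n0) admits at least the frequencies of M^nu, and a shift of the index by n0 compares the two
    series; the finitely many initial terms are finite. *)
Lemma besov_tail_lty f j : besov M p (d%:R * (1 - q^-1) + N) f ->
  (\sum_(j <= nu <oo) wE nu f < +oo)%E.
Proof.
move=> [[mf pf fp] hb].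
have [n0 hn0] : exists n0 : nat, 1 <= delta * 2 ^+ n0.
  exists (Num.bound delta^-1); rewrite -ler_pdivrMl// mulr1.
  apply: le_trans (ltW (archi_boundP _)) _; first by rewrite invr_ge0 ltW.
  by rewrite -natrX ler_nat ltnW// ltn_expl.
pose G nu := ((m `^ ((d%:R * (1 - q^-1) + N) / d%:R * nu%:R))%:E * bestapprox (@Mpow R d M nu) p f)%E.
have G0 nu : (0 <= G nu)%E by rewrite mule_ge0 ?bestapprox_ge0// lee_fin powR_ge0.
have hG : (\sum_(1 <= nu <oo) G nu < +oo)%E.
  by apply: le_lt_trans hb; rewrite leeDr// Lpnorm_ge0.
have F0 nu : (0 <= wE nu f)%E := weighted_bestapprox_ge0 nu f.
have Ff nu : (wE nu f < +oo)%E.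
  rewrite lte_mul_pinfty ?lee_fin ?powR_ge0//.
  exact: le_lt_trans (bestapprox_le_Lpnorm _ _ _) fp.
suff h : (\sum_(0 <= nu <oo) wE nu f < +oo)%E.
  apply: le_lt_trans h; rewrite (nneseries_split 0 j); last by move=> k _; exact: F0.
  by rewrite add0n; apply: leeDr; apply: sume_ge0 => k _; exact: F0.
rewrite (nneseries_split 0 n0.+1); last by move=> k _; exact: F0.
rewrite add0n; apply: lte_add_pinfty.
  by apply: lte_sum_pinfty => i _; exact: Ff.
rewrite -nneseries_addn; last exact: F0.
apply: (@le_lt_trans _ _
    (\sum_(0 <= i <oo) (m `^ (al * n0%:R))%:E * G (i + 1)%N)%E); last first.
  rewrite nneseriesZl; last by move=> i _; exact: G0.
  apply: lte_mul_pinfty; [by rewrite lee_fin powR_ge0|exact: fin_numE|].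
  by rewrite (nneseries_addn 1 G0).
apply: lee_nneseries => [i _ _|i _]; first exact: F0.
have sE : (d%:R * (1 - q^-1) + N) / d%:R = al.
  by rewrite mulrDl mulrAC mulfV ?mul1r// pnatr_eq0 -lt0n.
rewrite /G sE muleA -EFinM -powRD; last by rewrite (gt_eqF m_gt0) implybT.
rewrite -mulrDr -natrD (_ : (n0 + (i + 1) = i + n0.+1)%N); last by rewrite addn1 !addnS addnC.
rewrite lee_wpmul2l ?lee_fin ?powR_ge0//; apply: le_bestapprox_mx => x.
rewrite enorm_scaled_MpowN ler_pdivrMl//.
rewrite -[delta]gtr0_norm// -enormZ; apply: le_enorm => k.
rewrite [in leRHS]mxE -/(MpowN M _) !MpowN_mul// !normrM !normfV mulrCA ler_wpM2l//.
have b0 nu : 0 < `|(dgrid M nu k)%:~R| :> R by rewrite normr_gt0 intr_eq0.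
rewrite ler_pdivlMr// ler_pdivrMl// mulrC.
have hk nu : `|(dgrid M nu k)%:~R| = (`|M k k| ^ nu)%:R :> R.
  by rewrite -intr_norm -abszE abs_dgrid.
rewrite !hk (gtr0_norm delta_gt0) addn1 addnS -addSn expnD natrM.
apply: (@le_trans _ _ ((`|M k k| ^ i.+1)%:R * (delta * 2 ^+ n0))).
  by rewrite ler_peMr.
rewrite mulrCA ler_wpM2l ?(ltW delta_gt0)// ler_wpM2l//.
rewrite -natrX ler_nat; case: (posnP n0) => [->//|n00].
by rewrite leq_exp2r//; exact: (dilation_entry_ge2 M_diag M_dil).
Qed.

Definition spec_le nu T := forall l, fourier T l != 0 -> forall i, (`|l i ord0| <= b nu i)%N.

Lemma spec_le_nbsum nu f : spec_le nu (nbs nu f).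
Proof.
move=> l; rewrite fourier_trigsum ?vpsupp_uniq//; case: ifPn => _; last by rewrite eqxx.
by move=> h; apply: eta_le_dgrid; apply: contraNneq h => ->; rewrite mul0r.
Qed.

Lemma spec_leS nu nu' T : (nu <= nu')%N -> spec_le nu T -> spec_le nu' T.
Proof.
move=> h hT l Tl i; apply: leq_trans (hT l Tl i) _; rewrite !abs_dgrid.
by rewrite leq_pexp2l// (ltnW (dilation_entry_ge2 M_diag M_dil i)).
Qed.

Lemma spec_le_D nu T : spec T `<=` D (@Mpow R d M nu) -> spec_le nu T.
Proof.
move=> sT l Tl i; have /(D_ingrid M_diag M_dil)/ingridP/(_ i) := sT l Tl.
rewrite mxE => /andP[h1 h2].
have n0 : 0 < `|(dgrid M nu i)%:~R| :> R by rewrite normr_gt0 intr_eq0.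
have : `|(l i ord0)%:~R / (dgrid M nu i)%:~R| <= 1 :> R by rewrite ler_norml; lra.
rewrite normrM normfV ler_pdivrMr// mul1r -!intr_norm ler_int.
by move: (l i ord0) (dgrid M nu i) => u v; clear; lia.
Qed.

Lemma spec_le_approximant nu T : approximant (delta *: Mpow M nu) T -> spec_le nu T.
Proof.
move=> hT; rewrite -(nbsum_id M_diag M_dil pq delta_gt0 delta_lt hT).
exact: spec_le_nbsum.
Qed.

Lemma trigpair_sub j nu F G : trigpoly F -> trigpoly G -> spec_le nu F -> spec_le nu G ->
  exists s, [/\ uniq s, (fun x => F x - G x) = trigsum s (fun l => fourier F l - fourier G l),
    (fun k => trigpair M j F (phit j) k - trigpair M j G (phit j) k) =
      trigpair M j (fun x => F x - G x) (phit j) &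
    forall l, l \in s -> fourier F l - fourier G l != 0 ->
      forall i, (`|l i ord0| <= b nu i)%N].
Proof.
move=> tF tG sF sG; have [s [us FE GE]] := trigpoly_common tF tG.
have dE : (fun x => F x - G x) = trigsum s (fun l => fourier F l - fourier G l).
  by rewrite {1}FE {1}GE trigsumB.
exists s; split => //.
  apply/funext => k; rewrite dE {1}FE {1}GE !trigpairE//.
  rewrite /trigsum -sumrB; apply: eq_bigr => l _; by ring.
move=> l _ h i; have [Fl|Fl] := eqVneq (fourier F l) 0; last exact: sF.
by apply: sG; apply: contraNneq h => Gl; rewrite Fl Gl subrr.
Qed.

Lemma trigpair_diff j k : (0 < j)%N -> k \in gseq j -> exists2 C : R, 0 <= C &
  forall nu F G, (j <= nu)%N -> trigpoly F -> trigpoly G -> spec_le nu F -> spec_le nu G ->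
  normc (trigpair M j F (phit j) k - trigpair M j G (phit j) k) <=
    C * m `^ (al * nu%:R) * pnorm p (fun x => F x - G x).
Proof.
move=> j0 kg; have [C C0 hC] := trigpair_bound j0 kg; exists C => // nu F G jnu tF tG sF sG.
have [s [us dE tE hs]] := trigpair_sub j tF tG sF sG.
have /= -> := congr1 (fun u => u k) tE.
by rewrite dE; exact: hC.
Qed.

Lemma Qop_diff j nu F G : (0 < j)%N -> (j <= nu)%N ->
  trigpoly F -> trigpoly G -> spec_le nu F -> spec_le nu G ->
  dualbound q (Qop M j (fun k => trigpair M j F (phit j) k - trigpair M j G (phit j) k) (phi j))
    (Qop_cst * m `^ (al * (nu%:R - j%:R)) * K j * pnorm p (fun x => F x - G x)).
Proof.
move=> j0 jnu tF tG sF sG; have [s [us dE -> hs]] := trigpair_sub j tF tG sF sG.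
by rewrite dE; exact: Qop_dualbound.
Qed.

(** The pairing is a finite linear combination of the samples, which lets limits of samples be taken
    inside it. *)
Lemma pairing_Qop j g : (0 < j)%N -> bperiodic g -> exists a : 'cV[int]_d -> R[i],
  forall c, pairing (Qop M j c (phi j)) g = \sum_(k <- gseq j) c k * a k.
Proof.
move=> j0 bg; have [r [ur phiE phi0]] := trigpolyP (phi_trig j0).
exists (fun k => ((size (gseq j))%:R^-1)%:C * (multiplierc (phi j) r g (gpt j k))^*) => c.
rewrite QopE// (pairing_qproj _ phiE)//.
by rewrite mulr_sumr; apply: eq_bigr => k _; rewrite mulrCA.
Qed.

Lemma QopB j c c' : Qop M j (fun k => c k - c' k) (phi j) =
  fun x => Qop M j c (phi j) x - Qop M j c' (phi j) x.
Proof.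
rewrite !QopE//; apply/funext => x; rewrite /qproj -mulrBr -sumrB; congr (_ * _).
by apply: eq_bigr => k _; rewrite mulrBl.
Qed.

Lemma bperiodic_Qop j c : (0 < j)%N -> bperiodic (Qop M j c (phi j)).
Proof.
move=> j0; have [r [ur phiE phi0]] := trigpolyP (phi_trig j0).
by rewrite QopE//; exact: (bperiodic_qproj _ phiE).
Qed.

Lemma pnorm_near_best f F G nu (a a' : R) : inLp p f -> bperiodic F -> bperiodic G ->
  (Lpnorm p (fun x => f x - F x)%R <= a%:E * E nu f)%E ->
  (Lpnorm p (fun x => f x - G x)%R <= a'%:E * E nu f)%E ->
  pnorm p (fun x => F x - G x) <= (`|a| + `|a'|) * fine (E nu f).
Proof.
move=> [mf pf fp] bF bG hF hG.
have [mF _ _] := bF; have [mG _ _] := bG.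
have Ef : E nu f \is a fin_num.
  rewrite ge0_fin_numE ?bestapprox_ge0//.
  exact: le_lt_trans (bestapprox_le_Lpnorm _ _ _) fp.
have p1 := conj_p_ge1 pq.
have h : (Lpnorm p (fun x => F x - G x)%R <=
    Lpnorm p (fun x => f x - G x)%R + Lpnorm p (fun x => f x - F x)%R)%E.
  have -> : (fun x => F x - G x) = fun x => (f x - G x) + - (f x - F x).
    by apply/funext => x; ring.
  apply: le_trans (Lpnorm_triangle p1 _ _) _; last by rewrite LpnormN.
    exact: cmeasurableB.
  have : cmeasurable (fun x => 0 - (f x - F x)).
    by apply: cmeasurableB; [exact: cmeasurable_cst|exact: cmeasurableB].
  by under eq_fun do rewrite sub0r.
rewrite -lee_fin -pnormE; last first.
  by apply: bperiodic_Lpnorm => //; exact: bperiodicB.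
apply: le_trans h _; rewrite mulrDl EFinD !EFinM fineK// [leLHS]addeC; apply: leeD.
  apply: le_trans hF _; rewrite lee_wpmul2r ?bestapprox_ge0// lee_fin ler_norm//.
by apply: le_trans hG _; rewrite lee_wpmul2r ?bestapprox_ge0// lee_fin ler_norm.
Qed.

(** * Samples of a distribution: convergence and telescoping *)

Section distributional_samples.
Variables (f : 'cV[R]_d -> R[i]) (j : nat).
Hypotheses (fB : besov M p (d%:R * (1 - q^-1) + N) f) (j0 : (0 < j)%N).

Let sigma : R := 1 + nb_cst.
Let wf nu : R := m `^ (al * nu%:R) * fine (E nu f).
Definition besov_tail : R := fine (\sum_(j <= nu <oo) wE nu f)%E.
Let c : 'cV[int]_d -> R[i] := distpair M delta p j f (phit j).
Let tp nu k : R[i] := trigpair M j (nbs nu f) (phit j) k.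

Let f_Lp : inLp p f. Proof. by case: fB. Qed.
Let sigma_ge0 : 0 <= sigma. Proof. by rewrite addr_ge0. Qed.

Let E_fin nu : E nu f \is a fin_num.
Proof.
rewrite ge0_fin_numE ?bestapprox_ge0//.
by case: f_Lp => _ _; apply: le_lt_trans; exact: bestapprox_le_Lpnorm.
Qed.

Let wf_ge0 nu : 0 <= wf nu.
Proof. by rewrite mulr_ge0 ?powR_ge0 ?fine_ge0 ?bestapprox_ge0. Qed.

Lemma besov_tailE : (\sum_(j <= nu <oo) wE nu f)%E = besov_tail%:E.
Proof.
rewrite fineK// ge0_fin_numE; first exact: besov_tail_lty.
by apply: nneseries_ge0 => nu _ _; exact: weighted_bestapprox_ge0.
Qed.

Lemma besov_tail_ge0 : 0 <= besov_tail.
Proof.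
by apply/fine_ge0/nneseries_ge0 => nu _ _; exact: weighted_bestapprox_ge0.
Qed.

Let sum_wf n : \sum_(i < n) wf (i + j) <= besov_tail.
Proof.
rewrite -lee_fin -besov_tailE -sumEFin.
apply: le_trans (nneseries_lim_ge (j + n) _); last first.
  by move=> nu _ _; exact: weighted_bestapprox_ge0.
rewrite -[X in (_ <= \sum_(X <= _ < _) _)%E]add0n big_addn addKn big_mkord; apply: lee_sum => i _.
by rewrite EFinM fineK.
Qed.

(** This is the term nu = j of the tail series. *)
Lemma bestapprox_le_tail : fine (E j f) <= m `^ (- (al * j%:R)) * besov_tail.
Proof.
have := sum_wf 1; rewrite big_ord1 add0n /wf => h.
have -> : fine (E j f) = m `^ (- (al * j%:R)) * (m `^ (al * j%:R) * fine (E j f)).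
  rewrite mulrA -powRD; last by rewrite (gt_eqF m_gt0) implybT.
  by rewrite addNr powRr0 mul1r.
by rewrite ler_wpM2l ?powR_ge0.
Qed.

Let wf_cvg0 : wf n @[n --> \oo] --> (0 : R).
Proof.
rewrite -(cvg_shiftn j); apply: cvg_series_cvg_0.
apply: nondecreasing_is_cvgn; first by apply: nondecreasing_series => i _ _; exact: wf_ge0.
by exists besov_tail => _ [n _ <-]; rewrite /series /= big_mkord; exact: sum_wf.
Qed.

Let nbs_err nu : (Lpnorm p (fun x => f x - nbs nu f x)%R <= sigma%:E * E nu f)%E.
Proof.
have [mf _ fp] := f_Lp.
exact: (nbsum_near_best M_diag M_dil pq delta_gt0 delta_lt).
Qed.

(** Both approximants are compared with f. The weight is that of level nu + 1, so the error of level
    nu costs one factor m to the power [al]. *)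
Let step_err nu : m `^ (al * nu.+1%:R) * pnorm p (fun x => nbs nu.+1 f x - nbs nu f x) <=
  sigma * (wf nu.+1 + m `^ al * wf nu).
Proof.
have [mf _ fp] := f_Lp.
have h : pnorm p (fun x => nbs nu.+1 f x - nbs nu f x) <=
    sigma * (fine (E nu f) + fine (E nu.+1 f)).
  have b1 := trigpoly_bperiodic (trigpoly_nbsum M delta nu.+1 f).
  have b2 := trigpoly_bperiodic (trigpoly_nbsum M delta nu f).
  have -> : (fun x => nbs nu.+1 f x - nbs nu f x) =
      fun x => (f x - nbs nu f x) + - (f x - nbs nu.+1 f x).
    by apply/funext => x; ring.
  have [mF1 _ _] := b1; have [mF2 _ _] := b2.
  have m1 : cmeasurable (fun x => f x - nbs nu f x) by exact: cmeasurableB.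
  have m2 : cmeasurable (fun x => - (f x - nbs nu.+1 f x)).
    by under eq_fun do rewrite opprB; exact: cmeasurableB.
  have := Lpnorm_triangle (conj_p_ge1 pq) m1 m2; rewrite LpnormN => h3.
  rewrite -lee_fin -pnormE; last first.
    apply: le_lt_trans h3 _; rewrite lte_add_pinfty//; exact: (LpnormB_lty pq).
  have eE (u v : \bar R) : u \is a fin_num -> v \is a fin_num ->
      (sigma * (fine u + fine v))%:E = (sigma%:E * u + sigma%:E * v)%E.
    by move=> fu fv; rewrite mulrDr EFinD !EFinM !fineK.
  apply: le_trans h3 _; rewrite (eE _ _ (E_fin _) (E_fin _)).
  by apply: leeD; exact: nbs_err.
apply: le_trans (ler_wpM2l (powR_ge0 _ _) h) _.
rewrite le_eqVlt; apply/orP; left; apply/eqP.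
have -> : m `^ al * wf nu = m `^ (al * nu.+1%:R) * fine (E nu f).
  rewrite /wf mulrA -powRD; last by rewrite (gt_eqF m_gt0) implybT.
  by congr (_ * _); apply: (congr1 (powR _)); rewrite -natr1; ring.
by rewrite [fine _ + _]addrC (mulrCA _ sigma) (mulrDr (m `^ _)).
Qed.

Let sum_step n : \sum_(i < n) m `^ (al * (i + j).+1%:R) *
    pnorm p (fun x => nbs (i + j).+1 f x - nbs (i + j) f x) <=
  sigma * (1 + m `^ al) * besov_tail.
Proof.
apply: (@le_trans _ _ (\sum_(i < n) sigma * (wf (i + j).+1 + m `^ al * wf (i + j)))).
  by apply: ler_sum => i _; exact: step_err.
rewrite -mulr_sumr -mulrA ler_wpM2l// big_split/= mulrDl mul1r; apply: lerD; last first.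
  by rewrite -mulr_sumr ler_wpM2l ?powR_ge0 ?sum_wf.
apply: le_trans (sum_wf n.+1); rewrite big_ord_recl/= -[leLHS]add0r lerD//.
Qed.

(** The samples have bounded variation in nu, by the summed step errors. *)
Let tp_step k : k \in gseq j -> exists l : R[i], ccvg (tp ^~ k) l.
Proof.
move=> kg; have [C C0 hC] := trigpair_diff j0 kg.
have [l hl] : exists l : R[i], ccvg (fun n => tp (n + j) k) l.
  apply: (@ccvg_bounded_variation _ _ (C * (sigma * (1 + m `^ al) * besov_tail))) => n.
  apply: le_trans (ler_wpM2l C0 (sum_step n)); rewrite mulr_sumr; apply: ler_sum => i _.
  rewrite addSn mulrA; apply: hC; try exact: trigpoly_nbsum.
  - by rewrite -addSn leq_addl.
  - exact: spec_le_nbsum.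
  - by apply: (@spec_leS (i + j)) => //; exact: spec_le_nbsum.
by exists l; exact: ccvg_shift hl.
Qed.

Lemma distpair_cvg k : k \in gseq j -> ccvg (tp ^~ k) (c k).
Proof.
move=> kg; have [l hl] := tp_step kg; have [C C0 hC] := trigpair_diff j0 kg.
(* The limit along the kernel sums is the limit along every near-best sequence: at level mu the two
   differ by at most a multiple of [wf mu], which tends to 0. Hence the set in [distpair] is
   inhabited and its default value is not taken. *)
have hP : [set z | forall (sg : R) (T : nat -> 'cV[R]_d -> R[i]),
    near_best M delta sg p f T -> ccvg (fun mu => trigpair M j (T mu) (phit j) k) z] l.
  move=> sg T nbT.
  apply: (ccvg_le hl (b := fun mu => C * (`|sg| + `|sigma|) * wf mu)).
    rewrite -[X in _ --> X](mulr0 (C * (`|sg| + `|sigma|))).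
    by apply: cvgM; [exact: cvg_cst|exact: wf_cvg0].
  exists j => // mu /= jmu; have [tT sT eT] := nbT mu.
  have h1 : normc (trigpair M j (T mu) (phit j) k - tp mu k) <=
      C * m `^ (al * mu%:R) * pnorm p (fun x => T mu x - nbs mu f x).
    apply: hC => //; first exact: trigpoly_nbsum.
      exact: spec_le_D.
    exact: spec_le_nbsum.
  apply: le_trans h1 _; rewrite /wf mulrACA ler_wpM2l ?mulr_ge0 ?powR_ge0//.
  exact: (pnorm_near_best f_Lp (trigpoly_bperiodic tT)
    (trigpoly_bperiodic (trigpoly_nbsum M delta mu f)) eT (nbs_err mu)).
have := xgetPex 0 (ex_intro _ l hP); rewrite -/(distpair M delta p j f (phit j) k) -/(c k).
move=> /(_ sigma (fun mu => nbs mu f)); apply.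
exact: (near_best_nbsum M_diag M_dil pq delta_gt0 delta_lt).
Qed.

(** The partial sums of the telescoping series satisfy the dual bound uniformly in n, and the bound
    passes to the limit because the pairing sees only finitely many samples. *)
Lemma Qop_distpair_dualbound :
  dualbound q (Qop M j (fun k => c k - tp j k) (phi j))
    (Qop_cst * K j * (m `^ (- (al * j%:R)) * (sigma * (1 + m `^ al) * besov_tail))).
Proof.
move=> g bg; have [a aE] := pairing_Qop j0 bg.
set B := Qop_cst * K j * _.
have step n : normc (pairing (Qop M j (fun k => tp (n + j) k - tp j k) (phi j)) g) <=
    B * qnorm q g.
  have Kq : 0 <= Qop_cst * K j * qnorm q g.
    have [r [ur phiE phi0]] := trigpolyP (phi_trig j0).
    have K0 := Kphi_ge0 pq ur phi0.
    by rewrite mulr_ge0 ?qnorm_ge0// mulr_ge0 ?Qop_cst_ge0.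
  apply: (@le_trans _ _ (Qop_cst * K j * qnorm q g * (m `^ (- (al * j%:R)) *
      \sum_(i < n) m `^ (al * (i + j).+1%:R) *
      pnorm p (fun x => nbs (i + j).+1 f x - nbs (i + j) f x)))); last first.
    rewrite /B [leRHS]mulrAC ler_wpM2l// ler_wpM2l ?powR_ge0//; exact: sum_step.
  have -> : pairing (Qop M j (fun k => tp (n + j) k - tp j k) (phi j)) g =
      \sum_(i < n) pairing (Qop M j (fun k => tp (i + j).+1 k - tp (i + j) k) (phi j)) g.
    under eq_bigr do rewrite aE.
    rewrite aE exchange_big/=; apply: eq_bigr => k _.
    rewrite -mulr_suml; congr (_ * _).
    have := telescope_sumr (fun o => tp (o + j)%N k) (leq0n n).
    by rewrite big_mkord => ->; rewrite add0n.
  apply: le_trans (normc_sum _ _ _) _; rewrite !mulr_sumr; apply: ler_sum => i _.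
  have := Qop_diff j0 (leq_trans (leq_addl i j) (leqnSn _))
    (trigpoly_nbsum M delta (i + j).+1 f) (trigpoly_nbsum M delta (i + j) f)
    (@spec_le_nbsum (i + j).+1 f) (spec_leS (leqnSn _) (@spec_le_nbsum (i + j) f)) bg.
  move=> /le_trans; apply; rewrite le_eqVlt; apply/orP; left; apply/eqP.
  rewrite mulrBr powRD; last by rewrite (gt_eqF m_gt0) implybT.
  by ring.
apply: (@cvg0_le_add _ _ _ (fun n => \sum_(k <- gseq j) normc (tp n k - c k) * normc (a k)) j).
  apply: cvg0_sum => k kg; rewrite -[0 : R](mul0r (normc (a k))).
  by apply: cvgM; [exact: distpair_cvg|exact: cvg_cst].
move=> n jn.
have -> : pairing (Qop M j (fun k => c k - tp j k) (phi j)) g =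
    pairing (Qop M j (fun k => tp n k - tp j k) (phi j)) g -
    \sum_(k <- gseq j) (tp n k - c k) * a k.
  rewrite !aE -sumrB; apply: eq_bigr => k _.
  by move: (c k) (tp j k) (tp n k) (a k) => u v v' z; ring.
apply: le_trans (le_normcD _ _) _; rewrite normcN; apply: lerD.
  by have := step (n - j)%N; rewrite subnK.
apply: le_trans (normc_sum _ _ _) _; apply: ler_sum => k _.
by rewrite normcM.
Qed.

End distributional_samples.

(** * Lower bounds from frequency 0 and the error for distributional samples *)

Variable Ct : R.
Hypothesis phit0 : forall j, (0 < j)%N -> normc (dfourier (phit j) 0) <= Ct.

Lemma unit_symbol0 j : (0 < j)%N -> fourier (phi j) 0 * (dfourier (phit j) 0)^* = 1.
Proof.
move=> j0; have D0 : D (@Mspow R d M j) 0.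
  rewrite MspowE//; apply/(D_ingrid M_diag M_dil)/ingridP => i.
  by rewrite !mxE mul0r oppr_le0 invr_ge0 ler0n invr_gt0 ltr0n.
have := compat j0 D0; rewrite (_ : toR 0 = 0 :> 'cV[R]_d); last first.
  by apply/colP => i; rewrite !mxE.
(* Here the order of compatibility must be positive: 0 to that power is 0, so the compatibility
   bound forces equality at frequency 0. *)
rewrite mulmx0 enorm0 powR0 ?gt_eqF// mulr0 => h.
have /eq0_normc/eqP : normc (1 - fourier (phi j) 0 * (dfourier (phit j) 0)^*) = 0.
  by apply/eqP; rewrite eq_le h normc_ge0.
by rewrite subr_eq0 eq_sym => /eqP.
Qed.

Let normc_symbol0 j : (0 < j)%N -> normc (fourier (phi j) 0) * normc (dfourier (phit j) 0) = 1.
Proof. by move=> j0; rewrite -[X in _ * X]normc_conj -normcM unit_symbol0// normc1. Qed.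

Let Ct_gt0 : 0 < Ct.
Proof.
have h := normc_symbol0 (ltn0Sn 0); apply: lt_le_trans (phit0 (ltn0Sn 0)).
rewrite lt0r normc_ge0 andbT; apply/eqP => e.
by move: h; rewrite e mulr0 => /esym/eqP; rewrite oner_eq0.
Qed.

Lemma Kphi_lower j : (0 < j)%N -> Ct^-1 <= K j.
Proof.
move=> j0; have [r [ur phiE phi0]] := trigpolyP (phi_trig j0).
apply: le_trans (Kphi_ge_fourier0 pq ur phi0).
rewrite -[leLHS]mulr1 -(normc_symbol0 j0) mulrCA ler_piMr ?normc_ge0//.
by rewrite ler_pdivrMl// mulr1; exact: phit0.
Qed.

Let Kphi_gt0 j : (0 < j)%N -> 0 < K j.
Proof. by move=> j0; apply: lt_le_trans (Kphi_lower j0); rewrite invr_gt0. Qed.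

Lemma Lpnorm_le_approximant f F T (a : R) : cmeasurable f -> bperiodic F -> bperiodic T ->
  0 <= a -> dualbound q (fun x => T x - F x) a ->
  (Lpnorm p (fun x => f x - F x)%R <= a%:E + Lpnorm p (fun x => f x - T x)%R)%E.
Proof.
move=> mf bF bT a0 h; have [mF _ _] := bF; have [mT _ _] := bT.
have -> : (fun x => f x - F x) = fun x => (T x - F x) + (f x - T x).
  by apply/funext => x; ring.
apply: le_trans (Lpnorm_triangle (conj_p_ge1 pq) _ _) _; try exact: cmeasurableB.
apply: leeD => //; apply: (dualbound_Lpnorm pq) => //; exact: bperiodicB.
Qed.

Lemma In_ge0 j f : 0 <= In j f.
Proof. by rewrite mulr_ge0 ?powR_ge0. Qed.

Lemma Qop_distpair_error : exists C : R, forall f j,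
  besov M p (d%:R * (1 - q^-1) + N) f -> (0 < j)%N ->
  (Lpnorm p (fun x => f x - Qop M j (distpair M delta p j f (phit j)) (phi j) x)%R
   <= C%:E * ((In j f)%:E + multnorm q (phi j) * (m `^ (- (j%:R * al)))%:E *
     \sum_(j <= nu <oo) wE nu f))%E.
Proof.
have [C1 C10 hC1] := approximant_error.
pose sg := 1 + nb_cst.
have sg0 : 0 <= sg by rewrite addr_ge0.
(* C2 collects the telescoped part. C3 collects the factor of ||f - T||, each summand without K
   being multiplied by [Ct * K >= 1]. *)
pose C2 := Qop_cst * (sg * (1 + m `^ al)).
pose C3 := Ct + nb_cst * (Ct + phit_cst) + Qop_cst * nb_cst.
have C20 : 0 <= C2.
  by rewrite /C2 mulr_ge0 ?Qop_cst_ge0// mulr_ge0// addr_ge0 ?powR_ge0.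
have Ct0 : 0 <= Ct := ltW Ct_gt0.
have C30 : 0 <= C3.
  have N0 := nb_cst_ge0; have F0 := phit_cst_ge0; have Q0 := Qop_cst_ge0.
  by rewrite /C3; do ![done | apply: addr_ge0 | apply: mulr_ge0].
exists (C1 + (C2 + C3)) => f j fB j0.
have [[mf pf fp] _] := fB.
have K0 := Kphi_gt0 j0.
have [r [ur phiE phi0]] := trigpolyP (phi_trig j0).
rewrite (KphiE pq ur phi0) (besov_tailE j fB).
rewrite [X in (_ <= X)%E](_ : _ = ((C1 + (C2 + C3)) *
  (In j f + K j * m `^ (- (j%:R * al)) * besov_tail f j))%:E)//.
have t0 := besov_tail_ge0 f j.
pose S := m `^ (- (j%:R * al)) * besov_tail f j.
have S0 : 0 <= S by rewrite mulr_ge0 ?powR_ge0.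
set c := distpair M delta p j f (phit j).
pose a := C1 * In j f + C2 * (K j * S).
pose b0 := 1 + nb_cst * (1 + phit_cst * K j) + Qop_cst * K j * nb_cst.
have b00 : 0 <= b0.
  have N0 := nb_cst_ge0; have F0 := phit_cst_ge0; have Q0 := Qop_cst_ge0.
  have K1 := ltW K0.
  by rewrite /b0; do ![done | apply: addr_ge0 | apply: mulr_ge0].
have hT T : approximant (delta *: Mpow M j) T ->
    (Lpnorm p (fun x => f x - Qop M j c (phi j) x)%R <=
      a%:E + b0%:E * Lpnorm p (fun x => f x - T x)%R)%E.
  move=> aT; have bT := trigpoly_bperiodic aT.1; have [mT _ _] := bT.
  have hp := LpnormB_lty pq mf fp bT.
  have mh := cmeasurableB mf mT.
  pose h x := f x - T x.
  pose tpT := trigpair M j T (phit j).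
  pose tpV := trigpair M j (nbs j f) (phit j).
  have bV := trigpoly_nbsum M delta j f.
  have b1 : bperiodic (fun x => T x - Qop M j tpT (phi j) x).
    by apply: bperiodicB => //; exact: bperiodic_Qop.
  have b2 : bperiodic (Qop M j (fun k => c k - tpV k) (phi j)) := bperiodic_Qop _ j0.
  have b3 : bperiodic (Qop M j (fun k => tpV k - tpT k) (phi j)) := bperiodic_Qop _ j0.
  have D1 := hC1 j f T j0 mf fp aT.
  have D2 := Qop_distpair_dualbound fB j0.
  have D3 : dualbound q (Qop M j (fun k => tpV k - tpT k) (phi j))
      (Qop_cst * K j * (nb_cst * pnorm p h)).
    have := Qop_diff j0 (leqnn j) bV aT.1 (@spec_le_nbsum j f) (spec_le_approximant aT).
    apply: le_dualbound; rewrite subrr mulr0 powRr0 mulr1.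
    apply: ler_wpM2l; first by apply: mulr_ge0; [exact: Qop_cst_ge0|exact: ltW].
    have -> : (fun x => nbs j f x - T x) = fun x => nbs j f x - nbs j T x.
      by rewrite (nbsum_id M_diag M_dil pq delta_gt0 delta_lt aT).
    rewrite nbsumB//; last 2 first.
    - exact: Lp_cintegrable pq mf fp.
    - exact: bperiodic_cintegrable.
    apply: (dualbound_pnorm pq); first exact: bperiodic_trigsum.
      by rewrite mulr_ge0 ?pnorm_ge0.
    exact: (nbsum_dualbound M_diag M_dil pq delta_gt0 delta_lt).
  have D4 := dualboundD b1 (bperiodicN (bperiodicD b2 b3)) D1
    (dualboundN (bperiodicD b2 b3) (dualboundD b2 b3 D2 D3)).
  (* Q f is compared with Q T through Q V f: telescoping handles Q f - Q V f, and V f - T = V (f -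
     T) is again controlled by ||f - T||. *)
  have E4 : (fun x => T x - Qop M j c (phi j) x) =
      fun x => (T x - Qop M j tpT (phi j) x) +
        - (Qop M j (fun k => c k - tpV k) (phi j) x + Qop M j (fun k => tpV k - tpT k) (phi j) x).
    by rewrite !QopB; apply/funext => x; ring.
  rewrite -E4 in D4.
  apply: le_trans (Lpnorm_le_approximant mf (bperiodic_Qop _ j0) bT _ D4) _.
    have P0 := pnorm_ge0 p h; have I0 := In_ge0 j f.
    have N0 := nb_cst_ge0; have F0 := phit_cst_ge0; have Q0 := Qop_cst_ge0.
    have K1 := ltW K0; have m0 := powR_ge0 m.
    by do ![done | apply: addr_ge0 | apply: mulr_ge0].
  rewrite (pnormE hp) -EFinM -!EFinD lee_fin le_eqVlt; apply/orP; left; apply/eqP.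
  rewrite -[fun x => f x - T x]/h [al * _]mulrC /a /b0 /C2 /S /sg.
  move: (pnorm p h) (m `^ (- _)) (m `^ al) (besov_tail f j) (In j f) (K j) nb_cst Qop_cst phit_cst.
  by clear => P X Y t I0 k u v z; ring.
have := le_bestapprox b00 hT => /le_trans; apply.
have Ef : E j f \is a fin_num.
  rewrite ge0_fin_numE ?bestapprox_ge0//.
  exact: le_lt_trans (bestapprox_le_Lpnorm _ _ _) fp.
rewrite -(fineK Ef) -EFinM -EFinD lee_fin.
have hE : fine (E j f) <= S by have := bestapprox_le_tail j fB; rewrite [al * _]mulrC.
have hb : b0 <= C3 * K j.
  have h1 : 1 <= Ct * K j by rewrite -ler_pdivrMl// mulr1; exact: Kphi_lower.
  rewrite /b0 /C3 !mulrDl; apply: lerD; last by rewrite mulrAC.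
  by apply: lerD => //; rewrite -mulrA ler_wpM2l// mulrDl lerD2r.
have I0 := In_ge0 j f.
apply: (@le_trans _ _ (a + C3 * K j * S)).
  rewrite lerD2l; apply: ler_pM => //; exact/fine_ge0/bestapprox_ge0.
rewrite /a -mulrA -/S.
have h1 : C1 * In j f <= (C1 + (C2 + C3)) * In j f.
  by rewrite ler_wpM2r// lerDl addr_ge0.
have h2 : (C2 + C3) * (K j * S) <= (C1 + (C2 + C3)) * (K j * S).
  by rewrite ler_wpM2r ?lerDr// mulr_ge0 ?(ltW K0).
by move: h1 h2; rewrite mulrDr -mulrA -/S; lra.
Qed.

(** * Samples given by integration against an L_q function *)

Variable Cp : R.
Hypothesis phi_le : forall j, (0 < j)%N -> normc (fourier (phi j) 0) <= Cp.

Section function_samples.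
Variables (g : 'cV[R]_d -> R[i]) (j : nat).
Hypotheses (j0 : (0 < j)%N) (mg : cmeasurable g) (pg : Zperiodic g).
Hypotheses (gL : (Lqjnorm M q j g < +oo)%E) (gu : induced_by g (phit j)).
Local Notation P := (@torus_prob R d).
Local Notation synth := (gridsynth (dgrid M j) g).

Definition lamq : R := fine (Lqjnorm M q j g).

Let LqjnormE : Lqjnorm M q j g = (((size (gseq j))%:R%:E *
  \int[P]_(x in gridcell (dgrid M j)) ((gridavg (dgrid M j) g x) `^ q)%:E) `^ q^-1)%E.
Proof.
rewrite /Lqjnorm (absdet_exp R M_diag j) (cube_gridcell M_diag M_dil j).
apply: (congr1 (fun z => ((size (gseq j))%:R%:E * z) `^ q^-1)%E).
apply: eq_integral => x _; apply: (congr1 (fun z => (z `^ q)%:E)).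
rewrite (sum_D M_diag M_dil) /gridavg; apply: (congr1 ( *%R _)).
by apply: eq_bigr => k _; rewrite (MpowN_gridpt M_diag M_dil).
Qed.

Lemma lamqE : Lqjnorm M q j g = lamq%:E.
Proof.
rewrite /lamq; have h : (0 <= Lqjnorm M q j g)%E by rewrite LqjnormE; exact: poweR_ge0.
by move: (Lqjnorm M q j g) h gL => x x0 xy; rewrite fineK// ge0_fin_numE.
Qed.

Lemma lamq_ge0 : 0 <= lamq.
Proof. by apply: fine_ge0; rewrite LqjnormE; exact: poweR_ge0. Qed.

Let gridint_le : (gridint (dgrid M j) q g <= (lamq `^ q)%:E)%E.
Proof.
apply: le_trans (gridint_cell q (@n_neq0 j) mg pg (fun i => dgrid_ge2 M_diag M_dil i j0)) _.
set Y := (_ * _)%E; have Y0 : (0 <= Y)%E.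
  by rewrite mule_ge0 ?lee_fin// integral_ge0// => x _; rewrite lee_fin powR_ge0.
have Yf : Y \is a fin_num.
  rewrite (ge0_fin_numE Y0) ltNge; apply/negP; rewrite leye_eq => /eqP Yy.
  by move: gL; rewrite LqjnormE -/Y Yy poweRyr ?ltxx ?invr_neq0 ?gt_eqF.
have -> : lamq = fine Y `^ q^-1.
  by rewrite /lamq LqjnormE -/Y; move: Y Yf {Y0} => Y Yf; rewrite -{1}(fineK Yf) poweR_EFin.
by rewrite -powRrM mulVf ?gt_eqF// powRr1 ?fine_ge0// fineK.
Qed.

Let Lpnorm_synth H : (Lpnorm q%:E (synth H) <=
  (lamq * ((size (gseq j))%:R^-1 * \sum_(k <- gseq j) normc (H k) `^ q) `^ q^-1)%:E)%E.
Proof. exact: (Lpnorm_gridsynth (@n_neq0 j) q_ge1 mg pg _ lamq_ge0 gridint_le). Qed.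

(** g is itself a synthesis, from the multiple of the indicator of k = 0 that cancels the
    normalisation. So finiteness of the grid norm puts g in L_q. *)
Let gq : (Lpnorm q%:E g < +oo)%E.
Proof.
pose H (k : 'cV[int]_d) : R[i] := if k == 0 then (size (gseq j))%:R%:C else 0.
suff -> : g = synth H by apply: le_lt_trans (Lpnorm_synth H) (ltry _).
have g0 : 0 \in gseq j.
  rewrite mem_gridseq//; apply/ingridP => i.
  by rewrite !mxE mul0r oppr_le0 invr_ge0 ler0n invr_gt0 ltr0n.
apply/funext => x; rewrite /gridsynth (bigD1_seq 0) ?gridseq_uniq//= big1 ?addr0.
  rewrite /H eqxx (_ : gpt j 0 = 0) ?subr0; last by apply/colP => i; rewrite !mxE mul0r.
  rewrite mulrA -rmorphM/= mulVf ?mul1r//.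
  by rewrite pnatr_eq0 -lt0n size_gridseq_gt0.
by move=> k /negbTE k0; rewrite /H k0 mul0r.
Qed.

Let shift_meas y : cmeasurable (fun t => g (t - y)).
Proof. exact: cmeasurable_shift. Qed.

Let shift_q y : (Lpnorm q%:E (fun t => g (t - y)) < +oo)%E.
Proof.
suff -> : Lpnorm q%:E (fun t => g (t - y)) = Lpnorm q%:E g by exact: gq.
rewrite !Lpnorm_fin /Lqint; apply: (congr1 (fun z => (z `^ q^-1)%E)).
apply: (torus_integral_shift (H := fun t => (normc (g t) `^ q)%:E) (- y)).
- exact: measurable_powR_normcE.
- by move=> x; rewrite lee_fin powR_ge0.
- by move=> x k; rewrite pg.
Qed.

Let shift_int y : cintegrable (fun t => g (t - y)).
Proof. exact: (Lq_cintegrable pq (shift_meas y) (shift_q y)). Qed.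

Let gi : cintegrable g. Proof. exact: (Lq_cintegrable pq mg gq). Qed.

Lemma fourier_shift y l : fourier (fun t => g (t - y)) l = fourier g l * character (- l) y.
Proof.
rewrite /fourier -[LHS](cint_shift y); last 2 first.
- by apply: cmeasurableM => //; exact: cmeasurable_character.
- by move=> x k; rewrite addrAC pg Zperiodic_character.
have -> : (fun x => g (x + y - y) * character (- l) (x + y)) =
    fun x => character (- l) y * (g x * character (- l) x).
  by apply/funext => x; rewrite addrK characterDr mulrA mulrC.
by rewrite (cintZ _ (cintegrableM_character (- l) gi)) mulrC.
Qed.

Lemma funpairE f k : funpair M j f g k = pairing f (fun t => g (t - gpt j k)).
Proof. by rewrite /funpair MpowN_gridpt. Qed.

(** The two definitions of samples agree on polynomials, since g has the Fourier coefficients of the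
    distribution that it induces. *)
Lemma funpair_trigpoly T k : trigpoly T -> funpair M j T g k = trigpair M j T (phit j) k.
Proof.
move=> /trigpolyP[s [us -> _]]; rewrite funpairE trigpairE// pairing_trigsum//.
apply: eq_bigr => l _; rewrite fourier_shift conjCM characterNl conjCK mulrA.
by rewrite (dfourier_induced _ gu).
Qed.

Lemma funpairB f T k : cmeasurable f -> (Lpnorm p f < +oo)%E ->
  bperiodic T -> funpair M j (fun x => f x - T x) g k = funpair M j f g k - funpair M j T g k.
Proof.
move=> mf fp bT; have [mT _ _] := bT.
have i1 := cintegrable_pairing pq mf (shift_meas (gpt j k)) fp (shift_q (gpt j k)).
have Tp : (Lpnorm p T < +oo)%E by exact: bperiodic_Lpnorm.
have i2 := cintegrable_pairing pq mT (shift_meas (gpt j k)) Tp (shift_q (gpt j k)).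
rewrite !funpairE /pairing.
have -> : (fun x => (f x - T x) * (g (x - gpt j k))^*) =
    fun x => f x * (g (x - gpt j k))^* + (-1) * (T x * (g (x - gpt j k))^*).
  by apply/funext => x; rewrite mulN1r mulrBl.
by rewrite (cintD i1 (cintegrableZ (-1) i2)) (cintZ (-1) i2) mulN1r.
Qed.

(** The pairing becomes one of f with a synthesis from translates of g, weighted by the samples of
    the transformed test function, and Hoelder's inequality applies. *)
Lemma Qop_funpair_dualbound f : cmeasurable f -> (Lpnorm p f < +oo)%E ->
  dualbound q (Qop M j (funpair M j f g) (phi j))
    (mz_cst d q A `^ q^-1 * K j * lamq * pnorm p f).
Proof.
move=> mf fp psi bpsi; have [r [ur phiE phi0]] := trigpolyP (phi_trig j0).
pose H k := multiplierc (phi j) r psi (gpt j k).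
have -> : pairing (Qop M j (funpair M j f g) (phi j)) psi = pairing f (synth H).
  rewrite QopE// (pairing_qproj _ phiE)// /pairing.
  have e x : f x * (synth H x)^* = ((size (gseq j))%:R^-1)%:C *
      \sum_(k <- gseq j) (H k)^* * (f x * (g (x - gpt j k))^*).
    rewrite /gridsynth conjCM conjC_realC mulrCA; apply: (congr1 ( *%R _)).
    rewrite conjC_sum mulr_sumr; apply: eq_bigr => k _.
    by rewrite conjCM mulrCA.
  under [X in _ = cint X]eq_fun do rewrite e.
  have i1 k := cintegrable_pairing pq mf (shift_meas (gpt j k)) fp (shift_q (gpt j k)).
  have ik k : cintegrable (fun x => (H k)^* * (f x * (g (x - gpt j k))^*)).
    exact: cintegrableZ (i1 k).
  rewrite (cintZ _ (cintegrable_sum (gseq j) ik)).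
  apply: (congr1 ( *%R _)); rewrite (cint_sum (gseq j) ik); apply: eq_bigr => k _.
  by rewrite (cintZ _ (i1 k)) mulrC funpairE.
have mS := cmeasurable_gridsynth (dgrid M j) mg H.
have hS := Lpnorm_synth H.
have Sq : (Lpnorm q%:E (synth H) < +oo)%E by exact: le_lt_trans hS (ltry _).
have K0 := Kphi_ge0 pq ur phi0; have Q0 := qnorm_ge0 q psi.
have KQ0 : 0 <= K j * qnorm q psi by rewrite mulr_ge0.
rewrite -lee_fin; apply: le_trans (normc_pairing pq mf mS fp Sq) _.
rewrite (pnormE fp); apply: (@le_trans _ _ ((pnorm p f)%:E * (lamq *
    (mz_cst d q A * (K j * qnorm q psi) `^ q) `^ q^-1)%:E)%E).
  apply: lee_wpmul2l; first by rewrite lee_fin pnorm_ge0.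
  apply: le_trans hS _; rewrite lee_fin ler_wpM2l ?lamq_ge0//.
  rewrite ge0_ler_powR ?nnegrE ?invr_ge0 ?(ltW q_gt0)//.
  - by rewrite mulr_ge0 ?invr_ge0//; apply: sumr_ge0 => k _; exact: powR_ge0.
  - by rewrite mulr_ge0 ?powR_ge0 ?mz_cst_ge0.
  - exact: (sampled_multiplier pq (@n_neq0 j) ur phi0 (fun l => phi_supp (l := l) j0) bpsi).
rewrite -EFinM lee_fin (powRM _ (mz_cst_ge0 _ _ _) (powR_ge0 _ _)) -powRrM mulfV ?gt_eqF//.
by rewrite powRr1// le_eqVlt; apply/orP; left; apply/eqP; ring.
Qed.

(** The average of g over grid translates keeps the coefficient at frequency 0, and its L_q norm is
    at most [lamq]. *)
Lemma lamq_lower : normc (dfourier (phit j) 0) <= lamq.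
Proof.
rewrite (dfourier_induced _ gu).
have e : fourier (synth (fun=> 1)) 0 = fourier g 0.
  rewrite /fourier.
  have -> : (fun x => synth (fun=> 1) x * character (- 0) x) = fun x =>
      ((size (gseq j))%:R^-1)%:C * \sum_(k <- gseq j) g (x - gpt j k) * character (- 0) x.
    apply/funext => x; rewrite /gridsynth -mulrA mulr_suml; apply: (congr1 ( *%R _)).
    by apply: eq_bigr => k _; rewrite mul1r.
  have ik k : cintegrable (fun x => g (x - gpt j k) * character (- 0) x).
    exact: cintegrableM_character (shift_int _).
  rewrite (cintZ _ (cintegrable_sum (gseq j) ik)) (cint_sum (gseq j) ik).
  transitivity (((size (gseq j))%:R^-1)%:C * \sum_(k <- gseq j) fourier g 0).
    apply: (congr1 ( *%R _)); apply: eq_bigr => k _.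
    rewrite -[LHS]/(fourier (fun t => g (t - gpt j k)) 0) fourier_shift.
    by rewrite oppr0 character0 mulr1.
  rewrite -[RHS]/(fourier g 0); move: (fourier g 0) => z.
  rewrite big_const_seq count_predT iter_addr_0 -[z *+ _]mulr_natl mulrA.
  rewrite -(rmorph_nat (real_complex R)) -rmorphM/= mulVf ?mul1r// pnatr_eq0 -lt0n.
  exact: size_gridseq_gt0.
have mS := cmeasurable_gridsynth (dgrid M j) mg (fun=> 1).
have Sq : (Lpnorm q%:E (synth (fun=> 1%R)) < +oo)%E.
  exact: le_lt_trans (Lpnorm_synth _) (ltry _).
rewrite -e -lee_fin; apply: le_trans (fourier_le_Lpnorm pq 0 mS Sq) _.
apply: le_trans (Lpnorm_synth _) _; rewrite lee_fin.
under eq_bigr do rewrite normc1 powR1.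
rewrite big_const_seq count_predT iter_addr_0 mulVf ?powR1 ?mulr1//.
by rewrite pnatr_eq0 -lt0n size_gridseq_gt0.
Qed.

End function_samples.

(** This absorbs the error terms that carry K but lack [lamq]; the bound with K in place of Cp
    absorbs those that lack both factors. *)
Lemma lamq_lower_cst (g : 'cV[R]_d -> R[i]) j : (0 < j)%N -> cmeasurable g -> Zperiodic g ->
  (Lqjnorm M q j g < +oo)%E -> induced_by g (phit j) -> 1 <= Cp * lamq g j.
Proof.
move=> j0 mg pg gL gu; rewrite -(normc_symbol0 j0).
by apply: ler_pM; rewrite ?normc_ge0 ?phi_le// (lamq_lower j0 mg pg gL gu).
Qed.

Lemma Kphi_lamq_lower (g : 'cV[R]_d -> R[i]) j : (0 < j)%N -> cmeasurable g -> Zperiodic g ->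
  (Lqjnorm M q j g < +oo)%E -> induced_by g (phit j) -> 1 <= K j * lamq g j.
Proof.
move=> j0 mg pg gL gu; have [r [ur phiE phi0]] := trigpolyP (phi_trig j0).
rewrite -(normc_symbol0 j0); apply: ler_pM; rewrite ?normc_ge0//.
  exact: (Kphi_ge_fourier0 pq ur phi0).
exact: (lamq_lower j0 mg pg gL gu).
Qed.

Lemma Qop_funpair_error (g : nat -> 'cV[R]_d -> R[i]) : classL M q g ->
  (forall j, (0 < j)%N -> induced_by (g j) (phit j)) ->
  exists C : R, forall f j, inLp p f -> (0 < j)%N ->
  (Lpnorm p (fun x => f x - Qop M j (funpair M j f (g j)) (phi j) x)%R
   <= C%:E * ((In j f)%:E + multnorm q (phi j) * Lqjnorm M q j (g j) * E j f))%E.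
Proof.
move=> gL gu; have [C1 C10 hC1] := approximant_error.
pose mz := mz_cst d q A `^ q^-1.
have mz0 : 0 <= mz by exact: powR_ge0.
pose C3 := 1 + nb_cst * (1 + phit_cst * Cp) + mz.
have N0 := nb_cst_ge0; have F0 := phit_cst_ge0.
have Cp0 : 0 <= Cp := le_trans (normc_ge0 _) (phi_le (ltn0Sn 0)).
have C30 : 0 <= C3 by rewrite /C3; do ![done | apply: addr_ge0 | apply: mulr_ge0].
exists (C1 + C3) => f j [mf pf fp] j0.
have [mg pg gf] := gL j j0; have guj := gu j j0.
have K1 := ltW (Kphi_gt0 j0); have l0 := lamq_ge0 (g j) j.
have [r [ur phiE phi0]] := trigpolyP (phi_trig j0).
set c := funpair M j f (g j).
pose a := C1 * In j f.
pose b0 := 1 + nb_cst * (1 + phit_cst * K j) + mz * K j * lamq (g j) j.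
have b00 : 0 <= b0 by rewrite /b0; do ![done | apply: addr_ge0 | apply: mulr_ge0].
have hT T : approximant (delta *: Mpow M j) T ->
    (Lpnorm p (fun x => f x - Qop M j c (phi j) x)%R <=
      a%:E + b0%:E * Lpnorm p (fun x => f x - T x)%R)%E.
  move=> aT; have bT := trigpoly_bperiodic aT.1; have [mT _ _] := bT.
  have hp := LpnormB_lty pq mf fp bT.
  have mh := cmeasurableB mf mT.
  pose h x := f x - T x.
  pose tpT := trigpair M j T (phit j).
  have b1 : bperiodic (fun x => T x - Qop M j tpT (phi j) x).
    by apply: bperiodicB => //; exact: bperiodic_Qop.
  have b2 : bperiodic (Qop M j (funpair M j h (g j)) (phi j)) := bperiodic_Qop _ j0.
  have D1 := hC1 j f T j0 mf fp aT.
  have D2 := Qop_funpair_dualbound j0 mg pg gf mh hp.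
  have D4 := dualboundD b1 (bperiodicN b2) D1 (dualboundN b2 D2).
  have E4 : (fun x => T x - Qop M j c (phi j) x) =
      fun x => (T x - Qop M j tpT (phi j) x) + - Qop M j (funpair M j h (g j)) (phi j) x.
    have -> : funpair M j h (g j) = fun k => c k - tpT k.
      apply/funext => k; rewrite (funpairB j0 mg pg gf _ mf fp bT).
      by rewrite (funpair_trigpoly j0 mg pg gf guj _ aT.1).
    by rewrite QopB; apply/funext => x; ring.
  rewrite -E4 in D4.
  have P0 := pnorm_ge0 p h; have I0 := In_ge0 j f.
  apply: le_trans (Lpnorm_le_approximant mf (bperiodic_Qop _ j0) bT _ D4) _.
    by do ![done | apply: addr_ge0 | apply: mulr_ge0].
  rewrite (pnormE hp) -EFinM -!EFinD lee_fin le_eqVlt; apply/orP; left; apply/eqP.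
  rewrite -[fun x => f x - T x]/h /a /b0 /mz.
  move: (pnorm p h) (mz_cst d q A `^ q^-1) (In j f) (K j) (lamq (g j) j) nb_cst phit_cst.
  by clear => P X I0 k y u z; ring.
have := le_bestapprox b00 hT => /le_trans; apply.
have Ef : E j f \is a fin_num.
  rewrite ge0_fin_numE ?bestapprox_ge0//.
  exact: le_lt_trans (bestapprox_le_Lpnorm _ _ _) fp.
have e0 : 0 <= fine (E j f) by exact/fine_ge0/bestapprox_ge0.
rewrite (KphiE pq ur phi0) (lamqE gf) -(fineK Ef).
rewrite [X in (_ <= X)%E](_ : _ = ((C1 + C3) *
  (In j f + K j * lamq (g j) j * fine (E j f)))%:E)//.
rewrite -EFinM -EFinD lee_fin.
have h1 := Kphi_lamq_lower j0 mg pg gf guj.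
have h2 := lamq_lower_cst j0 mg pg gf guj.
have hb : b0 <= C3 * (K j * lamq (g j) j).
  have hK : K j <= Cp * (K j * lamq (g j) j) by rewrite mulrCA ler_peMr.
  rewrite /b0 /C3 [leRHS]mulrDl -[mz * _ * _]mulrA lerD2r [leRHS]mulrDl mul1r.
  apply: lerD => //; rewrite -mulrA ler_wpM2l// mulrDl mul1r.
  by apply: lerD => //; rewrite -mulrA ler_wpM2l.
have I0 := In_ge0 j f.
pose z := K j * lamq (g j) j * fine (E j f).
have h3 : b0 * fine (E j f) <= C3 * z by rewrite mulrA ler_wpM2r.
have h4 : 0 <= C3 * In j f by rewrite mulr_ge0.
have h5 : 0 <= C1 * z by rewrite !mulr_ge0.
apply: (@le_trans _ _ (a + C3 * z)); first by rewrite lerD2l.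
rewrite -/z /a; move: h4 h5; move: (In j f) (z) (C1) (C3) => X Y u v h4 h5.
by rewrite mulrDr !mulrDl; lra.
Qed.

End sampled_trigonometric_polynomials.

(** Writing 1/p as 1 - 1/q covers p = oo, where the inverse is 0. The value q = 0, whose extended
    inverse is oo, is excluded by the equation itself. *)
Lemma conjugate_exponentsP (R : realType) (p : \bar R) (q : R) : (2%:E <= p)%E ->
  (p^-1 + (q%:E)^-1 = 1)%E -> conjugate_exponents p q /\ fine p^-1%E = 1 - q^-1.
Proof.
case: p => [r| |]//.
  rewrite lee_fin => r2; rewrite !inver (gt_eqF (lt_le_trans _ r2)) ?ltr0n//.
  have r0 : 0 < r by lra.
  case: eqVneq => [//|q0] /eqP; rewrite -EFinD eqe => /eqP h.
  have rV : 0 < r^-1 by rewrite invr_gt0.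
  have rV2 : r^-1 <= 2^-1 by rewrite lef_pV2// posrE.
  have qV : 0 < q^-1 by lra.
  have qp : 0 < q by rewrite -invr_gt0.
  split; last by rewrite /=; lra.
  right; exists r; split => //; first by lra.
  by rewrite -invf_lt1//; lra.
move=> _; rewrite invey add0e inver; case: eqVneq => [//|q0] /eqP.
rewrite eqe => /eqP h; have q1 : q = 1 by rewrite -[q]invrK h invr1.
by split; [left|rewrite h subrr].
Qed.

Theorem theorem22 (R : realType) (d : nat) (M : 'M[int]_d)
    (p : \bar R) (q N s delta : R)
    (phi : nat -> 'cV[R]_d -> R[i])
    (phit : nat -> ('cV[R]_d -> R[i]) -> R[i])
    (d_gt0 : (0 < d)%N)
    (M_diag : is_diag_mx M) (M_dil : @dilation R d M)
    (p_ge2 : (2%:E <= p)%E) (pq : (p^-1 + (q%:E)^-1 = 1)%E)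
    (N_ge0 : 0 <= N) (s_gt0 : 0 < s)
    (delta_gt0 : 0 < delta) (delta_lt : delta < 2^-1)
    (phitS : classS M N p phit) (phiB : classB M delta phi)
    (compat : weakly_compatible M s phi phit) :
  let m := @absdet R d M in
  let pinv := fine p^-1%E in
  (exists C : R, forall (f : 'cV[R]_d -> R[i]) (j : nat),
     besov M p (d%:R * pinv + N) f -> (0 < j)%N ->
     (Lpnorm p (fun x => (f x -
        Qop M j (distpair M delta p j f (phit j)) (phi j) x)%R)
      <= C%:E *
         ((opnorm (@MpowN R d M j) `^ s * Innorm M q s j f)%:E +
          multnorm q (phi j) * (m `^ (- (j%:R * (pinv + N / d%:R))))%:E *
          \sum_(j <= nu <oo) ((m `^ ((pinv + N / d%:R) * nu%:R))%:E *
             bestapprox (delta *: @Mpow R d M nu) p f)))%E) /\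
  (forall g : nat -> 'cV[R]_d -> R[i],
     classL M q g ->
     (forall j : nat, (0 < j)%N -> induced_by (g j) (phit j)) ->
     exists C : R, forall (f : 'cV[R]_d -> R[i]) (j : nat),
       inLp p f -> (0 < j)%N ->
       (Lpnorm p (fun x => (f x -
          Qop M j (funpair M j f (g j)) (phi j) x)%R)
        <= C%:E *
           ((opnorm (@MpowN R d M j) `^ s * Innorm M q s j f)%:E +
            multnorm q (phi j) * Lqjnorm M q j (g j) *
            bestapprox (delta *: @Mpow R d M j) p f))%E).
Proof.
have [pq' pinvE] := conjugate_exponentsP p_ge2 pq.
have [_ [Ct hCt] [CS hS]] := phitS.
have [phi_trig [r [Cp [r0 Cp0 hB]]]] := phiB.
have [cw hcw] := compat.
(* An integer above the radius of the class, so that the spectra of the phi j fit into boxes with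
   integer half-sides A |n|. *)
pose A := Num.bound r.
have rA : r < A%:R by exact/archi_boundP/ltW.
have n_neq0 j i : dgrid M j i != 0 by exact: (dgrid_neq0 M_diag M_dil).
have nR_neq0 j i : (dgrid M j i)%:~R != 0 :> R by rewrite intr_eq0.
have phi_supp j l : (0 < j)%N -> fourier (phi j) l != 0 ->
    forall i, (`|l i ord0| <= A * `|dgrid M j i|)%N.
  move=> j0 hl i; have [sp _] := hB j j0; have [y [yr _] yl] := sp l hl.
  have /colP/(_ i) := yl; rewrite (MspowE R M_diag) (Mpow_mul M_diag) mxE => e.
  have yA : `|y i ord0| <= A%:R.
    apply: le_trans (enorm_ge_coord y i) (ltW (lt_trans _ rA)).
    by move: yr; rewrite /eball /= subr0.
  have : `|(l i ord0)%:~R| <= A%:R * `|(dgrid M j i)%:~R| :> R.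
    by rewrite -e normrM mulrC ler_wpM2r.
  rewrite -!intr_norm -[A%:R]/(A%:Z%:~R) -intrM ler_int -!abszE.
  by rewrite -PoszM lez_nat.
have phi_gap j l v : (0 < j)%N -> enorm (@MpowN R d M j *m toR l) < delta -> v != 0 ->
    fourier (phi j) (l + gridmul (dgrid M j) v) = 0.
  move=> j0 hl v0; apply/eqP; apply: contraPT hl => hl.
  have [sp _] := hB j j0; have [y [_ yn] yl] := sp _ hl.
  move=> hlt; apply: yn; exists v => //; rewrite /eball /=.
  (* In rescaled coordinates l + n v is y, and its distance to the lattice point v is |M^-j l| <
     delta, a region excluded from the spectrum. *)
  suff -> : y - toR v = MpowN M j *m toR l by [].
  apply/colP => i; rewrite (MpowN_mul M_diag M_dil) !mxE.
  have /colP/(_ i) := yl; rewrite (MspowE R M_diag) (Mpow_mul M_diag) !mxE => e.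
  apply: (mulfI (nR_neq0 j i)); rewrite mulrBr e rmorphD rmorphM/= addrK.
  by rewrite mulrC divfK.
have phit0 j : (0 < j)%N -> normc (dfourier (phit j) 0) <= Ct.
  move=> j0; have [_] := hCt j 0 j0; apply; rewrite (MspowE R M_diag).
  apply/(D_ingrid M_diag M_dil)/ingridP => i.
  by rewrite !mxE mul0r oppr_le0 invr_ge0 ler0n invr_gt0 ltr0n.
have phi00 j : (0 < j)%N -> normc (fourier (phi j) 0) <= Cp.
  by move=> j0; have [_] := hB j j0; exact.
move=> m pinv; rewrite /pinv pinvE /m; split.
  exact: (Qop_distpair_error M_diag M_dil pq' phi_trig phi_supp hS p_ge2 delta_gt0
    delta_lt s_gt0 phi_gap hcw d_gt0 phit0).
move=> g gL gu.
exact: (Qop_funpair_error M_diag M_dil pq' phi_trig phi_supp hS p_ge2 delta_gt0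
  delta_lt s_gt0 phi_gap hcw phit0 phi00 gL gu).
Qed.
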